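(* Let $T>0$, $c_1>c_2>0$ and $0<a_1<a_2$. Put $$t^*:=\frac{a_2-a_1}{c_1-c_2},\qquad t_1:=\frac{a_1}{c_1},\qquad t_2:=\frac{a_2}{c_2},\qquad \tilde t:=\frac{a_2-2a_1}{c_2}.$$ For $N\in\mathbb{N}$ let $$\psi_T(N):=\mathbb{P}\left(\sup_{t\in[0,T]}\left(\sum_{k=1}^{N}B_k(t)-c_1Nt\right)>a_1N,\ \sup_{t\in[0,T]}\left(\sum_{k=1}^{N}B_k(t)-c_2Nt\right)>a_2N\right),$$ where $\{B_k(t):t\ge0\}$, $k=1,\dots,N$, are mutually independent standard Brownian motions. Suppose that $t^*<T$. Then the following hold as $N\to\infty$. (i,a) If $t^*<t_1$ and $T<t_1$, then $$\psi_T(N)=\frac{1}{\sqrt{2\pi}}\left(\frac{\sqrt{T}}{a_1+c_1T}+\frac{\sqrt{T}}{a_1-c_1T}\right)\frac{1}{\sqrt{N}}\,e^{-\frac{(a_1+c_1T)^2}{2T}N}(1+o(1)).$$ (i,b) If $t^*<t_1$ and $T=t_1$, then $$\psi_T(N)=\frac12\,e^{-2a_1c_1N}(1+o(1)).$$ (i,c) If $t^*<t_1$ and $T>t_1$, then $$\psi_T(N)=e^{-2a_1c_1N}(1+o(1)).$$ (ii) If $t_1=t^*$, then $$\psi_T(N)=\frac12\,e^{-2a_1c_1N}(1+o(1)).$$ (iii,a) If $t_1<t^*<t_2$ and $T<\tilde t$, then $$\psi_T(N)=\frac{1}{\sqrt{2\pi}}\left(\frac{\sqrt{T}}{(a_2-2a_1)-c_2T}-\frac{\sqrt{T}}{(2a_1-a_2)-c_2T}\right)\frac{1}{\sqrt{N}}\,e^{-\frac{(2a_1-a_2-c_2T)^2+4a_1c_1T}{2T}N}(1+o(1)).$$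 (iii,b) If $t_1<t^*<t_2$ and $T=\tilde t$, then $$\psi_T(N)=\frac12\,e^{-2(a_1(c_1-2c_2)+a_2c_2)N}(1+o(1)).$$ (iii,c) If $t_1<t^*<t_2$, $T>\tilde t$ and $\tilde t<t^*$, then $$\psi_T(N)=\frac{1}{\sqrt{2\pi}}\left(\frac{\sqrt{t^*}}{a_2-c_2t^*}+\frac{\sqrt{t^*}}{(2a_1-a_2)+c_2t^*}-\frac{\sqrt{t^*}}{a_1+c_1t^*}-\frac{\sqrt{t^*}}{a_1-c_1t^*}\right)\frac{1}{\sqrt{N}}\,e^{-\frac{(a_1+c_1t^* )^2}{2t^*}N}(1+o(1)).$$ (iii,d) If $t_1<t^*<t_2$, $T>\tilde t$ and $\tilde t=t^*$, then $$\psi_T(N)=\frac12\,e^{-2(a_1(c_1-2c_2)+a_2c_2)N}(1+o(1)).$$ (iii,e) If $t_1<t^*<t_2$, $T>\tilde t$ and $\tilde t>t^*$, then $$\psi_T(N)=e^{-2(a_1(c_1-2c_2)+a_2c_2)N}(1+o(1)).$$ (iv) If $t_1<t_2=t^*$, then $$\psi_T(N)=\frac12\,e^{-2a_2c_2N}(1+o(1)).$$ (v) If $t_2<t^*$, then $$\psi_T(N)=e^{-2a_2c_2N}(1+o(1)).$$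
   Context: $f(N)=g(N)(1+o(1))$ as $N\to\infty$ means $\lim_{N\to\infty}f(N)/g(N)=1$. Standard Brownian motions start at $0$. The number $t^*$ is the unique point of intersection of the lines $t\mapsto a_1+c_1t$ and $t\mapsto a_2+c_2t$. *)

(* Defs.v *)
From HB Require Import structures.
From mathcomp Require Import all_boot all_order all_algebra.
From mathcomp Require Import all_classical all_reals all_analysis.
Import Order.TTheory GRing.Theory Num.Theory.
Import numFieldNormedType.Exports.

Set Implicit Arguments.
Unset Strict Implicit.
Unset Printing Implicit Defensive.

Local Open Scope classical_set_scope.
Local Open Scope ring_scope.

Section brownian_motion.
Context {d : measure_display} {Omega : measurableType d} {R : realType}
  (P : probability Omega R).

(* The product rule is required for every finite subfamily, so [I] may be
   infinite. *)
Definition mutually_independent_systems {I : eqType}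
    (F : I -> set (set Omega)) : Prop :=
  forall (s : seq I) (A : I -> set Omega),
    uniq s -> (forall i, i \in s -> F i (A i)) ->
    P (\bigcap_(i in [set` s]) A i) = (\prod_(i <- s) fine (P (A i)))%:E.

Definition mutually_independent_RVs {I : eqType} (X : I -> Omega -> R) : Prop :=
  mutually_independent_systems
    (fun i => preimage_set_system setT (X i) measurable).

(* Processes are indexed by all of [R], but only the times [t >= 0] matter. *)
Definition process_sigma_algebra (W : R -> {RV P >-> R}) : set (set Omega) :=
  <<s \bigcup_(t in [set t | 0 <= t])
        preimage_set_system setT (W t) measurable >>.

Definition mutually_independent_processes {I : eqType}
    (W : I -> R -> {RV P >-> R}) : Prop :=
  mutually_independent_systems (fun i => process_sigma_algebra (W i)).

(* Start at 0 and path continuity are required for every outcome, so that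
   events about suprema of paths are measurable without completing [P].
   The second argument of [normal_prob] is the standard deviation. *)
Record standard_brownian_motion (W : R -> {RV P >-> R}) : Prop :=
  StandardBrownianMotion {
  sbm_start : forall w, W 0 w = 0 ;
  sbm_independent_increments : forall (n : nat) (t : nat -> R),
    0 <= t 0%N -> (forall i, (i < n)%N -> t i <= t i.+1) ->
    mutually_independent_RVs (fun i : 'I_n => W (t i.+1) \- W (t i)) ;
  sbm_gaussian_increments : forall s t : R, 0 <= s -> s < t ->
    forall U : set R, measurable U ->
      pushforward P (W t \- W s) U = normal_prob 0 (Num.sqrt (t - s)) U ;
  sbm_continuous_paths : forall w,
    {within [set t | 0 <= t], continuous (fun t : R => W t w)} }.

(* [B k] for [k = 0, ..., N - 1] stands for B_1, ..., B_N. *)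
Definition sup_exceeds (B : nat -> R -> {RV P >-> R})
    (T a c : R) (N : nat) : set Omega :=
  [set w | ((a * N%:R)%:E <
     ereal_sup [set (\sum_(k < N) B k t w - c * N%:R * t)%:E
               | t in `[0%R, T]])%E].

Definition psi (B : nat -> R -> {RV P >-> R})
    (a1 a2 c1 c2 T : R) (N : nat) : R :=
  fine (P (sup_exceeds B T a1 c1 N `&` sup_exceeds B T a2 c2 N)).

End brownian_motion.

Definition asymp_equiv {R : realType} (f g : nat -> R) : Prop :=
  f N / g N @[N --> \oo] --> (1 : R).

(* Main.v *)
Require Import Defs.
From HB Require Import structures.
From mathcomp Require Import all_boot all_order all_algebra.
From mathcomp Require Import all_classical all_reals all_analysis.
From mathcomp Require Import measurable_realfun ring lra zify.
Import Order.TTheory GRing.Theory Num.Theory.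
Import numFieldNormedType.Exports.

Set Implicit Arguments.
Unset Strict Implicit.
Unset Printing Implicit Defensive.

Local Open Scope classical_set_scope.
Local Open Scope ring_scope.

(** Write S for the sum of the N Brownian motions: run with the clock v = N u
    it is one standard Brownian motion, and psi is the probability that it goes
    above both lines a1 N + c1 v and a2 N + c2 v before the time N T.  The lines
    meet at v = N t^*, at the height N l with l = a1 + c1 t^* = a2 + c2 t^*.
    Before that time the second line is the higher one, afterwards the first
    is.  On the event that S is already above the meeting point at time t^*,
    both lines have been crossed.  On the complementary event V, crossing line 2
    before t^* forces a crossing of line 1, and crossing line 1 after t^* forces
    one of line 2, so both lines are crossed exactly when line 2 is crossed
    before t^*, or line 1 after t^*, or line 1 before and line 2 after t^*.
    Inclusion-exclusion gives ([psi_decomposition])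

      psi = T0 + (J2 - M22) + (M01 - M11) + M12,

    where T0 is the probability of the complement of V, and on V the term J2
    counts paths that cross line 2 before t^*, M01 those that cross line 1 after
    t^*, and Mij those that cross line i before and line j after t^*.  The same
    bookkeeping for a single line expresses the probability of crossing that
    line by such terms ([hit_decomposition1], [hit_decomposition2]).

    All terms are Gaussian integrals over the gap x > 0 between the line and S
    at time t^*.  A past crossing of line i contributes the factor
    exp (- 2 a_i x / t^* ), by the method of images, and a future crossing of
    line j contributes its probability, at most exp (- 2 c_j x).  A term is thus
    at most the integral over x > 0 of exp (- alpha x) against the Gaussian
    density centered at N l, where alpha = 2 a_i / t^* + 2 c_j without the
    summand of an absent crossing, and agrees with it to leading order when
    alpha t^* >= l ([tilted_le_recrossing]).  Such an
    integral is an exponential times a Gaussian tail, and Mills' ratio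
    ([mills]) yields its asymptotics: the rate is l^2 / (2 t^* ), with a factor
    1 / sqrt N if alpha t^* > l and the factor 1/2 if alpha t^* = l.  When
    alpha t^* < l the term may dominate, and it is expressed by the probability
    of crossing one line on the whole of [0, T]: line 1 in the case (i), line 2
    in the case (v), and in the cases (iii,a), (iii,b) and (iii,e) the line with
    intercept a2 - 2 a1 and slope c2, which is line 2 seen from the mirror image
    2 a1 N of the starting point ([recrossing_hit]).

    The probabilities of crossing are computed without stopping times.  On a
    finite grid of times, the path is followed step by step, and the method of
    images value [crossing] is compared with the true one at the first grid time
    where the gap is negative ([crossed_by_le], [crossed_by_ge]); path
    continuity and dyadic grids pass to continuous time ([integral_crosses],
    [probability_past_future]). *)

(** * Gaussian integrals and the heat semigroup *)

Section gaussian_kernel.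
Context {R : realType}.
Local Notation mu := (@lebesgue_measure R).

Lemma ge0_integral_lebesgue_shift (f : R -> \bar R) (a : R) :
  measurable_fun [set: R] f -> (forall x, 0 <= f x)%E ->
  (\int[mu]_x f (x + a)%R = \int[mu]_x f x)%E.
Proof.
move=> mf f0.
pose phi0 (x : measurableTypeR R) : measurableTypeR R := x + a.
have mphi : measurable_fun setT phi0 by exact: measurable_funD.
pose phiM := isMeasurableFun.Build _ _ _ _ _ mphi.
pose phi : {mfun measurableTypeR R >-> measurableTypeR R} := HB.pack phi0 phiM.
have eqm A : measurable A -> mu A = pushforward mu phi A.
  apply: lebesgue_measure_unique => //= _ [[b c]] _ <-.
  rewrite /pushforward/= [X in _ = mu X](_ : _ = `]b - a, c - a]%classic).
    rewrite !lebesgue_measure_itv/= !lte_fin ltrD2r; case: ifPn => // _.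
    by congr (_%:E); ring.
  by apply/seteqP; split => x/=; rewrite !in_itv/= ltrBlDr lerBrDr.
rewrite -[RHS](@eq_measure_integral _ _ _ setT _
    (pushforward mu phi)); last first.
  by move=> A mA _; exact/esym/eqm.
by rewrite ge0_integral_pushforward.
Qed.

Lemma ge0_integral_lebesgue_opp (f : R -> \bar R) :
  measurable_fun [set: R] f -> (forall x, 0 <= f x)%E ->
  (\int[mu]_x f (- x)%R = \int[mu]_x f x)%E.
Proof.
move=> mf f0.
rewrite -[RHS](@eq_measure_integral _ _ _ setT _
    (pushforward mu (-%R : _ -> measurableTypeR R))); last first.
  by move=> A mA _; exact: lebesgue_measureN.
by rewrite ge0_integral_pushforward.
Qed.

Definition gauss (v x : R) := expR (- x ^+ 2 / (2 * v)) / Num.sqrt (2 * pi * v).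

Lemma gauss_ge0 v x : 0 <= gauss v x.
Proof. by rewrite divr_ge0 ?expR_ge0 ?sqrtr_ge0. Qed.

Lemma measurable_gauss v : measurable_fun [set: R] (gauss v).
Proof.
apply: measurable_funM => //; apply: measurableT_comp => //.
by apply: measurable_funM => //; exact: measurableT_comp.
Qed.

Lemma measurable_gauss_shift v y : measurable_fun [set: R] (fun x => gauss v (x - y)).
Proof.
by apply: (measurableT_comp (measurable_gauss v)); exact: measurable_funB.
Qed.

Lemma gaussN v x : gauss v (- x) = gauss v x.
Proof. by rewrite /gauss sqrrN. Qed.

Lemma normal_pdf_gauss v y x : 0 < v ->
  normal_pdf y (Num.sqrt v) x = gauss v (x - y).
Proof.
move=> v0; rewrite normal_pdfE ?gt_eqF ?sqrtr_gt0//.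
rewrite /normal_peak /normal_fun sqr_sqrtr ?ltW// mulrC /gauss.
congr (expR (_ / _) / Num.sqrt _); first by rewrite mulr_natl.
by rewrite -mulr_natl; ring.
Qed.

Lemma integral_gauss v y : 0 < v -> (\int[mu]_x (gauss v (x - y))%:E = 1)%E.
Proof.
move=> v0; rewrite -[RHS](integral_normal_pdf y (Num.sqrt v)).
by apply: eq_integral => x _; rewrite normal_pdf_gauss.
Qed.

(** Completing the square: the product of two Gaussian densities in z is a
    Gaussian density in z times the density of the sum. *)
Lemma gauss_convolution v w x y z : 0 < v -> 0 < w ->
  gauss v (z - y) * gauss w (x - z) =
  gauss (v + w) (x - y) * gauss (v * w / (v + w)) (z - (w * y + v * x) / (v + w)).
Proof.
move=> v0 w0; have vw0 : 0 < v + w by exact: addr_gt0.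
rewrite /gauss mulrACA [RHS]mulrACA -!invfM -!expRD -!sqrtrM ?mulr_ge0 ?pi_ge0// ?ltW//.
congr (expR _ / Num.sqrt _); field; rewrite ?gt_eqF ?pi_gt0//=; lra.
Qed.

(** Completing the square: an exponential weight only shifts the mean. *)
Lemma gauss_tilt v g x y : v != 0 ->
  expR (- g * x) * gauss v (x - y) =
  expR (- g * y + g ^+ 2 * v / 2) * gauss v (x - (y - g * v)).
Proof.
move=> v0; rewrite /gauss !mulrA -!expRD; congr (expR _ / _).
by field.
Qed.

(** The expectation of f at y plus a centered normal variable of variance v. *)
Definition heat (v : R) (f : R -> \bar R) (y : R) : \bar R :=
  (\int[mu]_x (f x * (gauss v (x - y))%:E))%E.

Section heat.
Implicit Types (f g : R -> \bar R) (v w y : R).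

Lemma measurable_heat_integrand v f y : measurable_fun [set: R] f ->
  measurable_fun [set: R] (fun x => f x * (gauss v (x - y))%:E)%E.
Proof.
move=> mf; apply: emeasurable_funM => //; apply/measurable_EFinP.
exact: measurable_gauss_shift.
Qed.

Lemma heat_ge0 v f y : (forall x, 0 <= f x)%E -> (0 <= heat v f y)%E.
Proof.
by move=> f0; apply: integral_ge0 => x _; rewrite mule_ge0// lee_fin gauss_ge0.
Qed.

Lemma eq_heat v f g y : f =1 g -> heat v f y = heat v g y.
Proof. by move=> fg; apply: eq_integral => x _; rewrite fg. Qed.

Lemma le_heat v f g y : measurable_fun [set: R] f -> measurable_fun [set: R] g ->
  (forall x, 0 <= f x)%E -> (forall x, f x <= g x)%E ->
  (heat v f y <= heat v g y)%E.
Proof.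
move=> mf mg f0 fg; apply: ge0_le_integral => //.
- by move=> x _; rewrite mule_ge0// lee_fin gauss_ge0.
- exact: measurable_heat_integrand.
- exact: measurable_heat_integrand.
- by move=> x _; rewrite lee_wpmul2r// lee_fin gauss_ge0.
Qed.

Lemma heatD v f g y : measurable_fun [set: R] f -> measurable_fun [set: R] g ->
  (forall x, 0 <= f x)%E -> (forall x, 0 <= g x)%E ->
  heat v (fun x => f x + g x)%E y = (heat v f y + heat v g y)%E.
Proof.
move=> mf mg f0 g0; rewrite /heat.
under eq_integral do rewrite ge0_muleDl//.
rewrite ge0_integralD//.
- by move=> x _; rewrite mule_ge0// lee_fin gauss_ge0.
- exact: measurable_heat_integrand.
- by move=> x _; rewrite mule_ge0// lee_fin gauss_ge0.
- exact: measurable_heat_integrand.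
Qed.

Lemma heatZ v (k : R) f y : measurable_fun [set: R] f -> (forall x, 0 <= f x)%E ->
  0 <= k -> heat v (fun x => k%:E * f x)%E y = (k%:E * heat v f y)%E.
Proof.
move=> mf f0 k0; rewrite /heat -ge0_integralZl//.
- by apply: eq_integral => x _; rewrite muleA.
- exact: measurable_heat_integrand.
- by move=> x _; rewrite mule_ge0// lee_fin gauss_ge0.
Qed.

Lemma heat_cst v (k : R) y : 0 < v -> 0 <= k -> heat v (fun=> k%:E) y = k%:E.
Proof.
move=> v0 k0; rewrite /heat ge0_integralZl//.
- by rewrite integral_gauss// mule1.
- by apply/measurable_EFinP; exact: measurable_gauss_shift.
- by move=> x _; rewrite lee_fin gauss_ge0.
Qed.

Lemma measurable_gauss2 v :
  measurable_fun [set: R * R] (fun p => gauss v (p.2 - p.1)).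
Proof.
apply: (measurableT_comp (measurable_gauss v)).
by apply: measurable_funB; [exact: measurable_snd|exact: measurable_fst].
Qed.

Lemma measurable_heat v f : measurable_fun [set: R] f -> (forall x, 0 <= f x)%E ->
  measurable_fun [set: R] (heat v f).
Proof.
move=> mf f0.
apply: (@measurable_fun_fubini_tonelli_F _ _ _ _ _ mu
  (fun p : R * R => f p.2 * (gauss v (p.2 - p.1))%:E)%E).
- apply: emeasurable_funM; last by apply/measurable_EFinP; exact: measurable_gauss2.
  by apply: (measurableT_comp mf); exact: measurable_snd.
- by move=> p; rewrite mule_ge0// lee_fin gauss_ge0.
Qed.

Lemma heat_semigroup v w f y : 0 < v -> 0 < w ->
  measurable_fun [set: R] f -> (forall x, 0 <= f x)%E ->
  heat v (heat w f) y = heat (v + w) f y.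
Proof.
move=> v0 w0 mf f0; rewrite {1}/heat.
transitivity (\int[mu]_z \int[mu]_x
    (f x * (gauss w (x - z) * gauss v (z - y))%:E))%E.
  apply: eq_integral => z _; rewrite muleC /heat -ge0_integralZl//.
  - by apply: eq_integral => x _; rewrite EFinM muleCA; congr (_ * _)%E; exact: muleC.
  - exact: measurable_heat_integrand.
  - by move=> x _; rewrite mule_ge0// lee_fin gauss_ge0.
  - by rewrite lee_fin gauss_ge0.
rewrite (@fubini_tonelli _ _ _ _ _ mu mu (fun p : R * R =>
   f p.2 * (gauss w (p.2 - p.1) * gauss v (p.1 - y))%:E)%E) /=; last 2 first.
- apply: emeasurable_funM.
    by apply: (measurableT_comp mf); exact: measurable_snd.
  apply/measurable_EFinP; apply: measurable_funM; first exact: measurable_gauss2.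
  apply: (measurableT_comp (measurable_gauss v)).
  by apply: measurable_funB => //; exact: measurable_fst.
- by move=> p; rewrite mule_ge0// lee_fin mulr_ge0// gauss_ge0.
apply: eq_integral => x _.
under eq_integral do rewrite [(gauss w _ * _)%R]mulrC gauss_convolution// EFinM muleA.
rewrite ge0_integralZl//.
- by rewrite integral_gauss ?mule1// divr_gt0 ?mulr_gt0 ?addr_gt0.
- by apply/measurable_EFinP; exact: measurable_gauss_shift.
- by move=> z _; rewrite lee_fin gauss_ge0.
- by rewrite mule_ge0// lee_fin gauss_ge0.
Qed.

Lemma heat_shift v f a y : measurable_fun [set: R] f -> (forall x, 0 <= f x)%E ->
  heat v (fun x => f (x + a)) y = heat v f (y + a).
Proof.
move=> mf f0; rewrite /heat -[RHS](@ge0_integral_lebesgue_shift _ a).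
- by apply: eq_integral => x _; do 3 f_equal; ring.
- exact: measurable_heat_integrand.
- by move=> x; rewrite mule_ge0// lee_fin gauss_ge0.
Qed.

Lemma heat_opp v f y : measurable_fun [set: R] f -> (forall x, 0 <= f x)%E ->
  heat v (fun x => f (- x)) y = heat v f (- y).
Proof.
move=> mf f0; rewrite /heat -[RHS]ge0_integral_lebesgue_opp.
- by apply: eq_integral => x _; rewrite -gaussN; do 3 f_equal; ring.
- exact: measurable_heat_integrand.
- by move=> x; rewrite mule_ge0// lee_fin gauss_ge0.
Qed.

Lemma heat_tilt v (g : R) f y : 0 < v -> measurable_fun [set: R] f ->
  (forall x, 0 <= f x)%E ->
  heat v (fun x => (expR (- g * x))%:E * f x)%E y =
  ((expR (- g * y + g ^+ 2 * v / 2))%:E * heat v f (y - g * v))%E.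
Proof.
move=> v0 mf f0; rewrite /heat -ge0_integralZl//.
- apply: eq_integral => x _.
  by rewrite -muleA muleCA -EFinM gauss_tilt ?gt_eqF// EFinM muleCA.
- exact: measurable_heat_integrand.
- by move=> x _; rewrite mule_ge0// lee_fin gauss_ge0.
Qed.

Lemma heat_expR v (g : R) y : 0 < v ->
  heat v (fun x => (expR (- g * x))%:E) y = (expR (- g * y + g ^+ 2 * v / 2))%:E.
Proof.
move=> v0; transitivity (heat v (fun x => (expR (- g * x))%:E * 1%:E)%E y).
  by apply: eq_heat => x; rewrite mule1.
by rewrite heat_tilt// heat_cst// mule1.
Qed.

End heat.

End gaussian_kernel.

(** * Images across a line *)

Section reflection.
Context {R : realType}.
Local Notation mu := (@lebesgue_measure R).
Implicit Types (f g : R -> \bar R) (c v w y e : R).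

Definition below f x : \bar R := if x < 0 then f x else 0%E.
Definition above f x : \bar R := if 0 <= x then f x else 0%E.

Lemma below_ge0 f : (forall x, 0 <= f x)%E -> forall x, (0 <= below f x)%E.
Proof. by move=> f0 x; rewrite /below; case: ifP. Qed.

Lemma above_ge0 f : (forall x, 0 <= f x)%E -> forall x, (0 <= above f x)%E.
Proof. by move=> f0 x; rewrite /above; case: ifP. Qed.

Lemma measurable_below f : measurable_fun [set: R] f ->
  measurable_fun [set: R] (below f).
Proof. by move=> mf; apply: measurable_fun_ifT => //; exact: measurable_fun_ltr. Qed.

Lemma measurable_above f : measurable_fun [set: R] f ->
  measurable_fun [set: R] (above f).
Proof. by move=> mf; apply: measurable_fun_ifT => //; exact: measurable_fun_ler. Qed.

Lemma measurable_comp_opp f : measurable_fun [set: R] f ->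
  measurable_fun [set: R] (fun x => f (- x)).
Proof. by move=> mf; apply: (measurableT_comp mf). Qed.

Lemma measurable_comp_shift f e : measurable_fun [set: R] f ->
  measurable_fun [set: R] (fun x => f (x + e)).
Proof. by move=> mf; apply: (measurableT_comp mf); exact: measurable_funD. Qed.

Lemma measurable_expR_lin (g : R) :
  measurable_fun [set: R] (fun x : R => (expR (- g * x))%:E).
Proof.
by apply/measurable_EFinP; apply: measurableT_comp => //; exact: measurable_funM.
Qed.

(** The origin is Lebesgue-negligible; this frees the statements on images
    from conventions at the barrier. *)
Lemma heat_eq_off0 v f g y : measurable_fun [set: R] f ->
  measurable_fun [set: R] g ->
  (forall x, 0 <= f x)%E -> (forall x, 0 <= g x)%E ->
  (forall x : R, x != 0 -> f x = g x) -> heat v f y = heat v g y.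
Proof.
move=> mf mg f0 g0 fg; rewrite /heat.
have hyp (h : R -> \bar R) : measurable_fun [set: R] h -> (forall x, 0 <= h x)%E ->
    (\int[mu]_x (h x * (gauss v (x - y))%:E) =
     \int[mu]_(x in setT `\` [set (0%R : R)]) (h x * (gauss v (x - y))%:E))%E.
  move=> mh h0; apply: ge0_negligible_integral => //.
  - exact: measurable_heat_integrand.
  - by move=> x _; rewrite mule_ge0// lee_fin gauss_ge0.
  - exact: lebesgue_measure_set1.
rewrite hyp// [RHS]hyp//; apply: eq_integral => x.
by rewrite inE/= => -[_ /eqP x0]; rewrite fg.
Qed.

(** The image charges of f for paths of drift c and the barrier 0: the part of f
    on the positive side is mirrored with the density of the reflected path. *)
Definition reflected c f x : \bar R :=
  below (fun z => f z + (expR (- (2 * c) * z))%:E * f (- z)%R)%E x.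

Lemma reflected_ge0 c f : (forall x, 0 <= f x)%E ->
  forall x, (0 <= reflected c f x)%E.
Proof.
by move=> f0; apply: below_ge0 => x; rewrite adde_ge0// mule_ge0// lee_fin expR_ge0.
Qed.

Lemma measurable_reflected c f : measurable_fun [set: R] f ->
  measurable_fun [set: R] (reflected c f).
Proof.
move=> mf; apply: measurable_below; apply: emeasurable_funD => //.
apply: emeasurable_funM; first exact: measurable_expR_lin.
exact: measurable_comp_opp.
Qed.

(** For a path started at y >= 0 with drift c, the expectation of f at time v
    on the event that the path has been negative, computed by images. *)
Definition crossing c v f y := heat v (reflected c f) (y + c * v).

Lemma crossing_ge0 c v f y : (forall x, 0 <= f x)%E -> (0 <= crossing c v f y)%E.
Proof. by move=> f0; apply: heat_ge0; exact: reflected_ge0. Qed.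

Lemma measurable_crossing c v f : measurable_fun [set: R] f ->
  (forall x, 0 <= f x)%E -> measurable_fun [set: R] (crossing c v f).
Proof.
move=> mf f0; apply: measurable_comp_shift; apply: measurable_heat.
  exact: measurable_reflected.
exact: reflected_ge0.
Qed.

(** A change of sign of the variable turns the mirrored part into an integral over the
    positive half-line, centered at the mirror image of the start. *)
Lemma crossingE c v f y : 0 < v -> measurable_fun [set: R] f ->
  (forall x, 0 <= f x)%E ->
  crossing c v f y = (heat v (below f) (y + c * v) +
     (expR (- (2 * c) * y))%:E * heat v (above f) (c * v - y))%E.
Proof.
move=> v0 mf f0.
have mE := measurable_expR_lin (2 * c).
have mafN : measurable_fun [set: R] (fun x => above f (- x)).
  by apply: measurable_comp_opp; exact: measurable_above.
have af0 x : (0 <= above f x)%E by exact: above_ge0.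
have e0 x : (0 <= (expR (- (2 * c) * x))%:E)%E by rewrite lee_fin expR_ge0.
rewrite /crossing (@heat_eq_off0 _ _ (fun x => below f x +
    (expR (- (2 * c) * x))%:E * above f (- x)%R)%E).
- rewrite heatD//; last 4 first.
  + exact: measurable_below.
  + exact: emeasurable_funM.
  + exact: below_ge0.
  + by move=> x; rewrite mule_ge0.
  rewrite (heat_tilt (2 * c) (y + c * v) v0 mafN) => [|x]; last exact: af0.
  rewrite (@heat_opp _ v (above f) _ (measurable_above mf) af0).
  have -> : - (y + c * v - 2 * c * v) = c * v - y by ring.
  have -> // : - (2 * c) * (y + c * v) + (2 * c) ^+ 2 * v / 2 = - (2 * c) * y.
  by field.
- exact: measurable_reflected.
- by apply: emeasurable_funD; [exact: measurable_below|exact: emeasurable_funM].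
- exact: reflected_ge0.
- by move=> x; rewrite adde_ge0// ?mule_ge0// below_ge0.
- move=> x x0; rewrite /reflected /below /above oppr_ge0.
  by case: ltgtP x0 => //; rewrite mule0 adde0.
Qed.

Lemma gauss_reflection c v x y : v != 0 ->
  expR (- (2 * c) * y) * gauss v (x - (c * v - y)) =
  expR (- (2 * y / v) * x) * gauss v (x - (y + c * v)).
Proof.
by move=> v0; rewrite /gauss !mulrA -!expRD; congr (expR _ / _); field.
Qed.

Lemma heat_split v f y : measurable_fun [set: R] f -> (forall x, 0 <= f x)%E ->
  heat v f y = (heat v (below f) y + heat v (above f) y)%E.
Proof.
move=> mf f0; rewrite -heatD//; first last.
- exact: above_ge0.
- exact: below_ge0.
- exact: measurable_above.
- exact: measurable_below.
apply: eq_heat => x; rewrite /below /above.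
by case: ltP => _; rewrite (adde0, add0e).
Qed.

(** The mirrored start is traded for the true one at the price of an
    exponential weight in the final value. *)
Lemma heat_image c v f y : 0 < v -> measurable_fun [set: R] f ->
  (forall x, 0 <= f x)%E ->
  ((expR (- (2 * c) * y))%:E * heat v f (c * v - y))%E =
  heat v (fun x => (expR (- (2 * y / v) * x))%:E * f x)%E (y + c * v).
Proof.
move=> v0 mf f0; rewrite /heat -ge0_integralZl//.
- apply: eq_integral => x _.
  by rewrite muleCA -EFinM gauss_reflection ?gt_eqF// EFinM muleA (muleC (f x)).
- exact: measurable_heat_integrand.
- by move=> x _; rewrite mule_ge0// lee_fin gauss_ge0.
Qed.

(** From a negative start the path has already crossed, and the image value
    is at least the free expectation: the two sides differ by an integral over the
    positive half-line against the density started at y minus the mirrored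
    one, whose sign is that of y. *)
Lemma heat_le_crossing c v f y : 0 < v -> measurable_fun [set: R] f ->
  (forall x, 0 <= f x)%E -> y <= 0 ->
  (heat v f (y + c * v) <= crossing c v f y)%E.
Proof.
move=> v0 mf f0 y0; rewrite crossingE// heat_split// leeD2l// heat_image//; last 2 first.
- exact: measurable_above.
- exact: above_ge0.
apply: le_heat.
- exact: measurable_above.
- by apply: emeasurable_funM; [exact: measurable_expR_lin|exact: measurable_above].
- exact: above_ge0.
- move=> x; rewrite /above; case: ifPn => x0; last by rewrite mule0.
  rewrite lee_pemull// lee_fin -expR0 ler_expR mulr_ge0//.
  by rewrite oppr_ge0 pmulr_lle0 ?invr_gt0// pmulr_rle0.
Qed.

Lemma crossing_le_heat c v f y : 0 < v -> measurable_fun [set: R] f ->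
  (forall x, 0 <= f x)%E -> 0 <= y ->
  (crossing c v f y <= heat v f (y + c * v))%E.
Proof.
move=> v0 mf f0 y0; rewrite crossingE// [leRHS]heat_split// leeD2l// heat_image//; last 2 first.
- exact: measurable_above.
- exact: above_ge0.
apply: le_heat.
- by apply: emeasurable_funM; [exact: measurable_expR_lin|exact: measurable_above].
- exact: measurable_above.
- by move=> x; rewrite mule_ge0 ?above_ge0// lee_fin expR_ge0.
- move=> x; rewrite /above; case: ifPn => x0; last by rewrite mule0.
  rewrite -[leRHS]mul1e lee_wpmul2r// lee_fin -expR0 ler_expR.
  by rewrite mulNr oppr_le0 mulr_ge0// divr_ge0 ?mulr_ge0// ltW.
Qed.

(** Chapman-Kolmogorov: a crossing value is itself a heat integral. *)
Lemma crossing_step c v w f y : 0 < v -> 0 < w -> measurable_fun [set: R] f ->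
  (forall x, 0 <= f x)%E ->
  heat w (crossing c v f) (y + c * w) = crossing c (w + v) f y.
Proof.
move=> v0 w0 mf f0; rewrite /crossing.
have mr := measurable_reflected c mf; have r0 := reflected_ge0 c f0.
rewrite heat_shift; [|exact: measurable_heat|by move=> x; exact: heat_ge0].
have -> : y + c * (w + v) = y + c * w + c * v by ring.
by rewrite heat_semigroup.
Qed.

Lemma reflected_le_expR c f x : 0 <= c -> (forall x, f x <= 1)%E ->
  (reflected c f x <= (2 * expR (- (2 * c) * x))%:E)%E.
Proof.
move=> c0 f1; rewrite /reflected /below; case: ifPn => x0; last first.
  by rewrite lee_fin mulr_ge0 ?expR_ge0.
set E := expR _.
have -> : 2 * E = E + E by rewrite mulr_natl mulr2n.
rewrite [leRHS]EFinD leeD//; last first.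
  by rewrite -[leRHS]mule1 lee_wpmul2l// lee_fin expR_ge0.
rewrite /E (le_trans (f1 _))// lee_fin -expR0 ler_expR.
by rewrite mulNr oppr_ge0 mulr_ge0_le0// ?mulr_ge0// ltW.
Qed.

Lemma crossing_le_expR c v f y : 0 < v -> 0 <= c -> measurable_fun [set: R] f ->
  (forall x, 0 <= f x)%E -> (forall x, f x <= 1)%E ->
  (crossing c v f y <= (2 * expR (- (2 * c) * y))%:E)%E.
Proof.
move=> v0 c0 mf f0 f1.
have mE : measurable_fun [set: R] (fun x : R => 2%:E * (expR (- (2 * c) * x))%:E)%E.
  by apply: emeasurable_funM => //; exact: measurable_expR_lin.
apply: (@le_trans _ _ (heat v (fun x => 2%:E * (expR (- (2 * c) * x))%:E)%E (y + c * v))).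
  apply: le_heat => //; first exact: measurable_reflected.
    exact: reflected_ge0.
  by move=> x; rewrite -EFinM; exact: reflected_le_expR.
rewrite (heatZ v _ (measurable_expR_lin (2 * c)))//.
rewrite heat_expR// -EFinM lee_fin ler_pM2l// ler_expR.
by rewrite le_eqVlt; apply/orP; left; apply/eqP; field.
Qed.

(** Dominates the crossing value when the gap y at the first negative grid time lies
    beyond -e; [heat_overshoot] shows that one small step rarely jumps so far. *)
Definition overshoot c e x : \bar R :=
  (if x < - e then 2 * expR (- (2 * c) * (x + e)) else 0)%:E.

Lemma measurable_overshoot c e : measurable_fun [set: R] (overshoot c e).
Proof.
apply/measurable_EFinP; apply: measurable_fun_ifT => //.
  exact: measurable_fun_ltr.
apply: measurable_funM => //; apply: measurableT_comp => //.
by apply: measurable_funM => //; exact: measurable_funD.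
Qed.

Lemma overshoot_ge0 c e x : (0 <= overshoot c e x)%E.
Proof. by rewrite lee_fin; case: ifP => // _; rewrite mulr_ge0 ?expR_ge0. Qed.

(** Chernoff bound with exponent e / v, which the condition on the step makes
    at least 2 c. *)
Lemma heat_overshoot c e v y : 0 < v -> 0 <= c -> 2 * c * v <= e -> 0 <= y ->
  (heat v (overshoot c e) (y + c * v) <= (2 * expR (- e ^+ 2 / (2 * v)))%:E)%E.
Proof.
move=> v0 c0 cve y0; set g := e / v.
have e0 : 0 <= e by rewrite (le_trans _ cve)// !mulr_ge0// ltW.
have g2c : 2 * c <= g by rewrite /g ler_pdivlMr.
have mE : measurable_fun [set: R] (fun x : R => (2 * expR (- g * e))%:E * (expR (- g * x))%:E)%E.
  by apply: emeasurable_funM => //; exact: measurable_expR_lin.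
apply: (@le_trans _ _ (heat v
   (fun x => (2 * expR (- g * e))%:E * (expR (- g * x))%:E)%E (y + c * v))).
  apply: le_heat => //; first exact: measurable_overshoot.
    exact: overshoot_ge0.
  move=> x; rewrite -EFinM lee_fin; case: ifPn => xe; last first.
    by rewrite !mulr_ge0 ?expR_ge0.
  rewrite -(mulrA 2) -expRD ler_pM2l// ler_expR -mulrDr addrC.
  rewrite !mulNr lerN2; apply: ler_wnM2r => //; lra.
rewrite (heatZ v _ (measurable_expR_lin g)) ?mulr_ge0 ?expR_ge0//.
rewrite heat_expR// -EFinM lee_fin -(mulrA 2) ler_pM2l// -expRD ler_expR.
have -> : - g * e + (- g * (y + c * v) + g ^+ 2 * v / 2) =
   - e ^+ 2 / (2 * v) - g * (y + c * v).
  by rewrite /g; field; rewrite gt_eqF.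
rewrite lerBlDr lerDl mulr_ge0//; last by rewrite addr_ge0// mulr_ge0// ltW.
by rewrite divr_ge0// ltW.
Qed.

End reflection.

(** * Continuity and exponential bounds for crossings *)

Section continuity.
Context {R : realType}.
Local Notation mu := (@lebesgue_measure R).
Implicit Types (f g : R -> \bar R) (c v w y e : R).

Local Notation one := (fun=> 1%E : \bar R).

Lemma ge0_nondecreasing_cvg_integral_in d (T : measurableType d)
    (m : {measure set T -> \bar R}) (D : set T) (u : (T -> \bar R)^nat) (f : T -> \bar R) :
  measurable D ->
  (forall n, measurable_fun [set: T] (u n)) -> (forall n x, 0 <= u n x)%E ->
  (forall x, nondecreasing_seq (u ^~ x)) -> (forall x, u n x @[n --> \oo] --> f x) ->
  (\int[m]_(x in D) u n x)%E @[n --> \oo] --> (\int[m]_(x in D) f x)%E.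
Proof.
move=> mD mu0 u0 ndu uf.
rewrite (_ : (\int[m]_(x in D) f x)%E = (\int[m]_(x in D) (limn (u ^~ x)))%E).
  apply: cvg_monotone_convergence.
  - exact: mD.
  - by move=> n; exact: measurable_funTS.
  - by move=> n x _; exact: u0.
  - by move=> x _; exact: ndu.
by apply: eq_integral => x _; apply/esym/cvg_lim => //; exact: uf.
Qed.

Lemma ge0_nondecreasing_cvg_integral d (T : measurableType d)
    (m : {measure set T -> \bar R}) (u : (T -> \bar R)^nat) (f : T -> \bar R) :
  (forall n, measurable_fun [set: T] (u n)) -> (forall n x, 0 <= u n x)%E ->
  (forall x, nondecreasing_seq (u ^~ x)) -> (forall x, u n x @[n --> \oo] --> f x) ->
  (\int[m]_x u n x)%E @[n --> \oo] --> (\int[m]_x f x)%E.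
Proof. exact: ge0_nondecreasing_cvg_integral_in. Qed.

Lemma mule_def1 (x : \bar R) : (1 *? x)%E.
Proof. by rewrite mule_defE onee_eq0/= andbF. Qed.

Lemma cvg_expR_to1 (u : nat -> R) : u n @[n --> \oo] --> (0 : R) ->
  (expR (u n))%:E @[n --> \oo] --> 1%E.
Proof.
move=> u0; apply: cvg_EFin; first by near=> n.
rewrite -expR0; apply: continuous_cvg => //; exact: continuous_expR.
Unshelve. all: by end_near. Qed.

(** A shift of the center amounts to an exponential weight, by the Gaussian tilt, and
    the weights increase to 1; monotone convergence applies. *)
Lemma heat_above_cvg v f m (k : R) : 0 < v -> 0 <= k ->
  measurable_fun [set: R] f -> (forall x, 0 <= f x)%E ->
  heat v (above f) (m - k * n.+1%:R^-1) @[n --> \oo] --> heat v (above f) m.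
Proof.
move=> v0 k0 mf f0.
have maf : measurable_fun [set: R] (above f) by exact: measurable_above.
have af0 x : (0 <= above f x)%E by exact: above_ge0.
pose g n := k * n.+1%:R^-1 / v : R.
have heatE n : heat v (above f) (m - k * n.+1%:R^-1) =
    ((expR (g n * m - g n ^+ 2 * v / 2))%:E *
     heat v (fun x => (expR (- g n * x))%:E * above f x) m)%E.
  rewrite heat_tilt// muleA -EFinM -expRD.
  have -> : g n * m - g n ^+ 2 * v / 2 + (- g n * m + g n ^+ 2 * v / 2) = 0 by ring.
  by rewrite expR0 mul1e /g divfK ?gt_eqF.
under eq_fun do rewrite heatE.
have g_cvg0 : g n @[n --> \oo] --> (0 : R).
  rewrite -[X in _ --> X](mul0r (v^-1)); apply: cvgMl.
  by rewrite -[X in _ --> X](mulr0 k); apply: cvgMr; exact: cvg_harmonic.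
have e_cvg1 : (expR (g n * m - g n ^+ 2 * v / 2))%:E @[n --> \oo] --> 1%E.
  apply: cvg_expR_to1.
  have -> : (0 : R) = 0 * m - 0 * 0 * v / 2 by ring.
  apply: cvgB; first by apply: cvgMl.
  by apply: cvgMl; apply: cvgMl; apply: cvgM.
have h_cvg : heat v (fun x => (expR (- g n * x))%:E * above f x)%E m @[n --> \oo]
    --> heat v (above f) m.
  have g0 n : 0 <= g n by rewrite /g !mulr_ge0 ?invr_ge0// ltW.
  apply: ge0_nondecreasing_cvg_integral.
  - move=> n; apply: measurable_heat_integrand; apply: emeasurable_funM => //.
    exact: measurable_expR_lin.
  - by move=> n x; rewrite !mule_ge0// lee_fin ?expR_ge0 ?gauss_ge0.
  - move=> x n n' nn'; rewrite lee_wpmul2r// ?lee_fin ?gauss_ge0//.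
    rewrite /above; case: ifPn => x0; last by rewrite !mule0.
    rewrite lee_wpmul2r// lee_fin ler_expR ler_wpM2r// lerN2.
    rewrite /g ler_wpM2r ?invr_ge0 ?(ltW v0)// ler_wpM2l//.
    by rewrite lef_pV2 ?posrE// ler_nat.
  - move=> x; rewrite -[X in _ --> X]mul1e.
    under eq_fun do rewrite -muleA.
    apply: cvgeM; [exact: mule_def1| |exact: cvg_cst].
    apply: cvg_expR_to1; have -> : (0 : R) = - 0 * x by ring.
    by apply: cvgMl; apply: cvgN.
by rewrite -[heat v (above f) m]mul1e; apply: cvgeM => //; exact: mule_def1.
Qed.

Lemma heat_below_above v y : 
  heat v (below one) y = heat v (above one) (- y).
Proof.
rewrite -heat_opp//; [|exact: measurable_above|exact: above_ge0].
apply: heat_eq_off0.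
- exact: measurable_below.
- by apply: measurable_comp_opp; exact: measurable_above.
- exact: below_ge0.
- by move=> x; exact: above_ge0.
- by move=> x; rewrite /below /above oppr_ge0; case: ltgtP.
Qed.

(** When f lives on the positive half-line only the mirrored term is left. *)
Lemma crossing_aboveE c v f y : 0 < v -> measurable_fun [set: R] f ->
  (forall x, 0 <= f x)%E -> crossing c v (above f) y =
    ((expR (- (2 * c) * y))%:E * heat v (above f) (c * v - y))%E.
Proof.
move=> v0 mf f0; rewrite crossingE//; [|exact: measurable_above|exact: above_ge0].
rewrite (@eq_heat _ _ (below _) (fun=> 0%E)).
  rewrite (@heat_cst _ v 0)// add0e.
  by have -> : above (above f) = above f by apply/funext => x; rewrite /above; case: leP.
by move=> x; rewrite /below /above; case: ltP => // /lt_geF ->.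
Qed.

Lemma crossing1_cvg c v y : 0 < v ->
  crossing c v one (y + n.+1%:R^-1) @[n --> \oo] --> crossing c v one y.
Proof.
move=> v0; rewrite crossingE//.
under eq_fun do rewrite crossingE//.
rewrite heat_below_above.
apply: cvgeD.
- by rewrite ge0_adde_def// inE ?heat_ge0 ?mule_ge0 ?lee_fin ?expR_ge0 ?heat_ge0//;
    exact: above_ge0.
- under eq_fun do rewrite heat_below_above.
  rewrite (_ : (fun n => _) = (fun n => heat v (above one) (- (y + c * v) - 1 * n.+1%:R^-1))).
    exact: heat_above_cvg.
  by apply/funext => n; congr heat; ring.
- rewrite (_ : (fun n => _) = (fun n => (expR (- (2 * c) * (y + n.+1%:R^-1)))%:E *
      heat v (above one) (c * v - y - 1 * n.+1%:R^-1)))%E; last first.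
    by apply/funext => n; rewrite opprD addrA mul1r.
  have e_cvg : (expR (- (2 * c) * (y + n.+1%:R^-1)))%:E @[n --> \oo] -->
      (expR (- (2 * c) * y))%:E.
    apply: cvg_EFin; first by near=> n.
    apply: continuous_cvg; first exact: continuous_expR.
    apply: cvgMr; rewrite -[X in _ --> X]addr0; apply: cvgD; first exact: cvg_cst.
    exact: cvg_harmonic.
  apply: cvgeM => //; last exact: heat_above_cvg.
  by rewrite mule_defE eqe expR_eq0/= andbF.
Unshelve. all: by end_near. Qed.

Lemma crossing_shift_above c v f y e : 0 < v -> 0 <= e ->
  measurable_fun [set: R] f -> (forall x, 0 <= f x)%E ->
  crossing c v (fun x => above f (x - e)) (y + e) =
  ((expR (- (2 * c) * (y + e)))%:E * heat v (above f) (c * v - y - 2 * e))%E.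
Proof.
move=> v0 e0 mf f0.
have mE : measurable_fun [set: R] (fun x => above f (x - e)).
  by apply: measurable_comp_shift; exact: measurable_above.
have above_shift : above (fun x => above f (x - e)) = (fun x => above f (x - e)).
  apply/funext => x; rewrite /above subr_ge0; case: (leP 0 x) => // x0.
  by rewrite leNgt (lt_le_trans x0).
have s0 x : (0 <= above f (x - e)%R)%E by exact: above_ge0.
rewrite -above_shift (crossing_aboveE c _ v0 mE s0) above_shift.
rewrite heat_shift; [|exact: measurable_above|exact: above_ge0].
by have -> : c * v - (y + e) - e = c * v - y - 2 * e by ring.
Qed.

Lemma crossing_above_le_lim c v f y (X : \bar R) : 0 < v ->
  measurable_fun [set: R] f -> (forall x, 0 <= f x)%E ->
  (forall n, crossing c v (fun x => above f (x - n.+1%:R^-1)%R) (y + n.+1%:R^-1)%R <= X)%E ->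
  (crossing c v (above f) y <= X)%E.
Proof.
move=> v0 mf f0 leX.
have e_cvg : (expR (- (2 * c) * (y + n.+1%:R^-1)))%:E @[n --> \oo] -->
    (expR (- (2 * c) * y))%:E.
  apply: cvg_EFin; first by near=> n.
  apply: continuous_cvg; first exact: continuous_expR.
  apply: cvgMr; rewrite -[X in _ --> X]addr0; apply: cvgD; first exact: cvg_cst.
  exact: cvg_harmonic.
have h_cvg := @heat_above_cvg v f (c * v - y) 2 v0 (ler0n _ 2) mf f0.
have cv : ((expR (- (2 * c) * (y + n.+1%:R^-1)))%:E *
    heat v (above f) (c * v - y - 2 * n.+1%:R^-1))%E @[n --> \oo] -->
    crossing c v (above f) y.
  rewrite crossing_aboveE//; apply: cvgeM => //.
  by rewrite mule_defE eqe expR_eq0/= andbF.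
rewrite -(cvg_lim _ cv)//; apply: lime_le; first by apply/cvg_ex; eexists; exact: cv.
near=> n.
by rewrite -crossing_shift_above.
Unshelve. all: by end_near. Qed.

Lemma crossing1_nincr c v y e : 0 < v -> 0 <= c -> 0 <= e ->
  (crossing c v one (y + e) <= crossing c v one y)%E.
Proof.
move=> v0 c0 e0; rewrite /crossing (_ : y + e + c * v = y + c * v + e); last by ring.
have mr : measurable_fun [set: R] (reflected c one) by exact: measurable_reflected.
have r0 := @reflected_ge0 _ c one (fun=> lee01).
rewrite -(heat_shift v e _ mr r0); apply: le_heat => //; first exact: measurable_comp_shift.
move=> x; rewrite /reflected /below; case: ifPn => xe; last first.
  by case: ifPn => // x0; rewrite !mule1 lee_fin addr_ge0// expR_ge0.
have -> : x < 0 by rewrite (le_lt_trans _ xe)// lerDl.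
rewrite !mule1 lee_fin lerD2l ler_expR !mulNr lerN2 ler_wpM2l ?mulr_ge0//.
by rewrite lerDl.
Qed.

Lemma crossing1_split c v y : 0 < v ->
  crossing c v one y = (heat v (below one) (y + c * v) +
    heat v (below (fun x => (expR (- (2 * c) * x))%:E)) (y + c * v))%E.
Proof.
move=> v0; rewrite -heatD//.
- by apply: eq_heat => x; rewrite /reflected /below; case: ifP => _; rewrite ?mule1 ?adde0.
- exact: measurable_below.
- by apply: measurable_below; exact: measurable_expR_lin.
- exact: below_ge0.
- by apply: below_ge0 => x; rewrite lee_fin expR_ge0.
Qed.

Lemma expR_split c v y : 0 < v ->
  (expR (- (2 * c) * y))%:E =
  (heat v (above (fun x => (expR (- (2 * c) * x))%:E)) (y + c * v) +
   heat v (below (fun x => (expR (- (2 * c) * x))%:E)) (y + c * v))%E.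
Proof.
move=> v0; rewrite addeC -(heat_split v (y + c * v) (measurable_expR_lin (2 * c)))//.
rewrite heat_expR//.
have -> // : - (2 * c) * (y + c * v) + (2 * c) ^+ 2 * v / 2 = - (2 * c) * y.
by field.
Qed.

(** For c >= 0 the bound is the probability of ever crossing.  The function exp (- 2 c x)
    is harmonic, and its part on x >= 0 has a crossing value below its free expectation. *)
Lemma crossing1_le_expR c v y : 0 < v -> 0 <= y ->
  (crossing c v one y <= (expR (- (2 * c) * y))%:E)%E.
Proof.
move=> v0 y0; rewrite crossing1_split// (expR_split c y v0) leeD2r//.
set E := fun x => (expR (- (2 * c) * x))%:E.
have mE : measurable_fun [set: R] E by exact: measurable_expR_lin.
have E0 x : (0 <= E x)%E by rewrite lee_fin expR_ge0.
have := crossing_le_heat c v0 (measurable_above mE) (above_ge0 E0) y0.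
apply: le_trans; rewrite /crossing le_eqVlt; apply/orP; left; apply/eqP.
apply: heat_eq_off0 => //.
- exact: measurable_below.
- by apply: measurable_reflected; exact: measurable_above.
- exact: below_ge0.
- by apply: reflected_ge0; exact: above_ge0.
move=> x x0; rewrite /reflected /below; case: ifPn => // xn.
rewrite /above leNgt xn/= oppr_ge0 (ltW xn) add0e /E -EFinM -expRD.
by rewrite mulrN addrN expR0.
Qed.

(** The defect is the expectation of exp (- 2 c x) over final gaps x >= 0, where it is at
    most exp (- (2 c - l) x). *)
Lemma crossing1_ge_expR c v y l : 0 < v -> 0 <= l ->
  ((expR (- (2 * c) * y))%:E <= crossing c v one y +
     (expR (- (2 * c - l) * y + v * (l ^+ 2 / 2 - l * c)))%:E)%E.
Proof.
move=> v0 l0; rewrite crossing1_split// (expR_split c y v0).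
rewrite [leLHS]addeC -[leRHS]addeA [leRHS]addeCA leeD2l//.
apply: (@le_trans _ _ (heat v (fun x => (expR (- (2 * c - l) * x))%:E) (y + c * v))).
  have mE := @measurable_expR_lin R.
  apply: le_heat => //.
  - exact: measurable_above.
  - by apply: above_ge0 => x; rewrite lee_fin expR_ge0.
  - move=> x; rewrite /above; case: ifPn => x0; rewrite lee_fin ?expR_ge0//.
    by rewrite ler_expR !mulNr lerN2 ler_wpM2r// gerBl.
rewrite heat_expR//.
have -> : - (2 * c - l) * (y + c * v) + (2 * c - l) ^+ 2 * v / 2 =
  - (2 * c - l) * y + v * (l ^+ 2 / 2 - l * c) by field.
by rewrite leeDr// heat_ge0//; exact: below_ge0.
Qed.

End continuity.

(** * Crossing a line on a time grid *)

Lemma exchange_le (R : realType) (a a' b b' s r : \bar R) :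
  (a' = a + s -> b = b' + r -> s <= r -> a' + b' <= a + b)%E.
Proof. by move=> -> -> sr; rewrite -addeA leeD2l// addeC leeD2l. Qed.

Lemma eq2_le (R : realType) (a a' b b' : \bar R) :
  (a = a' -> b = b' -> a <= b -> a' <= b')%E.
Proof. by move=> -> ->. Qed.

Lemma exchange_ge (R : realType) (a a' b b' s r t u : \bar R) :
  (a' = a + s -> b = b' + r -> r <= s + u ->
   a + b + t <= a' + b' + (t + u))%E.
Proof.
move=> -> -> rsu.
have -> : (a + (b' + r) + t = a + b' + t + r)%E by rewrite addeA (addeAC (a + b')%E).
have -> : (a + s + b' + (t + u) = a + b' + t + (s + u))%E.
  by rewrite (addeAC a s b') addeACA.
by rewrite leeD2l.
Qed.

Section walk.
Context d (Omega : measurableType d) (R : realType) (P : probability Omega R).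

(** A walk whose step k adds an independent centered normal variable of variance
    w (k + 1) - w k.  The class [adp k] stands for the past at time k; only
    finite disjoint unions and intersections with events of the present are needed, which
    avoids a filtration. *)
Record gaussian_walk (m : nat) (Z : nat -> Omega -> R) (w : nat -> R)
    (adp : nat -> set Omega -> Prop) : Prop := GaussianWalk {
  walk_measurable : forall k, measurable_fun [set: Omega] (Z k) ;
  walk_clock : forall k, (k < m)%N -> w k < w k.+1 ;
  adp_measurable : forall k G, adp k G -> measurable G ;
  adpI : forall k G C, adp k G -> measurable C -> adp k (G `&` Z k @^-1` C) ;
  adpU : forall k G G', adp k G -> adp k G' -> G `&` G' = set0 -> adp k (G `|` G') ;
  adpS : forall k G, (k < m)%N -> adp k G -> adp k.+1 G ;
  walk_markov : forall k G (f : R -> \bar R), (k < m)%N -> adp k G ->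
    measurable_fun [set: R] f -> (forall x, 0 <= f x)%E ->
    (\int[P]_(x in G) f (Z k.+1 x) =
     \int[P]_(x in G) heat (w k.+1 - w k) f (Z k x))%E }.

Context (m : nat) (Z : nat -> Omega -> R) (w : nat -> R)
  (adp : nat -> set Omega -> Prop) (walkZ : gaussian_walk m Z w adp).

Section one_stage.
Context (A c : R) (k0 n : nat) (k0nm : (k0 + n <= m)%N).
Let Y k x := A + c * w k - Z k x.
Context (G : set Omega) (adpG : adp k0 G).

Definition crossed_by j : set Omega :=
  G `&` [set x | exists2 i, (0 < i <= j)%N & A + c * w (k0 + i) - Z (k0 + i) x < 0].

Let surv j : set Omega :=
  G `&` [set x | forall i, (0 < i <= j)%N -> 0 <= Y (k0 + i) x].

Let neg k : set Omega := Y k @^-1` [set y | y < 0].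
Let pos k : set Omega := Y k @^-1` [set y | 0 <= y].

Let surv0 : surv 0 = G.
Proof.
apply/seteqP; split => [x []//|x Gx]; split => // i.
by case/andP => /leq_trans h /h.
Qed.

Let survS j : surv j.+1 = surv j `&` pos (k0 + j.+1).
Proof.
apply/seteqP; split => [x [Gx h]|x [[Gx h] h1]].
  split; last by apply: h; rewrite leqnn.
  by split=> // i /andP[i0 ij]; apply: h; rewrite i0 ltnW.
split=> // i /andP[i0]; rewrite leq_eqVlt => /predU1P[->//|ij].
by apply: h; rewrite i0.
Qed.

Let crossed0 : crossed_by 0 = set0.
Proof.
apply/seteqP; split => // x [Gx [i /andP[i0 ij]]].
by have := leq_trans i0 ij.
Qed.

Let crossedS j : crossed_by j.+1 = crossed_by j `|` (surv j `&` neg (k0 + j.+1)).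
Proof.
apply/seteqP; split => [x [Gx [i /andP[i0 ij] Yi]]|x].
  have [[i' hi' Yi']|nh] := pselect (exists2 i', (0 < i' <= j)%N & Y (k0 + i') x < 0).
    by left; split => //; exists i'.
  right; split.
    split => // i' hi'; rewrite leNgt; apply/negP => Yi'.
    by apply: nh; exists i'.
  move: ij; rewrite leq_eqVlt => /predU1P[ij|ij]; first by rewrite -ij.
  by exfalso; apply: nh; exists i => //; rewrite i0.
case=> [[Gx [i /andP[i0 ij] Yi]]|[[Gx h] h1]].
  by split => //; exists i => //; rewrite i0 ltnW.
by split => //; exists j.+1 => //; rewrite leqnn.
Qed.

Let disj j : crossed_by j `&` (surv j `&` neg (k0 + j.+1)) = set0.
Proof.
apply/seteqP; split => // x [[_ [i ij Yi]] [[_ h] _]].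
by have := h _ ij; rewrite leNgt Yi.
Qed.

Let mltY (B : set R) k : measurable B -> measurable [set z | B (A + c * w k - z)].
Proof.
move=> mB; rewrite -[X in measurable X]setTI.
by apply: (measurable_funB (measurable_cst _) (@measurable_id _ _ setT)).
Qed.

Let adp_surv j : (j <= n)%N -> adp (k0 + j) (surv j).
Proof.
elim: j => [|j ih] jn; first by rewrite addn0 surv0.
rewrite survS addnS; apply: (adpI walkZ (C := [set z | 0 <= A + c * w (k0 + j).+1 - z])).
  by apply: (adpS walkZ); [lia|apply: ih; lia].
apply: (mltY (B := [set y | 0 <= y])); rewrite -set_itvcy; exact: measurable_itv.
Qed.

Let adp_new j : (j < n)%N -> adp (k0 + j.+1) (surv j `&` neg (k0 + j.+1)).
Proof.
move=> jn; rewrite addnS.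
apply: (adpI walkZ (C := [set z | A + c * w (k0 + j).+1 - z < 0])).
  by apply: (adpS walkZ); [lia|apply: adp_surv; lia].
apply: (mltY (B := [set y | y < 0])); rewrite -set_itvNyo; exact: measurable_itv.
Qed.

Lemma adp_crossed j : (j <= n)%N -> adp (k0 + j) (crossed_by j).
Proof.
elim: j => [|j ih] jn.
  rewrite addn0 crossed0 -(setI0 G) -(preimage_set0 (Z k0)).
  exact: (adpI walkZ).
rewrite crossedS; apply: (adpU walkZ) => //; last exact: adp_new.
by rewrite addnS; apply: (adpS walkZ); [lia|apply: ih; lia].
Qed.

Let mY k : measurable_fun [set: Omega] (Y k).
Proof. by apply: measurable_funB => //; exact: (walk_measurable walkZ). Qed.

Let markovY k H (g : R -> \bar R) : (k < m)%N -> adp k H ->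
  measurable_fun [set: R] g -> (forall x, 0 <= g x)%E ->
  (\int[P]_(x in H) g (Y k.+1 x) =
   \int[P]_(x in H) heat (w k.+1 - w k) g (Y k x + c * (w k.+1 - w k))%R)%E.
Proof.
move=> km aH mg g0.
pose g' z := g (- z + (A + c * w k.+1)).
have mg1 := measurable_comp_shift (A + c * w k.+1) mg.
have mg' : measurable_fun [set: R] g' := measurable_comp_opp mg1.
transitivity (\int[P]_(x in H) g' (Z k.+1 x))%E.
  by apply: eq_integral => x _; rewrite /g' /Y addrC.
rewrite (walk_markov walkZ km aH mg' (fun z => g0 _)).
apply: eq_integral => x _.
rewrite (@heat_opp _ _ (fun z => g (z + _)) _ mg1 (fun z => g0 _)).
rewrite (@heat_shift _ _ g _ _ mg g0).
by have -> : - Z k x + (A + c * w k.+1) = Y k x + c * (w k.+1 - w k) by rewrite /Y; ring.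
Qed.

Let wlt k : (k < k0 + n)%N -> w k < w (k0 + n).
Proof.
move=> kn; have h j : (k + j < k0 + n)%N -> w k < w (k + j).+1.
  elim: j => [|j ih] hj; first by rewrite addn0; apply: (walk_clock walkZ); lia.
  apply: lt_trans (ih _) _; first lia.
  by rewrite addnS; apply: (walk_clock walkZ); lia.
have -> : (k0 + n = (k + (k0 + n - k).-1).+1)%N by lia.
by apply: h; lia.
Qed.

Let value (g : R -> \bar R) k y : \bar R := if (k == k0 + n)%N then g y
  else heat (w (k0 + n) - w k) g (y + c * (w (k0 + n) - w k)).

Let value_ge0 g k : (forall x, 0 <= g x)%E -> forall y, (0 <= value g k y)%E.
Proof. by move=> g0 y; rewrite /value; case: ifP => // _; exact: heat_ge0. Qed.

Let measurable_value g k : measurable_fun [set: R] g -> (forall x, 0 <= g x)%E ->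
  measurable_fun [set: R] (value g k).
Proof.
move=> mg g0; rewrite /value; case: (k == (k0 + n)%N) => //.
by apply: measurable_comp_shift; exact: measurable_heat.
Qed.

Let valueS g k y : (k < k0 + n)%N -> measurable_fun [set: R] g ->
  (forall x, 0 <= g x)%E ->
  heat (w k.+1 - w k) (value g k.+1) (y + c * (w k.+1 - w k)) = value g k y.
Proof.
move=> kn mg g0; have wk : 0 < w k.+1 - w k.
  by rewrite subr_gt0; apply: (walk_clock walkZ); lia.
rewrite /value (ltn_eqF kn); case: eqP => [<-//|kn1].
have wk1 : 0 < w (k0 + n) - w k.+1 by rewrite subr_gt0; apply: wlt; lia.
rewrite (heat_shift _ _ _ (measurable_heat _ mg g0)); last first.
  by move=> x; exact: heat_ge0.
have -> : y + c * (w (k0 + n) - w k) =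
  y + c * (w k.+1 - w k) + c * (w (k0 + n) - w k.+1) by ring.
rewrite (heat_semigroup _ wk wk1 mg g0).
by have -> : w k.+1 - w k + (w (k0 + n) - w k.+1) = w (k0 + n) - w k by ring.
Qed.

Let integral_value g k H e : (k < k0 + n)%N -> adp k H ->
  measurable_fun [set: R] g -> (forall x, 0 <= g x)%E ->
  (\int[P]_(x in H) value g k.+1 (Y k.+1 x + e)%R =
   \int[P]_(x in H) value g k (Y k x + e)%R)%E.
Proof.
move=> kn aH mg g0.
have mv := measurable_value k.+1 mg g0.
have km : (k < m)%N by exact: leq_trans k0nm.
have v0 x : (0 <= value g k.+1 x)%E by exact: value_ge0.
etransitivity.
  exact: (markovY km aH (measurable_comp_shift e mv) (fun y => v0 _)).
apply: eq_integral => x _; rewrite (heat_shift _ _ _ mv v0).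
by rewrite -addrA (addrC _ e) addrA valueS.
Qed.

Let integral_survS j (g : Omega -> \bar R) : (j < n)%N ->
  measurable_fun [set: Omega] g -> (forall x, 0 <= g x)%E ->
  (\int[P]_(x in surv j) g x =
   \int[P]_(x in surv j.+1) g x +
   \int[P]_(x in surv j `&` neg (k0 + j.+1)) g x)%E.
Proof.
move=> jn mg g0; have UE : surv j = surv j.+1 `|` (surv j `&` neg (k0 + j.+1)).
  rewrite survS -setIUr (_ : pos _ `|` neg _ = setT) ?setIT//.
  by apply/seteqP; split => // x _ /=; case: (leP 0 (Y (k0 + j.+1) x)); [left|right].
rewrite {1}UE ge0_integral_setU//.
- exact: (adp_measurable walkZ (adp_surv jn)).
- exact: (adp_measurable walkZ (adp_new jn)).
- by apply: measurable_funTS.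
- rewrite disj_set2E survS; apply/eqP/seteqP; split => // x [[_ h] [_ h1]].
  by move: h1; rewrite /neg/= ltNge h.
Qed.

Let integral_crossedS j (g : Omega -> \bar R) : (j < n)%N ->
  measurable_fun [set: Omega] g -> (forall x, 0 <= g x)%E ->
  (\int[P]_(x in crossed_by j.+1) g x =
   \int[P]_(x in crossed_by j) g x +
   \int[P]_(x in surv j `&` neg (k0 + j.+1)) g x)%E.
Proof.
move=> jn mg g0; rewrite crossedS ge0_integral_setU//.
- exact: (adp_measurable walkZ (adp_crossed (ltnW jn))).
- exact: (adp_measurable walkZ (adp_new jn)).
- by apply: measurable_funTS.
- by rewrite disj_set2E disj.
Qed.

Let mvY g k e : measurable_fun [set: R] g -> (forall x, 0 <= g x)%E ->
  measurable_fun [set: Omega] (fun x => value g k (Y k x + e)).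
Proof.
move=> mg g0.
exact: (measurableT_comp (measurable_comp_shift e (measurable_value k mg g0)) (mY k)).
Qed.

Context (f : R -> \bar R) (mf : measurable_fun [set: R] f)
  (f0 : forall x, (0 <= f x)%E) (n0 : (0 < n)%N).

Let a j := (\int[P]_(x in crossed_by j) value f (k0 + j)%N (Y (k0 + j)%N x + 0)%R)%E.

Let aS j : (j < n)%N -> a j.+1 = (a j + \int[P]_(x in surv j `&` neg (k0 + j.+1))
   value f (k0 + j.+1)%N (Y (k0 + j.+1)%N x + 0)%R)%E.
Proof.
move=> jn.
have <- : (\int[P]_(x in crossed_by j) value f (k0 + j.+1)%N
    (Y (k0 + j.+1)%N x + 0)%R = a j)%E.
  rewrite addnS; apply: integral_value => //; first lia.
  by apply: adp_crossed; exact: ltnW.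
exact: (integral_crossedS jn (mvY _ _ mf f0) (fun x => value_ge0 _ f0 _)).
Qed.

Let a0 : a 0 = 0%E.
Proof. by rewrite /a crossed0 integral_set0. Qed.

Let an : a n = (\int[P]_(x in crossed_by n) f (Y (k0 + n) x))%E.
Proof. by rewrite /a; apply: eq_integral => x _; rewrite /value eqxx addr0. Qed.

Let b (g : R -> \bar R) (e : R) j :=
  (\int[P]_(x in surv j) value g (k0 + j)%N (Y (k0 + j)%N x + e)%R)%E.

Let bS g e j : (j < n)%N -> measurable_fun [set: R] g -> (forall x, 0 <= g x)%E ->
  b g e j = (b g e j.+1 + \int[P]_(x in surv j `&` neg (k0 + j.+1))
     value g (k0 + j.+1)%N (Y (k0 + j.+1)%N x + e)%R)%E.
Proof.
move=> jn mg g0; rewrite /b.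
transitivity (\int[P]_(x in surv j) value g (k0 + j.+1)%N (Y (k0 + j.+1)%N x + e)%R)%E.
  rewrite addnS; apply/esym/integral_value => //; first lia.
  by apply: adp_surv; exact: ltnW.
exact: (integral_survS jn (mvY _ _ mg g0) (fun x => value_ge0 _ g0 _)).
Qed.

Let b0 g e : b g e 0 =
  (\int[P]_(x in G) heat (w (k0 + n) - w k0) g
     (Y k0 x + e + c * (w (k0 + n) - w k0))%R)%E.
Proof.
rewrite /b surv0 addn0; apply: eq_integral => x _; rewrite /value.
by case: eqP => //; lia.
Qed.

Let bn g e : (forall y, 0 <= y -> g (y + e) = 0%E) -> b g e n = 0%E.
Proof.
move=> ge0; rewrite /b (eq_integral (fun=> 0%E)) ?integral0// => x /[!inE] -[_ h].
rewrite /value eqxx ge0//; apply: h; by rewrite n0 leqnn.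
Qed.

(** Let a_j be the integral over the paths crossed within j steps of the expected final value,
    and b_j the integral over the others of the image value.  One step moves the
    paths that cross from b to a, and for a negative gap the image value is the
    larger of the two, so a_j + b_j decreases from b_0 to a_n. *)
Lemma crossed_by_le :
  (\int[P]_(x in crossed_by n) f (A + c * w (k0 + n) - Z (k0 + n) x)%R <=
   \int[P]_(x in G) crossing c (w (k0 + n) - w k0) f (A + c * w k0 - Z k0 x)%R)%E.
Proof.
have mr := measurable_reflected c mf; have r0 := reflected_ge0 c f0.
(* At a negative gap the free expectation is below the image value. *)
have dec j : (j <= n)%N -> (a j + b (reflected c f) 0 j <= b (reflected c f) 0 0)%E.
  elim: j => [|j ih] jn; first by rewrite a0 add0e.
  apply: le_trans (ih (ltnW jn)).
  apply: (exchange_le (aS jn) (bS 0 jn mr r0)).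
  apply: ge0_le_integral => //.
  - exact: (adp_measurable walkZ (adp_new jn)).
  - by move=> x _; exact: value_ge0.
  - by apply: measurable_funTS; exact: mvY.
  - by apply: measurable_funTS; exact: mvY.
  move=> x [_]; rewrite /neg/= !addr0 => Yx; rewrite /value; case: eqP => kn.
    by rewrite /reflected /below Yx leeDl// mule_ge0// lee_fin expR_ge0.
  by apply: heat_le_crossing => //; [rewrite subr_gt0; apply: wlt; lia|exact: ltW].
have := dec n (leqnn n).
rewrite bn ?adde0; last first.
  by move=> y y0; rewrite addr0 /reflected /below ltNge y0.
apply: (eq2_le an); apply: etrans (b0 _ _) _.
by apply: eq_integral => x _; rewrite addr0.
Qed.

Context (delta e : R) (f1 : forall x, (f x <= 1)%E) (c0 : 0 <= c)
  (wdelta : forall k, (k0 <= k < k0 + n)%N -> w k.+1 - w k = delta)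
  (G0 : forall x, G x -> 0 <= A + c * w k0 - Z k0 x)
  (delta_small : 2 * c * delta <= e).

(** The comparison is reversed at gaps >= 0, so the barrier for the gap is lowered from 0 to -e:
    at the first negative gap y, the shifted gap y + e is nonnegative unless the walk jumps by
    more than e, which costs one error term for each step. *)
Lemma crossed_by_ge :
  (\int[P]_(x in G) crossing c (w (k0 + n) - w k0) (fun y => f (y - e)%R)
      (A + c * w k0 - Z k0 x + e)%R <=
   \int[P]_(x in crossed_by n) f (A + c * w (k0 + n) - Z (k0 + n) x)%R +
   (n%:R * (2 * expR (- e ^+ 2 / (2 * delta))))%:E)%E.
Proof.
pose fe y := f (y - e).
have mfe : measurable_fun [set: R] fe by exact: measurable_comp_shift.
have fe0 y : (0 <= fe y)%E by exact: f0.
have fe1 y : (fe y <= 1)%E by exact: f1.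
have mr := measurable_reflected c mfe; have r0 := reflected_ge0 c fe0.
have delta0 : 0 < delta.
  rewrite -(@wdelta k0); last lia.
  by rewrite subr_gt0; apply: (walk_clock walkZ); lia.
have e0 : 0 <= e by rewrite (le_trans _ delta_small)// !mulr_ge0// ltW.
set eta := 2 * expR _.
have eta0 : 0 <= eta by rewrite mulr_ge0 ?expR_ge0.
have mo := measurable_overshoot c e.
(* A jump beyond - e is paid by [overshoot]; otherwise the shifted gap is
   nonnegative, where the image value is below the free expectation. *)
have cmp k y : (k <= k0 + n)%N -> y < 0 ->
    (value (reflected c fe) k (y + e) <= value f k (y + 0) + overshoot c e y)%E.
  move=> kn y0; rewrite addr0 /value.
  have [ye|ye] := ltP y (- e).
    have ye0 : y + e < 0 by lra.
    rewrite -[leLHS]add0e; apply: leeD.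
      by case: ifP => _ //; exact: heat_ge0.
    rewrite /overshoot ye; case: eqP => kn1.
      exact: reflected_le_expR.
    apply: (crossing_le_expR _ _ c0 mfe fe0 fe1).
    by rewrite subr_gt0; apply: wlt; rewrite ltn_neqAle kn andbT; exact/eqP.
  rewrite -[leLHS]adde0; apply: leeD; last exact: overshoot_ge0.
  have ye0 : 0 <= y + e by lra.
  case: eqP => kn1; first by rewrite /reflected /below ltNge ye0; exact: f0.
  apply: (@le_trans _ _ (heat (w (k0 + n) - w k) fe (y + e + c * (w (k0 + n) - w k)))).
    apply: (crossing_le_heat c _ mfe fe0 ye0).
    by rewrite subr_gt0; apply: wlt; rewrite ltn_neqAle kn andbT; exact/eqP.
  rewrite /fe (@heat_shift _ _ f (- e) _ mf f0).
  by have -> : y + e + c * (w (k0 + n) - w k) - e = y + c * (w (k0 + n) - w k) by ring.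
have inc j : (j <= n)%N ->
    (b (reflected c fe) e 0 <= a j + b (reflected c fe) e j + (j%:R * eta)%:E)%E.
  elim: j => [|j ih] jn; first by rewrite a0 add0e mul0r adde0.
  apply: le_trans (ih (ltnW jn)) _.
  have -> : ((j.+1%:R * eta)%:E = (j%:R * eta)%:E + eta%:E)%E.
    by rewrite -natr1 mulrDl mul1r EFinD.
  apply: (exchange_ge _ (aS jn) (bS e jn mr r0)).
  set I1 := (X in (X <= _)%E); set I2 := (X in (_ <= X + _)%E).
    apply: (@le_trans _ _ (I2 + \int[P]_(x in surv j `&` neg (k0 + j.+1))
        overshoot c e (Y (k0 + j.+1)%N x))%E).
      have mN := adp_measurable walkZ (adp_new jn).
      rewrite /I1 /I2 -ge0_integralD//; first last.
      - by apply: measurable_funTS; exact: (measurableT_comp mo (mY _)).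
      - by move=> x _; exact: overshoot_ge0.
      - by apply: measurable_funTS; exact: mvY.
      - by move=> x _; exact: value_ge0.
      apply: ge0_le_integral => //.
      - by move=> x _; exact: value_ge0.
      - by apply: measurable_funTS; exact: mvY.
      - apply: measurable_funTS; apply: emeasurable_funD; first exact: mvY.
        exact: (measurableT_comp mo (mY _)).
      - by move=> x [_ Yx]; apply: cmp => //; lia.
    rewrite leeD2l//.
    have mS := adp_measurable walkZ (adp_surv (ltnW jn)).
    apply: (@le_trans _ _ (\int[P]_(x in surv j) overshoot c e (Y (k0 + j).+1%N x))%E).
      rewrite -addnS; apply: ge0_subset_integral => //.
      - exact: (adp_measurable walkZ (adp_new jn)).
      - by apply: measurable_funTS; exact: (measurableT_comp mo (mY _)).
      - by move=> x _; exact: overshoot_ge0.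
    have km : (k0 + j < m)%N by lia.
    rewrite (markovY km (adp_surv (ltnW jn)) mo (overshoot_ge0 c e)).
    have -> : w (k0 + j).+1 - w (k0 + j)%N = delta by apply: wdelta; lia.
    apply: (@le_trans _ _ (\int[P]_(x in surv j) eta%:E)%E).
      apply: ge0_le_integral => //.
      - by move=> x _; apply: heat_ge0; exact: overshoot_ge0.
      - apply: measurable_funTS; exact: (measurableT_comp (measurable_comp_shift
          (c * delta) (measurable_heat delta mo (overshoot_ge0 c e))) (mY _)).
      - move=> x [Gx h]; apply: heat_overshoot => //.
        case: j jn h {ih I1 I2 mS km} => [|j] jn h; first by rewrite addn0; exact: G0.
        by apply: h; rewrite leqnn.
    rewrite integral_cst// -[leRHS]mule1 lee_wpmul2l// ?lee_fin//.
    exact: probability_le1.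
have bn0 : b (reflected c fe) e n = 0%E.
  by apply: bn => y y0; rewrite /reflected /below ltNge addr_ge0.
have := inc n (leqnn n).
by apply: eq2_le; [exact: b0|rewrite bn0 adde0; apply: (f_equal (fun z => z + _)%E); exact: an].
Qed.

End one_stage.
End walk.

(** * Conditioning on independent Gaussian increments *)

Section normal_density.
Local Open Scope ereal_scope.
Context {R : realType}.
Local Notation mu := (@lebesgue_measure R).

Import HBNNSimple.

(** Both sides are monotone limits over simple functions, and agree on
    indicators by hypothesis. *)
Lemma ge0_integral_density d (T : measurableType d) (mu nu : {measure set T -> \bar R})
    (p : T -> R) (f : T -> \bar R) :
  measurable_fun [set: T] p -> (forall x, (0 <= p x)%R) ->
  (forall A, measurable A -> nu A = \int[mu]_(x in A) (p x)%:E) ->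
  measurable_fun [set: T] f -> (forall x, 0 <= f x) ->
  \int[nu]_x f x = \int[mu]_x (f x * (p x)%:E).
Proof.
move=> mp p0 nuE mf f0.
have mpdf : measurable_fun [set: T] (fun x => (p x)%:E) by exact/measurable_EFinP.
have pdf0 x : 0 <= (p x)%:E by rewrite lee_fin.
pose f_ := nnsfun_approx measurableT mf.
have mf_ n : measurable_fun [set: T] (fun x => (f_ n x)%:E : \bar R).
  exact/measurable_EFinP.
have f_cvg x : (f_ n x)%:E @[n --> \oo] --> f x by exact: cvg_nnsfun_approx.
have f_nd x : nondecreasing_seq (fun n => (f_ n x)%:E).
  by move=> a b ab; rewrite lee_fin; exact/lefP/nd_nnsfun_approx.
have cvg1 : (\int[nu]_x (f_ n x)%:E) @[n --> \oo] -->
    \int[nu]_x f x.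
  apply: ge0_nondecreasing_cvg_integral.
  - by move=> n; exact: mf_.
  - by move=> n x; rewrite lee_fin.
  - exact: f_nd.
  - exact: f_cvg.
have cvg2 : (\int[mu]_x ((f_ n x)%:E * (p x)%:E)) @[n --> \oo] -->
    \int[mu]_x (f x * (p x)%:E).
  apply: ge0_nondecreasing_cvg_integral.
  - by move=> n; apply: emeasurable_funM => //; exact: mf_.
  - by move=> n x; rewrite mule_ge0// lee_fin.
  - by move=> x a b ab; rewrite lee_wpmul2r//; exact: f_nd.
  - by move=> x; apply: cvgeZr => //; exact: f_cvg.
suff E n : \int[mu]_x ((f_ n x)%:E * (p x)%:E) =
    \int[nu]_x (f_ n x)%:E.
  move: cvg2; under eq_fun do rewrite E.
  by move=> cvg2; exact: (cvg_unique _ cvg1 cvg2).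
apply/esym; move: (f_ n) => h.
under [LHS]eq_integral do rewrite fimfunE -fsumEFin//.
rewrite [LHS]ge0_integral_fsum//; last 2 first.
  - by move=> r; exact/measurable_EFinP/measurableT_comp.
  - by move=> r x _; rewrite EFinM nnfun_muleindic_ge0.
under [RHS]eq_integral.
  move=> x xD; rewrite fimfunE -fsumEFin// muleC ge0_mule_fsumr; last first.
    by move=> r; rewrite EFinM nnfun_muleindic_ge0.
  over.
rewrite [RHS]ge0_integral_fsum//; last 2 first.
  - move=> r; apply: emeasurable_funM => //.
    by apply/measurable_EFinP; apply/measurableT_comp.
  - by move=> r x _; rewrite mule_ge0// EFinM nnfun_muleindic_ge0.
apply: eq_fsbigr => r _.
rewrite integralZl_indic_nnsfun//= integral_indic// setIT.
have [r0|r0] := leP 0%R r; last first.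
  rewrite preimage_nnfun0// measure0 mule0.
  by rewrite integral0_eq// => x _; rewrite indicE in_set0 mulr0 mule0.
have mh : measurable (h @^-1` [set r]) by [].
have m1 : measurable_fun [set: T] (fun x => (\1_(h @^-1` [set r]) x)%:E : \bar R).
  exact/measurable_EFinP.
transitivity (\int[mu]_x (r%:E * ((p x)%:E * (\1_(h @^-1` [set r]) x)%:E))).
  rewrite ge0_integralZl//.
  - congr (_ * _); rewrite nuE// [LHS]integral_mkcond; apply: eq_integral => x _.
    rewrite patchE indicE; case: ifPn => _; first by rewrite mule1.
    by rewrite mule0.
  - exact: emeasurable_funM.
  - by move=> x _; rewrite mule_ge0// lee_fin.
by apply: eq_integral => x _; rewrite EFinM muleCA.
Qed.

Lemma integral_normal_prob (m s : R) (f : R -> \bar R) :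
  measurable_fun [set: R] f -> (forall x, 0 <= f x) ->
  \int[normal_prob m s]_x f x = \int[mu]_x (f x * (normal_pdf m s x)%:E).
Proof.
apply: (@ge0_integral_density _ _ mu (normal_prob m s) (normal_pdf m s) f) => //.
  exact: measurable_normal_pdf.
exact: normal_pdf_ge0.
Qed.

Lemma integral_normal_heat v (f : R -> \bar R) z : (0 < v)%R ->
  measurable_fun [set: R] f -> (forall x, 0 <= f x) ->
  \int[normal_prob 0 (Num.sqrt v)]_y f (z + y)%R = heat v f z.
Proof.
move=> v0 mf f0.
have mfz : measurable_fun [set: R] (fun y => f (z + y)%R).
  by apply: (measurableT_comp mf); exact: measurable_funD.
rewrite integral_normal_prob//.
transitivity (\int[mu]_y (f (y + z)%R * (gauss v ((y + z) - z)%R)%:E)).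
  apply: eq_integral => y _; rewrite normal_pdf_gauss// subr0 addrK.
  by rewrite (addrC z).
apply: (@ge0_integral_lebesgue_shift _ (fun x => f x * (gauss v (x - z)%R)%:E) z).
  exact: measurable_heat_integrand.
by move=> x; rewrite mule_ge0// lee_fin gauss_ge0.
Qed.

End normal_density.

Section law_on.
Local Open Scope ereal_scope.
Context d d' (Omega : measurableType d) (T : measurableType d') (R : realType)
  (P : probability Omega R) (G : set Omega) (mG : measurable G)
  (Z : Omega -> T) (mZ : measurable_fun [set: Omega] Z).

(** Law of Z under the restriction of P to G. *)
Definition law_on : {measure set T -> \bar R} :=
  measure_function_pushforward__canonical__measure_function_Measure (mrestr P mG) mZ.

Lemma law_onE A : law_on A = P (G `&` Z @^-1` A).
Proof. by rewrite setIC. Qed.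

Lemma integral_law_on (F : T -> \bar R) : measurable_fun [set: T] F ->
  (forall x, 0 <= F x) -> \int[law_on]_x F x = \int[P]_(w in G) F (Z w).
Proof.
move=> mF F0; rewrite ge0_integral_pushforward// preimage_setT.
rewrite (@ge0_negligible_integral _ _ _ (mrestr P mG) _ (~` G))//=; last 3 first.
- exact: measurableC.
- exact: measurableT_comp.
- by rewrite /mrestr setICl measure0.
rewrite setTD setCK; apply: eq_measure_integral => A mA AG.
by rewrite /= /mrestr setIidl.
Qed.

Lemma law_on_lty : law_on setT < +oo.
Proof.
rewrite law_onE preimage_setT setIT.
exact: le_lt_trans (probability_le1 P mG) (ltry 1).
Qed.

End law_on.

Section joint_law.
Local Open Scope ereal_scope.
Context d (Omega : measurableType d) (R : realType) (P : probability Omega R).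
Context (G : set Omega) (mG : measurable G) (Z : Omega -> R)
  (mZ : measurable_fun [set: Omega] Z).

(** The product rule on rectangles identifies the joint law of Z and X on G as a product
    measure, and Tonelli's theorem concludes. *)
Lemma integral_joint_law d' (T : measurableType d') (X : Omega -> T)
    (nu : probability T R) (f : R * T -> \bar R) :
  measurable_fun [set: Omega] X ->
  (forall (A : set R) (B : set T), measurable A -> measurable B ->
    P (G `&` (Z @^-1` A `&` X @^-1` B)) = P (G `&` Z @^-1` A) * nu B) ->
  measurable_fun [set: R * T] f -> (forall x, 0 <= f x) ->
  \int[P]_(w in G) f (Z w, X w) = \int[P]_(w in G) \int[nu]_y f (Z w, y).
Proof.
move=> mX rect mf f0.
have mZX : measurable_fun [set: Omega] (fun w => (Z w, X w)).
  exact: measurable_fun_pair.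
rewrite -(integral_law_on P mG mZX mf f0).
pose m1f : {finite_measure set R -> \bar R} := mfrestr measurableT (law_on_lty P mG mZ).
have m1fE A : m1f A = law_on P mG mZ A by rewrite /m1f /= /mfrestr /mrestr setIT.
transitivity (\int[m1f \x nu]_z f z).
  apply: eq_measure_integral => D mD _; apply/esym.
  apply: product_measure_unique => // A B mA mB.
  transitivity (law_on P mG mZ A * nu B); last by congr (_ * _); exact/esym/m1fE.
  by rewrite !law_onE -rect.
rewrite fubini_tonelli1//.
have mF : measurable_fun [set: R] (fubini_F nu f).
  exact: measurable_fun_fubini_tonelli_F.
have F0 x : 0 <= fubini_F nu f x by exact: integral_ge0.
transitivity (\int[law_on P mG mZ]_x fubini_F nu f x).
  by apply: eq_measure_integral => A mA _; exact: m1fE.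
exact: (integral_law_on P mG mZ mF F0).
Qed.

Lemma integral_indep_event (E : set Omega) (k : {nonneg R}) (F : R -> \bar R) :
  measurable E ->
  (forall A : set R, measurable A ->
    P (G `&` E `&` Z @^-1` A) = k%:num%:E * P (G `&` Z @^-1` A)) ->
  measurable_fun [set: R] F -> (forall x, 0 <= F x) ->
  \int[P]_(w in G `&` E) F (Z w) = k%:num%:E * \int[P]_(w in G) F (Z w).
Proof.
move=> mE rect mF F0.
have mGE : measurable (G `&` E) by exact: measurableI.
rewrite -(integral_law_on P mGE mZ mF F0) -(integral_law_on P mG mZ mF F0).
rewrite -ge0_integral_mscale//; apply: eq_measure_integral => A mA _.
by rewrite /mscale/= -[LHS]/(law_on P mGE mZ A) law_onE rect// -law_onE.
Qed.

End joint_law.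

Section adapted.
Local Open Scope ereal_scope.
Context d (Omega : measurableType d) (R : realType) (P : probability Omega R).
Context (I : finType) (X : I -> Omega -> R) (v : I -> R)
  (mX : forall i, measurable_fun [set: Omega] (X i)) (v0 : forall i, (0 < v i)%R).
Context (X_law : forall i (U : set R), measurable U ->
  P (X i @^-1` U) = normal_prob 0 (Num.sqrt (v i)) U).
Context (X_indep : forall V : I -> set R, (forall i, measurable (V i)) ->
  P [set w | forall i, V i (X i w)] = \prod_(i : I) P (X i @^-1` V i)).

(** The increments outside U are independent of the pair formed by the event G and the
    position Z, expressed by the product rule for events that leave the increments in U
    free. *)
Definition adapted (U : pred I) (Z : Omega -> R) (G : set Omega) : Prop :=
  measurable G /\ forall (A : set R) (V : I -> set R), measurable A ->
    (forall i, measurable (V i)) -> (forall i, U i -> V i = setT) ->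
    P (G `&` Z @^-1` A `&` [set w | forall i, V i (X i w)]) =
    P (G `&` Z @^-1` A) * \prod_(i : I) P (X i @^-1` V i).

Lemma measurable_family (V : I -> set R) : (forall i, measurable (V i)) ->
  measurable [set w | forall i, V i (X i w)].
Proof.
move=> mV; rewrite (_ : [set w | _] = \bigcap_(i in [set: I]) (X i @^-1` V i)).
  apply: fin_bigcap_measurable => // i _.
  by rewrite -[X in measurable X]setTI; exact: mX.
by apply/seteqP; split => [w h0 i _|w h0 i]; exact: h0.
Qed.

Lemma adapted0 : adapted pred0 (cst 0%R) setT.
Proof.
split=> // A V mA mV _; rewrite setTI.
have [A0|A0] := pselect (A 0%R).
  have -> : cst 0%R @^-1` A = [set: Omega] by apply/seteqP; split.
  by rewrite setTI probability_setT mul1e X_indep.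
have -> : cst 0%R @^-1` A = set0 :> set Omega by apply/seteqP; split.
by rewrite set0I measure0 mul0e.
Qed.

Lemma adapted_ext (U U' : pred I) Z Z' G : U =1 U' -> Z =1 Z' ->
  adapted U Z G -> adapted U' Z' G.
Proof.
move=> UU' /funext <- [mG h]; split => // A V mA mV VU.
by apply: h => // i Ui; apply: VU; rewrite -UU'.
Qed.

Lemma adaptedI U Z G C : measurable_fun [set: Omega] Z -> adapted U Z G ->
  measurable C -> adapted U Z (G `&` Z @^-1` C).
Proof.
move=> mZ [mG h] mC; split=> [|A V mA mV VU].
  by apply: measurableI => //; rewrite -[X in measurable X]setTI; exact: mZ.
rewrite -(setIA G) -preimage_setI; apply: h => //; exact: measurableI.
Qed.

Lemma adaptedU U Z G G' : measurable_fun [set: Omega] Z -> adapted U Z G ->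
  adapted U Z G' -> G `&` G' = set0 -> adapted U Z (G `|` G').
Proof.
move=> mZ [mG h] [mG' h'] GG'; split=> [|A V mA mV VU]; first exact: measurableU.
have mZA : measurable (Z @^-1` A) by rewrite -[X in measurable X]setTI; exact: mZ.
have mE : measurable [set w | forall i, V i (X i w)] by exact: measurable_family.
set E := [set w | forall i, V i (X i w)].
rewrite !setIUl.
have mGZ : measurable (G `&` Z @^-1` A) by exact: measurableI.
have mGZ' : measurable (G' `&` Z @^-1` A) by exact: measurableI.
have -> : P ((G `&` Z @^-1` A) `&` E `|` (G' `&` Z @^-1` A) `&` E) =
    P ((G `&` Z @^-1` A) `&` E) + P ((G' `&` Z @^-1` A) `&` E).
  apply: measureU; [exact: measurableI|exact: measurableI|].
  by rewrite setIACA (setIACA G) GG' !set0I.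
have -> : P (G `&` Z @^-1` A `|` G' `&` Z @^-1` A) =
    P (G `&` Z @^-1` A) + P (G' `&` Z @^-1` A).
  by apply: measureU => //; rewrite setIACA GG' set0I.
by rewrite h// h'// ge0_muleDl.
Qed.

Lemma adapted_rect U Z G p (V : I -> set R) (A B : set R) :
  ~~ U p -> adapted U Z G -> (forall i, measurable (V i)) ->
  (forall i, U i -> V i = setT) -> V p = setT -> measurable A -> measurable B ->
  P (G `&` [set w | forall i, V i (X i w)] `&` (Z @^-1` A `&` X p @^-1` B)) =
  P (G `&` [set w | forall i, V i (X i w)] `&` Z @^-1` A) *
  normal_prob 0 (Num.sqrt (v p)) B.
Proof.
move=> nUp [mG h] mV VU Vp mA mB.
pose V' i := if i == p then B else V i.
have mV' i : measurable (V' i) by rewrite /V'; case: ifP.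
have VU' i : U i -> V' i = setT.
  by move=> Ui; rewrite /V'; case: eqP => [ip|_]; [rewrite -ip Ui in nUp|exact: VU].
rewrite [X in P X = _](_ : _ = G `&` Z @^-1` A `&` [set w | forall i, V' i (X i w)]).
  rewrite h// setIAC h// -muleA; congr (_ * _).
  rewrite (bigD1 p)//= [in RHS](bigD1 p)//= Vp preimage_setT probability_setT mul1e.
  rewrite muleC /V' eqxx X_law//; congr (_ * _).
  by apply: eq_bigr => i /negbTE ->.
apply/seteqP; split => w.
  by case=> [[Gw Ew] [Zw Xw]]; split => // i; rewrite /V'; case: eqP => [->//|_]; exact: Ew.
case=> [[Gw Zw] Ew]; split; split => //.
  by move=> i; have := Ew i; rewrite /V'; case: eqP => [->|//]; rewrite Vp.
by have := Ew p; rewrite /V' eqxx.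
Qed.

Lemma setI_family_setT (G : set Omega) :
  G `&` [set w | forall i, [set: R] (X i w)] = G.
Proof. by apply/seteqP; split => [w []|w]. Qed.

(** After the increment p has been added to Z, the remaining increments are still
    independent of the past: integrate out X p by the product structure. *)
Lemma adapted_step U Z G p : measurable_fun [set: Omega] Z -> ~~ U p ->
  adapted U Z G -> adapted [pred i | U i || (i == p)] (fun w => Z w + X p w)%R G.
Proof.
move=> mZ nUp aG; have [mG h] := aG; split=> [//|A V mA mV VU].
set E := [set w | forall i, V i (X i w)].
have VU' i : U i -> V i = setT by move=> Ui; apply: VU; rewrite /= Ui.
have Vp : V p = setT by apply: VU; rewrite /= eqxx orbT.
have mE : measurable E by exact: measurable_family.
have mGE : measurable (G `&` E) by exact: measurableI.
have mXp : measurable_fun [set: Omega] (X p : Omega -> measurableTypeR R) := mX p.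
pose f (z : R * measurableTypeR R) : \bar R := (\1_A (z.1 + z.2)%R)%:E.
have mf : measurable_fun [set: R * measurableTypeR R] f.
  apply/measurable_EFinP; apply: measurableT_comp => //.
  by apply: measurable_funD; [exact: measurable_fst|exact: measurable_snd].
have f0 z : 0 <= f z by rewrite lee_fin.
pose nu : probability (measurableTypeR R) R := normal_prob 0 (Num.sqrt (v p)).
pose F z : \bar R := \int[nu]_y f (z, y).
have mF : measurable_fun [set: R] F by exact: measurable_fun_fubini_tonelli_F.
have F0 z : 0 <= F z by exact: integral_ge0.
have mD : measurable ((fun w => Z w + X p w)%R @^-1` A).
  by rewrite -[X in measurable X]setTI; apply: measurable_funD.
have PE H : measurable H -> P (H `&` (fun w => Z w + X p w)%R @^-1` A) =
    \int[P]_(w in H) f (Z w, X p w).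
  move=> mH; rewrite setIC -(integral_indic P mH mD).
  by apply: eq_integral => w _; rewrite /f !indicE.
have rectE A' B : measurable A' -> measurable B ->
    P (G `&` E `&` (Z @^-1` A' `&` X p @^-1` B)) =
    P (G `&` E `&` Z @^-1` A') * nu B.
  by move=> mA' mB; exact: (adapted_rect nUp aG).
have rectT A' B : measurable A' -> measurable B ->
    P (G `&` (Z @^-1` A' `&` X p @^-1` B)) = P (G `&` Z @^-1` A') * nu B.
  move=> mA' mB; have := @adapted_rect U Z G p (fun=> setT) A' B nUp aG.
  by rewrite setI_family_setT; apply.
have qE : \prod_(i : I) P (X i @^-1` V i) = P E by rewrite X_indep.
have q0 : (0 <= fine (P E))%R by rewrite fine_ge0.
have qfin : (NngNum q0)%:num%:E = P E by rewrite /= fineK// fin_num_measure.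
rewrite setIAC PE// (integral_joint_law mGE mZ mXp rectE mf f0).
rewrite PE// (integral_joint_law mG mZ mXp rectT mf f0).
rewrite (integral_indep_event mG mZ (k := NngNum q0) mE _ mF F0).
  by rewrite muleC; congr (_ * _); rewrite qE; exact: qfin.
by move=> A' mA'; rewrite setIAC h// qE qfin muleC.
Qed.

(** Independence of X p and the past makes the expected value after the increment
    a heat integral. *)
Lemma adapted_markov U Z G p (f : R -> \bar R) : measurable_fun [set: Omega] Z ->
  ~~ U p -> adapted U Z G -> measurable_fun [set: R] f -> (forall x, 0 <= f x) ->
  \int[P]_(w in G) f (Z w + X p w)%R = \int[P]_(w in G) heat (v p) f (Z w).
Proof.
move=> mZ nUp aG mf f0; have [mG h] := aG.
have mXp : measurable_fun [set: Omega] (X p : Omega -> measurableTypeR R) := mX p.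
pose g (z : R * measurableTypeR R) := f (z.1 + z.2)%R.
have mg : measurable_fun [set: R * measurableTypeR R] g.
  apply: (measurableT_comp mf).
  by apply: measurable_funD; [exact: measurable_fst|exact: measurable_snd].
pose nu : probability (measurableTypeR R) R := normal_prob 0 (Num.sqrt (v p)).
have rectT A' B : measurable A' -> measurable B ->
    P (G `&` (Z @^-1` A' `&` X p @^-1` B)) = P (G `&` Z @^-1` A') * nu B.
  move=> mA' mB; have := @adapted_rect U Z G p (fun=> setT) A' B nUp aG.
  by rewrite setI_family_setT; apply.
have := integral_joint_law mG mZ mXp rectT mg (fun z => f0 _).
rewrite /g/= => ->; apply: eq_integral => w _; exact: integral_normal_heat.
Qed.

End adapted.

(** * The sum of the Brownian motions as a Gaussian walk *)

Section brownian_walk.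
Local Open Scope ereal_scope.
Context (R : realType) (d : measure_display) (Omega : measurableType d)
  (P : probability Omega R) (B : nat -> R -> {RV P >-> R}).
Context (B_brownian : forall k : nat, standard_brownian_motion (B k)).
Context (B_independent : mutually_independent_processes B).
Context (N m : nat) (N0 : (0 < N)%N) (tau : nat -> R) (tau0 : tau 0%N = 0%R)
  (tau_lt : forall i, (i < m)%N -> (tau i < tau i.+1)%R).

Let tau_ge0 i : (i <= m)%N -> (0 <= tau i)%R.
Proof.
elim: i => [|i ih] im; first by rewrite tau0.
by rewrite (le_trans (ih (ltnW im)))// ltW// tau_lt.
Qed.

Let X (p : 'I_N * 'I_m) (w : Omega) : R := (B p.1 (tau p.2.+1) w - B p.1 (tau p.2) w)%R.

Let v (p : 'I_N * 'I_m) : R := (tau p.2.+1 - tau p.2)%R.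

Let mB k t : measurable_fun [set: Omega] (B k t).
Proof. exact: measurable_funPT. Qed.

Let mX p : measurable_fun [set: Omega] (X p).
Proof. exact: measurable_funB. Qed.

Let v0 p : (0 < v p)%R. Proof. by rewrite subr_gt0 tau_lt. Qed.

Let X_law p (U : set R) : measurable U ->
  P (X p @^-1` U) = normal_prob 0 (Num.sqrt (v p)) U.
Proof.
move=> mU; rewrite -(sbm_gaussian_increments (B_brownian p.1) _ _ mU)//.
  by rewrite tau_ge0// ltnW.
exact: tau_lt.
Qed.

Let process_event (W : R -> {RV P >-> R}) (n : nat) (t : nat -> R) (V : 'I_n -> set R) :
  (forall i, (i <= n)%N -> (0 <= t i)%R) -> (forall i, measurable (V i)) ->
  process_sigma_algebra W [set w | forall i : 'I_n, V i (W (t i.+1) w - W (t i) w)%R].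
Proof.
move=> t0 mV.
pose gen := \bigcup_(t in [set t : R | (0 <= t)%R])
        preimage_set_system setT (W t) measurable.
have mW s : (0 <= s)%R -> @measurable_fun _ _ (g_sigma_algebraType gen) R setT (W s).
  move=> s0 _ U mU; rewrite setTI; apply: sub_sigma_algebra.
  by exists s => //; exists U => //; rewrite setTI.
rewrite (_ : [set w | _] = \bigcap_(i in [set: 'I_n])
    ((fun w => W (t i.+1) w - W (t i) w)%R @^-1` V i)); last first.
  by apply/seteqP; split => [w h i _|w h i]; exact: h.
have -> : process_sigma_algebra W = @measurable _ (g_sigma_algebraType gen) by [].
apply: fin_bigcap_measurable => // i _.
rewrite -[X in measurable X]setTI.
apply: (@measurable_funB _ (g_sigma_algebraType gen) _ setT (W (t i.+1)) (W (t i))) => //.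
- by apply: mW; apply: t0; exact: ltn_ord.
- by apply: mW; apply: t0; exact: ltnW.
Qed.

Let fine_prodK (I : Type) (s : seq I) (f : I -> \bar R) :
  (forall i, f i \is a fin_num) -> \prod_(i <- s) f i = (\prod_(i <- s) fine (f i))%:E.
Proof.
move=> ff; elim/big_ind2 : _ => // [x1 x2 y1 y2 -> ->|i _]; first by rewrite EFinM.
by rewrite fineK.
Qed.

Let Pfin A : measurable A -> P A \is a fin_num.
Proof. by move=> mA; exact: fin_num_measure. Qed.

Let X_indep (V : 'I_N * 'I_m -> set R) : (forall p, measurable (V p)) ->
  P [set w | forall p, V p (X p w)] = \prod_p P (X p @^-1` V p).
Proof.
move=> mV.
pose E (k : 'I_N) := [set w | forall i : 'I_m, V (k, i) (X (k, i) w)].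
pose A (k : nat) : set Omega := oapp E setT (insub k).
have AE (k : 'I_N) : A k = E k by rewrite /A valK.
have mE k : measurable (E k).
  exact: (measurable_family (fun i => mX (k, i)) (fun i => mV (k, i))).
have PE k : P (E k) = \prod_(i < m) P (X (k, i) @^-1` V (k, i)).
  have := sbm_independent_increments (B_brownian k) (n := m) (t := tau).
  rewrite tau0 => /(_ (lexx _) (fun i im => ltW (tau_lt im))).
  move=> /(_ (enum 'I_m) (fun i => X (k, i) @^-1` V (k, i)) (enum_uniq _)) h.
  rewrite [X in P X](_ : _ = \bigcap_(i in [set` enum 'I_m]) (X (k, i) @^-1` V (k, i))).
    rewrite h.
      rewrite big_enum fine_prodK// => i; apply: Pfin.
      by rewrite -[X in measurable X]setTI; exact: mX.
    by move=> i _; exists (V (k, i)) => //; rewrite setTI.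
  apply/seteqP; split => [w h0 i _|w h0 i]; first exact: h0.
  by apply: h0; rewrite /= mem_enum.
rewrite [X in P X](_ : _ = \bigcap_(k in [set` [seq val k | k <- enum 'I_N]]) A k); last first.
  apply/seteqP; split => [w h0 k /= /mapP[k' _ ->]|w h0 [k i]].
    by rewrite AE => i; exact: h0.
  have : A (val k) w by apply: h0 => /=; apply/mapP; exists k => //; rewrite mem_enum.
  by rewrite AE => /(_ i).
rewrite B_independent; last 2 first.
- by rewrite map_inj_uniq ?enum_uniq//; exact: val_inj.
- move=> k /mapP[k' _ ->]; rewrite AE /E /X/=.
  exact: (@process_event (B k') m tau (fun i => V (k', i)) (fun i im => tau_ge0 im)
    (fun i => mV (k', i))).
rewrite big_map big_enum/=.
under eq_bigr do rewrite AE.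
rewrite -(@fine_prodK _ _ (fun k => P (E k))); last by move=> k; exact: Pfin.
rewrite (eq_bigr (fun k : 'I_N => \prod_(i < m) P (X (k, i) @^-1` V (k, i)))); last first.
  by move=> k _; exact: PE.
by rewrite pair_big/=; apply: eq_bigr => -[].
Qed.

Definition brownian_sum (j : nat) (w : Omega) : R := (\sum_(k < N) B k (tau j) w)%R.

Let msum l t : measurable_fun [set: Omega] (fun w => \sum_(k < l) B k t w)%R.
Proof. exact: measurable_sum. Qed.

(** The increments are indexed by a motion and a time step; at time j those of the
    first j steps have been used. *)
Definition brownian_adapted (j : nat) : set Omega -> Prop :=
  adapted P X (fun p => (p.2 < j)%N) (brownian_sum j).

Let adapted_X0 := @adapted0 _ _ _ P _ X X_indep.

Lemma brownian_adapted0 : brownian_adapted 0 setT.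
Proof.
apply: (adapted_ext _ _ adapted_X0) => // w.
rewrite /brownian_sum big1// => k _; rewrite tau0.
exact: sbm_start.
Qed.

Let micro (j : nat) (jm : (j < m)%N) (l : nat) (w : Omega) : R :=
  (brownian_sum j w + \sum_(k < l) (B k (tau j.+1) w - B k (tau j) w))%R.

Let microU (j l : nat) : pred ('I_N * 'I_m) :=
  fun p => (p.2 < j)%N || ((p.2 == j :> nat) && (p.1 < l)%N).

Let mmicro j (jm : (j < m)%N) l : measurable_fun [set: Omega] (micro jm l).
Proof.
apply: measurable_funD; first exact: msum.
by apply: measurable_sum => k; exact: measurable_funB.
Qed.

Let microS j (jm : (j < m)%N) l (lN : (l < N)%N) w :
  micro jm l.+1 w = (micro jm l w + X (Ordinal lN, Ordinal jm) w)%R.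
Proof. by rewrite /micro big_ord_recr/= addrA. Qed.

Let microN j (jm : (j < m)%N) w : micro jm N w = brownian_sum j.+1 w.
Proof.
rewrite /micro /brownian_sum -big_split/=; apply: eq_bigr => k _.
by rewrite addrC subrK.
Qed.

Let micro_adapted j (jm : (j < m)%N) G l : (l <= N)%N -> brownian_adapted j G ->
  adapted P X (microU j l) (micro jm l) G.
Proof.
move=> + aG; elim: l => [_|l ih lN].
  apply: (adapted_ext _ _ aG) => [p|w]; first by rewrite /microU ltn0 andbF orbF.
  by rewrite /micro big_ord0 addr0.
have nU : ~~ microU j l (Ordinal lN, Ordinal jm).
  by rewrite /microU/= !ltnn eqxx.
apply: (adapted_ext _ _ (adapted_step mX X_law X_indep (mmicro jm l) nU (ih (ltnW lN)))).
  move=> [k i]; rewrite /microU/= xpair_eqE -!val_eqE/= ltnS (leq_eqVlt k).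
  by case: (_ < j)%N => //=; case: (_ == j) => //=; case: (_ == l) => //=; rewrite ?orbF ?orbT.
by move=> w; rewrite microS.
Qed.

Let micro_markov j (jm : (j < m)%N) G l (f : R -> \bar R) : (l < N)%N ->
  brownian_adapted j G -> measurable_fun [set: R] f -> (forall x, 0 <= f x) ->
  \int[P]_(w in G) f (micro jm l.+1 w) =
  \int[P]_(w in G) heat (l.+1%:R * (tau j.+1 - tau j))%R f (brownian_sum j w).
Proof.
move=> + aG; elim: l f => [|l ih] f lN mf f0.
  have a0 := micro_adapted jm (leq0n N) aG.
  have nU : ~~ microU j 0 (Ordinal lN, Ordinal jm) by rewrite /microU/= !ltnn eqxx.
  under eq_integral do rewrite microS.
  rewrite (adapted_markov mX v0 X_law (mmicro jm 0) nU a0 mf f0).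
  by apply: eq_integral => w _; rewrite /micro big_ord0 addr0 mul1r.
have a1 := micro_adapted jm (ltnW lN) aG.
have nU : ~~ microU j l.+1 (Ordinal lN, Ordinal jm) by rewrite /microU/= !ltnn eqxx.
under eq_integral do rewrite microS.
rewrite (adapted_markov mX v0 X_law (mmicro jm l.+1) nU a1 mf f0).
have dt0 : (0 < tau j.+1 - tau j)%R by rewrite subr_gt0 tau_lt.
have mh := measurable_heat (v (Ordinal lN, Ordinal jm)) mf f0.
have h0 x : 0 <= heat (v (Ordinal lN, Ordinal jm)) f x by exact: heat_ge0.
rewrite (ih _ (ltnW lN) mh h0); apply: eq_integral => w _.
rewrite (heat_semigroup _ (mulr_gt0 (ltr0Sn R l) dt0) (v0 _) mf f0).
by rewrite /v/= -[in RHS]natr1 mulrDl mul1r.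
Qed.

(** The N increments of one time step are added one motion at a time, and the
    variances accumulate by the semigroup law. *)
Lemma brownian_gaussian_walk :
  gaussian_walk P m brownian_sum (fun j => N%:R * tau j)%R brownian_adapted.
Proof.
split.
- by move=> k; exact: msum.
- by move=> k km; rewrite ltr_pM2l ?ltr0n// tau_lt.
- by move=> k G [].
- by move=> k G C aG mC; apply: adaptedI => //; exact: msum.
- by move=> k G G' aG aG' GG'; apply: adaptedU => //; exact: msum.
- move=> k G km aG; have := micro_adapted km (leqnn N) aG.
  apply: adapted_ext => [p|w]; last exact: microN.
  by rewrite /microU ltn_ord andbT ltnS [RHS]leq_eqVlt orbC.
- move=> k G f km aG mf f0.
  have lt : (N.-1 < N)%N by rewrite ltn_predL.
  have := micro_markov km lt aG mf f0; rewrite (prednK N0) => h.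
  rewrite -mulrBr -h; apply: eq_integral => w _.
  by rewrite microN.
Qed.

End brownian_walk.

(** * Dyadic approximation *)

Section dyadic.
Context {R : realType}.
Implicit Types (F : R -> R) (a b t : R).

(** A path that is nonnegative at a and negative somewhere is negative
    on an interval, which contains a dyadic time. *)
Lemma dyadic_sub_zero F a b t : 0 <= a -> a < b -> 0 <= F a -> a <= t <= b ->
  {within [set t : R | 0 <= t], continuous F} -> F t < 0 ->
  exists n i, (0 < i <= 2 ^ n)%N /\ F (a + (b - a) * i%:R / (2 ^ n)%:R) < 0.
Proof.
move=> a0 ab Fa /andP[at_ tb] cF Ft.
have t0 : 0 <= t by exact: le_trans at_.
have /subspace_continuousP/(_ t t0) := cF.
move=> /cvgrPdist_lt/(_ (- F t)); rewrite oppr_gt0 => /(_ Ft).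
rewrite near_withinE => /nbhs_ballP[/= e e0 he].
have ba0 : 0 < b - a by rewrite subr_gt0.
(* The mesh of the n-th dyadic grid is below the radius e of negativity around t. *)
pose n := (Num.truncn ((b - a) / e)).+1.
have hn : (b - a) / (2 ^ n)%:R < e.
  rewrite ltr_pdivrMr ?ltr0n ?expn_gt0// mulrC -ltr_pdivrMr//.
  apply: (lt_le_trans (truncnS_gt _)); rewrite ler_nat.
  exact: ltnW (ltn_expl _ _).
have p0 : 0 < (2 ^ n)%:R :> R by rewrite ltr0n expn_gt0.
pose x := (t - a) / (b - a) * (2 ^ n)%:R.
have x0 : 0 <= x by rewrite !mulr_ge0 ?invr_ge0 ?subr_ge0// ltW.
pose i := Num.truncn x.
have ix : i%:R <= x by rewrite truncn_le.
have xi : x < i.+1%:R by exact: truncnS_gt.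
have tE : t = a + (b - a) * x / (2 ^ n)%:R.
  by rewrite /x; field; rewrite !gt_eqF.
have Fi : F (a + (b - a) * i%:R / (2 ^ n)%:R) < 0.
  have := he (a + (b - a) * i%:R / (2 ^ n)%:R).
  have dist : ball t e (a + (b - a) * i%:R / (2 ^ n)%:R).
    rewrite /ball/= {1}tE opprD addrACA subrr add0r -mulrBl -mulrBr.
    rewrite ger0_norm ?mulr_ge0 ?invr_ge0 ?subr_ge0 ?(ltW p0) ?(ltW ab)//.
    apply: le_lt_trans hn; rewrite ler_wpM2r ?invr_ge0 ?(ltW p0)//.
    rewrite -[leRHS]mulr1 ler_wpM2l ?(ltW ba0)// lerBlDr addrC.
    by rewrite (le_trans (ltW xi))// -natr1.
  move=> /(_ dist); have pos : 0 <= a + (b - a) * i%:R / (2 ^ n)%:R.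
    by rewrite addr_ge0// !mulr_ge0 ?invr_ge0 ?(ltW p0) ?(ltW ba0).
  move=> /(_ pos); rewrite ltr_norml => /andP[+ _].
  by rewrite opprK ltrDl oppr_gt0.
exists n, i; split => //; apply/andP; split.
  rewrite lt0n; apply/eqP => i0; move: Fi; rewrite i0 mulr0 mul0r addr0.
  by rewrite ltNge Fa.
rewrite -(ler_nat R) (le_trans ix)// /x -[leRHS]mul1r ler_wpM2r ?(ltW p0)//.
by rewrite ler_pdivrMr// mul1r lerB.
Qed.

Lemma dyadic_refine a b n i :
  a + (b - a) * (i * 2)%:R / (2 ^ n.+1)%:R = a + (b - a) * i%:R / (2 ^ n)%:R :> R.
Proof.
have p0 : (2 ^ n)%:R != 0 :> R by rewrite pnatr_eq0 expn_eq0.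
by rewrite expnS natrM natrM; field; rewrite p0.
Qed.

Lemma natr_expR_cvg0 k : 0 < k -> N%:R * expR (- k * N%:R) @[N --> \oo] --> (0 : R).
Proof.
move=> k0.
apply: (@squeeze_cvgr _ _ _ _ (fun=> 0) (fun n => 8 / k ^+ 2 * n.+1%:R^-1)); last 2 first.
- exact: cvg_cst.
- rewrite -[X in _ --> X](mulr0 (8 / k ^+ 2)); apply: cvgMr; exact: cvg_harmonic.
near=> N; have N1 : (0 < N)%N by near: N; exact: nbhs_infty_gt.
set p := N%:R : R; have p0 : 0 < p by rewrite ltr0n.
apply/andP; split; first by rewrite mulr_ge0 ?expR_ge0// ltW.
have kp : 0 < k * p / 2 by rewrite divr_gt0// mulr_gt0.
(* Squaring y <= expR y at y = k p / 2 makes expR dominate p quadratically. *)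
have h : k * p / 2 <= expR (k * p / 2).
  by rewrite (le_trans _ (expR_ge1Dx _))// lerDr.
have h2 : (k * p / 2) ^+ 2 <= expR (k * p).
  have -> : expR (k * p) = expR (k * p / 2) ^+ 2.
    by rewrite expr2 -expRD; congr expR; field.
  by rewrite ler_sqr ?nnegrE ?expR_ge0 ?(ltW kp).
rewrite mulNr expRN.
apply: (@le_trans _ _ (p * ((k * p / 2) ^+ 2)^-1)).
  by rewrite ler_pM2l// lef_pV2// posrE ?expR_gt0// exprn_gt0.
have -> : p * ((k * p / 2) ^+ 2)^-1 = 4 / k ^+ 2 / p by field; rewrite !gt_eqF.
have -> : 4 / k ^+ 2 / p = 8 / k ^+ 2 * (2 * p)^-1 by field; rewrite !gt_eqF.
rewrite ler_pM2l ?divr_gt0 ?exprn_gt0// lef_pV2 ?posrE ?mulr_gt0//.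
by rewrite -natrM ler_nat mul2n -addnn -addn1 leq_add2l.
Unshelve. all: by end_near. Qed.

Lemma cvg_step_error (k : R) : 0 < k ->
  (2 ^ n)%:R * (2 * expR (- k * (2 ^ n)%:R)) @[n --> \oo] --> (0 : R).
Proof.
move=> k0; have p2 : (2 ^ n)%N @[n --> \oo] --> \oo.
  apply/cvgnyPge => A; near=> n; apply: (@leq_trans n); last exact: ltnW (ltn_expl _ _).
  by near: n; exact: nbhs_infty_ge.
have h := cvg_comp _ _ p2 (natr_expR_cvg0 k0).
rewrite -[X in _ --> X](mulr0 2).
under eq_fun do rewrite mulrCA.
by apply: cvgMr; exact: h.
Unshelve. all: by end_near. Qed.

End dyadic.

(** * Crossing a line in continuous time *)

Section limits.
Local Open Scope ereal_scope.
Context {R : realType}.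

Lemma integral_bigcup_cvg d (T : measurableType d) (m : {measure set T -> \bar R})
    (G : (set T)^nat) (F : T -> \bar R) :
  (forall n, measurable (G n)) -> nondecreasing_seq G ->
  measurable_fun [set: T] F -> (forall x, 0 <= F x) ->
  \int[m]_(x in G n) F x @[n --> \oo] --> \int[m]_(x in \bigcup_n G n) F x.
Proof.
move=> mG ndG mF F0; rewrite [X in _ --> X]integral_mkcond.
under eq_fun do rewrite integral_mkcond.
have sub n n' : (n <= n')%N -> G n `<=` G n' by move=> /ndG/subsetPset.
apply: ge0_nondecreasing_cvg_integral.
- by move=> n; apply/(measurable_restrictT _ _).1 => //; exact: measurable_funTS.
- by move=> n x; apply: erestrict_ge0 => y _; exact: F0.
- move=> x n n' nn'; rewrite !patchE; case: ifPn => xn; last by case: ifP.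
  by rewrite ifT// inE; apply: (sub _ _ nn'); rewrite -inE.
- move=> x; rewrite patchE; case: ifPn => [/[!inE] -[n0 _ xn0]|xG].
    apply: cvg_near_cst; near=> n; rewrite patchE ifT// inE.
    by apply: (sub n0) => //; near: n; exact: nbhs_infty_ge.
  apply: cvg_near_cst; near=> n; rewrite patchE ifF//.
  by apply: contraNF xG; rewrite !inE => xn; exists n.
Unshelve. all: by end_near. Qed.

Lemma le_cvg_error (X l : \bar R) (u : nat -> \bar R) (e : nat -> R) :
  u n @[n --> \oo] --> l -> e n @[n --> \oo] --> (0 : R)%R ->
  (\forall n \near \oo, X <= u n + (e n)%:E) -> X <= l.
Proof.
move=> ul e0 Xu.
have cv : (u n + (e n)%:E) @[n --> \oo] --> l.
  rewrite -[l in _ --> l]adde0; apply: cvgeD.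
  - by rewrite fin_num_adde_defl.
  - exact: ul.
  - by apply: cvg_EFin; [near=> n|exact: e0].
rewrite -(cvg_lim _ cv)//; apply: lime_ge => //.
by apply/cvg_ex; exists l.
Unshelve. all: by end_near. Qed.

Lemma le_cvg_le (X l : \bar R) (u : nat -> \bar R) :
  u n @[n --> \oo] --> l -> (forall n, u n <= X) -> l <= X.
Proof.
move=> ul uX; rewrite -(cvg_lim _ ul)//; apply: lime_le => //.
  by apply/cvg_ex; exists l.
by near=> n.
Unshelve. all: by end_near. Qed.

Lemma integral_above d (T : measurableType d) (m : {measure set T -> \bar R})
    (G : set T) (Y : T -> R) (h : R -> \bar R) :
  \int[m]_(x in G `&` [set x | (0 <= Y x)%R]) h (Y x) =
  \int[m]_(x in G) above h (Y x).
Proof.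
rewrite integral_mkcondr; apply: eq_integral => x _.
rewrite patchE /above; case: ifPn; case: ifPn => //.
  by move=> /negP Yx /[!inE].
by move=> Yx /negP; rewrite inE.
Qed.

Lemma le_above (f g : R -> \bar R) x : f x <= g x -> above f x <= above g x.
Proof. by rewrite /above; case: ifP. Qed.

Lemma cvg_above (u : nat -> R -> \bar R) (f : R -> \bar R) x :
  u n x @[n --> \oo] --> f x -> above (u n) x @[n --> \oo] --> above f x.
Proof. by rewrite /above; case: ifP => // _ _; exact: cvg_cst. Qed.

End limits.

Section continuous_time.
Local Open Scope ereal_scope.
Context (R : realType) (d : measure_display) (Omega : measurableType d)
  (P : probability Omega R) (B : nat -> R -> {RV P >-> R}).
Context (B_brownian : forall k : nat, standard_brownian_motion (B k)).
Context (B_independent : mutually_independent_processes B).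
Context (N : nat) (N0 : (0 < N)%N).

Definition bsum (t : R) (w : Omega) : R := (\sum_(k < N) B k t w)%R.

(** The clock of the sum of N motions is N t; crossing the line means a negative
    gap. *)
Definition gap (A c t : R) (w : Omega) : R := (A + c * (N%:R * t) - bsum t w)%R.

Definition crosses (A c a b : R) : set Omega :=
  [set w | exists2 t, (a <= t <= b)%R & (gap A c t w < 0)%R].

Let gcross (n : nat) (A c a b : R) : set Omega :=
  [set w | exists2 i, (0 < i <= 2 ^ n)%N &
     (gap A c (a + (b - a) * i%:R / (2 ^ n)%:R) w < 0)%R].

Lemma measurable_bsum t : measurable_fun [set: Omega] (bsum t).
Proof. by apply: measurable_sum => k; exact: measurable_funPT. Qed.

Lemma measurable_gap A c t : measurable_fun [set: Omega] (gap A c t).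
Proof. by apply: measurable_funB => //; exact: measurable_bsum. Qed.

Lemma measurable_gap_lt0 A c t : measurable [set w | (gap A c t w < 0)%R].
Proof.
rewrite -[X in measurable X]setTI (_ : [set w | _] = gap A c t @^-1` `]-oo, 0%R[).
  exact: measurable_gap.
by apply/seteqP; split => w /=; rewrite in_itv.
Qed.

Lemma measurable_gap_ge0 A c t : measurable [set w | (0 <= gap A c t w)%R].
Proof.
rewrite (_ : [set w | _] = ~` [set w | (gap A c t w < 0)%R]).
  by apply: measurableC; exact: measurable_gap_lt0.
by apply/seteqP; split => w /=; [rewrite leNgt => /negP|move=> /negP; rewrite -leNgt].
Qed.

Let gcross_nd A c a b : nondecreasing_seq (fun n => gcross n A c a b).
Proof.
apply/nondecreasing_seqP => n; apply/subsetPset => w [i /andP[i0 ip] gi].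
exists (i * 2)%N; last by rewrite dyadic_refine.
by rewrite muln_gt0 i0/= expnS mulnC leq_mul2l.
Qed.

Let measurable_gcross n A c a b : measurable (gcross n A c a b).
Proof.
rewrite (_ : gcross n A c a b = \bigcup_(i in [set i | (0 < i <= 2 ^ n)%N])
   [set w | (gap A c (a + (b - a) * i%:R / (2 ^ n)%:R) w < 0)%R]).
  by apply: bigcup_measurable => i _; exact: measurable_gap_lt0.
by apply/seteqP; split => w [i hi gi]; exists i.
Qed.

Lemma gap_continuous A c w : {within [set t : R | (0 <= t)%R], continuous (gap A c ^~ w)}.
Proof.
apply/subspace_continuousP => t t0; apply: cvgB.
  apply: cvgD; first exact: cvg_cst.
  apply: cvgMr; apply: cvgMr; apply: cvg_within_filter; exact: cvg_id.
rewrite /bsum; elim: (index_enum _) => [|k ks ih].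
  under eq_fun do rewrite big_nil.
  by rewrite big_nil; exact: cvg_cst.
under eq_fun do rewrite big_cons.
rewrite big_cons; apply: cvgD => //.
by have /subspace_continuousP := @sbm_continuous_paths _ _ _ _ _ (B_brownian k) w; apply.
Qed.

Let crosses_bigcup A c a b : (0 <= a)%R -> (a < b)%R ->
  [set w | (0 <= gap A c a w)%R] `&` crosses A c a b =
  \bigcup_n ([set w | (0 <= gap A c a w)%R] `&` gcross n A c a b).
Proof.
move=> a0 ab; apply/seteqP; split=> [w [ga [t tab gt]]|w [n _ [ga [i /andP[i0 ip] gi]]]].
  have [n [i [ip gi]]] := dyadic_sub_zero a0 ab ga tab (@gap_continuous A c w) gt.
  by exists n => //; split => //; exists i.
split => //; exists (a + (b - a) * i%:R / (2 ^ n)%:R)%R => //.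
have ba : (0 <= b - a)%R by rewrite subr_ge0 ltW.
rewrite lerDl !mulr_ge0 ?invr_ge0//= -lerBrDl -mulrA -[leRHS]mulr1 ler_wpM2l//.
by rewrite ler_pdivrMr ?ltr0n ?expn_gt0// mul1r ler_nat.
Qed.

Context (r s : R) (r0 : (0 < r)%R) (s0 : (0 < s)%R).

Let tau (n i : nat) : R := (if (i <= 2 ^ n)%N then r * i%:R / (2 ^ n)%:R
  else r + s * (i - 2 ^ n)%:R / (2 ^ n)%:R)%R.

Let p0 n : (0 < (2 ^ n)%:R :> R)%R. Proof. by rewrite ltr0n expn_gt0. Qed.

Let tau0 n : tau n 0%N = 0%R. Proof. by rewrite /tau leq0n mulr0 mul0r. Qed.

Let tau1 n i : (i <= 2 ^ n)%N -> tau n i = (0 + (r - 0) * i%:R / (2 ^ n)%:R)%R.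
Proof. by move=> ip; rewrite /tau ip add0r subr0. Qed.

Let tau2 n i : tau n (2 ^ n + i)%N = (r + (r + s - r) * i%:R / (2 ^ n)%:R)%R.
Proof.
have -> : (r + s - r = s)%R by ring.
rewrite /tau; case: i => [|i]; first by rewrite addn0 leqnn mulr0 mul0r addr0 mulfK// gt_eqF.
by rewrite ifF ?addKn//; apply/negbTE; rewrite -ltnNge -addn1 leq_add2l.
Qed.

Let tau_lt n i : (i < 2 ^ n + 2 ^ n)%N -> (tau n i < tau n i.+1)%R.
Proof.
move=> _; have [ip|ip] := ltnP i (2 ^ n).
  rewrite !tau1 ?(ltnW ip)// ltrD2l ltr_pM2r ?invr_gt0//.
  by rewrite ltr_pM2l ?subr0// ltr_nat.
have -> : i = (2 ^ n + (i - 2 ^ n))%N by rewrite subnKC.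
rewrite -addnS !tau2 ltrD2l ltr_pM2r ?invr_gt0// ltr_pM2l ?ltr_nat//.
by rewrite addrAC subrr add0r.
Qed.

Let Z n := brownian_sum B N (tau n).
Let wc n j : R := (N%:R * tau n j)%R.
Let adp n := @brownian_adapted _ _ _ P B N (2 ^ n + 2 ^ n)%N (tau n).

Let walk n : gaussian_walk P (2 ^ n + 2 ^ n) (Z n) (wc n) (adp n).
Proof.
exact: (brownian_gaussian_walk B_brownian B_independent N0 (tau0 n) (@tau_lt n)).
Qed.

Let Nr : (0 < N%:R * r)%R. Proof. by rewrite mulr_gt0// ltr0n. Qed.
Let Ns : (0 < N%:R * s)%R. Proof. by rewrite mulr_gt0// ltr0n. Qed.

Let gapE n A c j w : (A + c * wc n j - Z n j w = gap A c (tau n j) w)%R.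
Proof. by []. Qed.

Let tau_r n : tau n (2 ^ n)%N = r.
Proof. by rewrite tau1// add0r subr0 mulfK// gt_eqF. Qed.

Let tau_rs n : tau n (2 ^ n + 2 ^ n)%N = (r + s)%R.
Proof. by rewrite tau2 mulfK ?gt_eqF//; ring. Qed.

Let past_crossed n A c G :
  crossed_by (Z n) (wc n) A c 0 G (2 ^ n)%N = G `&` gcross n A c 0 r.
Proof.
apply/seteqP; split => [w [Gw [i ip]]|w [Gw [i ip]]] gi; split => //; exists i => //.
  by move: gi; rewrite gapE add0n tau1//; case/andP: ip.
by rewrite gapE add0n tau1//; case/andP: ip.
Qed.

Let future_crossed n A c G :
  crossed_by (Z n) (wc n) A c (2 ^ n)%N G (2 ^ n)%N = G `&` gcross n A c r (r + s).
Proof.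
apply/seteqP; split => [w [Gw [i ip]]|w [Gw [i ip]]] gi; split => //; exists i => //.
  by move: gi; rewrite gapE tau2.
by rewrite gapE tau2.
Qed.

Let step_past n k : (0 <= k < 0 + 2 ^ n)%N ->
  (wc n k.+1 - wc n k)%R = (N%:R * r / (2 ^ n)%:R)%R.
Proof.
rewrite add0n leq0n /= => kp; rewrite /wc !tau1 ?(ltnW kp)// -mulrBr -natr1.
by field; rewrite gt_eqF.
Qed.

Let step_future n k : (2 ^ n <= k < 2 ^ n + 2 ^ n)%N ->
  (wc n k.+1 - wc n k)%R = (N%:R * s / (2 ^ n)%:R)%R.
Proof.
move=> /andP[kp _]; have -> : k = (2 ^ n + (k - 2 ^ n))%N by rewrite subnKC.
rewrite -addnS /wc !tau2 -mulrBr -natr1; field; by rewrite gt_eqF.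
Qed.

Let near_step (D c e : R) : (0 < D)%R -> (0 <= c)%R -> (0 < e)%R ->
  \forall n \near \oo, (2 * c * (D / (2 ^ n)%:R) <= e)%R.
Proof.
move=> D0 c0 e0; near=> n.
rewrite mulrA ler_pdivrMr// -ler_pdivrMl//.
apply: (@le_trans _ _ n%:R); last by rewrite ler_nat ltnW// ltn_expl.
by near: n; exact: nbhs_infty_ger.
Unshelve. all: by end_near. Qed.

Let error_cvg (D e : R) : (0 < D)%R -> (0 < e)%R ->
  ((2 ^ n)%:R * (2 * expR (- e ^+ 2 / (2 * (D / (2 ^ n)%:R)))))%R @[n --> \oo] --> (0 : R)%R.
Proof.
move=> D0 e0; have k0 : (0 < e ^+ 2 / (2 * D))%R by rewrite divr_gt0 ?exprn_gt0 ?mulr_gt0.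
have := cvg_step_error k0; apply: cvg_trans; apply: near_eq_cvg; near=> n.
by do 3 f_equal; field; rewrite !gt_eqF.
Unshelve. all: by end_near. Qed.

Lemma gap0 A c w : gap A c 0 w = A.
Proof.
rewrite /gap mulr0 mulr0 addr0 /bsum big1 ?subr0// => k _; exact: sbm_start.
Qed.

Lemma crosses_past_bigcup A c : (0 <= A)%R ->
  crosses A c 0 r = \bigcup_n gcross n A c 0 r.
Proof.
move=> A0; have := crosses_bigcup A c (lexx 0%R) r0.
rewrite (_ : [set w | (0 <= gap A c 0 w)%R] = setT); last first.
  by apply/seteqP; split => // w _ /=; rewrite gap0.
by rewrite setTI => ->; apply: eq_bigcupr => n _; rewrite setTI.
Qed.

Lemma measurable_crosses_past A c : (0 <= A)%R -> measurable (crosses A c 0 r).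
Proof. by move=> A0; rewrite crosses_past_bigcup//; exact: bigcupT_measurable. Qed.

Lemma measurable_crosses_future A c :
  measurable ([set w | (0 <= gap A c r w)%R] `&` crosses A c r (r + s)).
Proof.
rewrite crosses_bigcup ?ltW// ?ltrDl//; apply: bigcupT_measurable => n.
by apply: measurableI => //; exact: measurable_gap_ge0.
Qed.

(** Grid upper bounds pass to the limit directly; in the lower bound the barrier shift
    goes to 0 after the mesh, so that an error of order 2^n exp (- const e^2 2^n) vanishes first. *)
Lemma integral_crosses A c (g : R -> \bar R) : (0 <= A)%R -> (0 <= c)%R ->
  measurable_fun [set: R] g -> (forall x, 0 <= g x) -> (forall x, g x <= 1) ->
  \int[P]_(w in crosses A c 0 r) above g (gap A c r w) =
  crossing c (N%:R * r) (above g) A.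
Proof.
move=> A0 c0 mg g0 g1.
have mag : measurable_fun [set: R] (above g) by exact: measurable_above.
have ag0 x : 0 <= above g x by exact: above_ge0.
have ag1 x : above g x <= 1 by rewrite /above; case: ifP.
have adpT n : adp n 0 setT.
  exact: (brownian_adapted0 B_brownian B_independent N (tau0 n) (@tau_lt n)).
have cvgE : \int[P]_(w in gcross n A c 0 r) above g (gap A c r w) @[n --> \oo] -->
    \int[P]_(w in crosses A c 0 r) above g (gap A c r w).
  rewrite crosses_past_bigcup//; apply: integral_bigcup_cvg => //.
  exact: (measurableT_comp mag (measurable_gap A c r)).
have wcr n : (wc n (0 + 2 ^ n)%N - wc n 0%N)%R = (N%:R * r)%R.
  by rewrite add0n /wc tau_r tau0 mulr0 subr0.
have start n w : (A + c * wc n 0%N - Z n 0%N w)%R = A by rewrite gapE tau0 gap0.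
have km n : (0 + 2 ^ n <= 2 ^ n + 2 ^ n)%N by rewrite add0n leq_addr.
have pn n : (0 < 2 ^ n)%N by rewrite expn_gt0.
have endE n w : (A + c * wc n (0 + 2 ^ n)%N - Z n (0 + 2 ^ n)%N w)%R = gap A c r w.
  by rewrite gapE add0n tau_r.
have endI n f : \int[P]_(x in crossed_by (Z n) (wc n) A c 0 setT (2 ^ n)%N)
      f (A + c * wc n (0 + 2 ^ n)%N - Z n (0 + 2 ^ n)%N x)%R =
    \int[P]_(w in gcross n A c 0 r) f (gap A c r w).
  by rewrite past_crossed setTI; apply: eq_integral => w _; rewrite endE.
have cstI (k : \bar R) : 0 <= k -> \int[P]_(x in setT) k = k.
  by move=> k0; rewrite integral_cst// [X in _ * X]probability_setT mule1.
apply/eqP; rewrite eq_le; apply/andP; split.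
  apply: (le_cvg_le cvgE) => n.
  have := crossed_by_le (walk n) A c (km n) (adpT n) mag ag0 (pn n).
  rewrite endI => h; apply: (le_trans h).
  rewrite [leLHS](eq_integral (fun=> crossing c (N%:R * r) (above g) A)).
    by rewrite cstI//; exact: crossing_ge0.
  by move=> w _; rewrite wcr start.
apply: (crossing_above_le_lim Nr mg g0) => k.
have e0 : (0 < k.+1%:R^-1 :> R)%R by rewrite invr_gt0.
apply: (le_cvg_error cvgE (error_cvg Nr e0)).
near=> n.
have small : (2 * c * (N%:R * r / (2 ^ n)%:R) <= k.+1%:R^-1)%R.
  by near: n; exact: near_step.
have G0 w : [set: Omega] w -> (0 <= A + c * wc n 0%N - Z n 0%N w)%R by rewrite start.
have := @crossed_by_ge _ _ _ _ _ _ _ _ (walk n) A c _ _ (km n) _ (adpT n) _ mag ag0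
  (pn n) _ _ ag1 c0 (@step_past n) G0 small.
rewrite endI; apply: le_trans.
rewrite [leRHS](eq_integral (fun=> crossing c (N%:R * r)
    (fun x => above g (x - k.+1%:R^-1)%R) (A + k.+1%:R^-1)%R)).
  by rewrite cstI//; exact: crossing_ge0.
by move=> w _; rewrite wcr start.
Unshelve. all: by end_near. Qed.

Local Notation one := (fun=> 1 : \bar R).

Lemma above_idem (g : R -> \bar R) : above (above g) = above g.
Proof. by apply/funext => x; rewrite /above; case: leP. Qed.

Lemma above_crossing1_le1 c v x : (0 < v)%R -> above (crossing c v one) x <= 1.
Proof.
move=> v0; rewrite /above; case: ifPn => // x0.
by rewrite (le_trans (crossing_le_heat c v0 _ _ x0))// heat_cst.
Qed.

Let integral_one (E : set Omega) : measurable E -> \int[P]_(w in E) one w = P E.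
Proof. by move=> mE; rewrite integral_cst// mul1e. Qed.

Let future_bigcup (G : nat -> set Omega) A c :
  (forall n, adp n (2 ^ n)%N (G n)) -> nondecreasing_seq G -> (0 <= c)%R ->
  P (\bigcup_n G n `&` ([set w | (0 <= gap A c r w)%R] `&` crosses A c r (r + s))) =
  \int[P]_(w in \bigcup_n G n) above (crossing c (N%:R * s) one) (gap A c r w).
Proof.
move=> aG ndG c0.
have mG n : measurable (G n) := adp_measurable (walk n) (aG n).
set pos := [set w | (0 <= gap A c r w)%R].
have mpos : measurable pos by exact: measurable_gap_ge0.
set h := crossing c (N%:R * s) one.
have mh : measurable_fun [set: R] h by exact: measurable_crossing.
have h0 x : 0 <= h x by exact: crossing_ge0.
have mgap := measurable_gap A c r.
have pn n : (0 < 2 ^ n)%N by rewrite expn_gt0.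
have wcs n : (wc n (2 ^ n + 2 ^ n)%N - wc n (2 ^ n)%N)%R = (N%:R * s)%R.
  by rewrite /wc tau_r tau_rs; ring.
have start n w : (A + c * wc n (2 ^ n)%N - Z n (2 ^ n)%N w)%R = gap A c r w.
  by rewrite gapE tau_r.
have adpG n : adp n (2 ^ n)%N (G n `&` pos).
  have -> : pos = Z n (2 ^ n)%N @^-1` [set z | (0 <= A + c * (N%:R * r) - z)%R].
    by apply/seteqP; split => w; rewrite /pos/= /gap /bsum /Z /brownian_sum tau_r.
  apply: (adpI (walk n)) => //.
  rewrite (_ : [set z | _] = `]-oo, (A + c * (N%:R * r))%R]%classic) //.
  by apply/seteqP; split => z /=; rewrite in_itv/= subr_ge0.
have mE n : measurable (G n `&` pos `&` gcross n A c r (r + s)).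
  by apply: measurableI => //; exact: measurableI.
have EU : \bigcup_n G n `&` (pos `&` crosses A c r (r + s)) =
    \bigcup_n (G n `&` pos `&` gcross n A c r (r + s)).
  rewrite crosses_bigcup ?ltW// ?ltrDl//; apply/seteqP; split.
    move=> w [[n1 _ G1] [n2 _ [pw g2]]]; exists (maxn n1 n2) => //; split.
      split => //; move: w G1 {g2 pw}; apply/subsetPset/ndG; exact: leq_maxl.
    move: w g2 {G1 pw}; apply/subsetPset; apply: gcross_nd; exact: leq_maxr.
  by move=> w [n _ [[Gw pw] gw]]; split; exists n.
have ndE : nondecreasing_seq (fun n => G n `&` pos `&` gcross n A c r (r + s)).
  move=> n n' nn'; apply/subsetPset; apply: setISS; last exact/subsetPset/gcross_nd.
  by apply: setSI; exact/subsetPset/ndG.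
have cvgP : P (G n `&` pos `&` gcross n A c r (r + s)) @[n --> \oo] -->
    P (\bigcup_n G n `&` (pos `&` crosses A c r (r + s))).
  rewrite EU; apply: nondecreasing_cvg_mu => //.
  exact: bigcupT_measurable.
have cvgI (g : R -> \bar R) : measurable_fun [set: R] g -> (forall x, 0 <= g x) ->
    \int[P]_(w in G n) above g (gap A c r w) @[n --> \oo] -->
    \int[P]_(w in \bigcup_n G n) above g (gap A c r w).
  move=> mg g0; apply: integral_bigcup_cvg => //.
    exact: (measurableT_comp (measurable_above mg) mgap).
  by move=> w; exact: above_ge0.
apply/eqP; rewrite eq_le; apply/andP; split.
  apply: (le_cvg_le cvgP) => n.
  have := crossed_by_le (walk n) A c (leqnn _) (adpG n) (measurable_cst _)
    (fun=> lee01) (pn n) (f := one).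
  rewrite future_crossed integral_one// => le1; apply: (le_trans le1).
  rewrite (eq_integral (fun w => h (gap A c r w))); last first.
    by move=> w _; rewrite wcs start.
  rewrite integral_above; apply: ge0_subset_integral => //.
  - exact: bigcupT_measurable.
  - apply: measurable_funTS.
    exact: (measurableT_comp (measurable_above mh) mgap).
  - by move=> w _; exact: above_ge0.
  - exact: bigcup_sup.
(* The line is raised by 1 / (k + 1) while the mesh goes to 0. *)
have key k : \int[P]_(w in \bigcup_n G n)
    above (fun y => h (y + k.+1%:R^-1)%R) (gap A c r w) <=
    P (\bigcup_n G n `&` (pos `&` crosses A c r (r + s))).
  have e0 : (0 < k.+1%:R^-1 :> R)%R by rewrite invr_gt0.
  set hk := fun y : R => h (y + k.+1%:R^-1)%R.
  have mhk : measurable_fun [set: R] hk by exact: measurable_comp_shift.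
  apply: (le_cvg_le (cvgI hk mhk (fun x => h0 _))) => n0.
  apply: (le_cvg_error cvgP (error_cvg Ns e0)).
  near=> n.
  have small : (2 * c * (N%:R * s / (2 ^ n)%:R) <= k.+1%:R^-1)%R.
    by near: n; exact: near_step.
  have n0n : (n0 <= n)%N by near: n; exact: nbhs_infty_ge.
  have G0 w : (G n `&` pos) w -> (0 <= A + c * wc n (2 ^ n)%N - Z n (2 ^ n)%N w)%R.
    by case=> _; rewrite start.
  have := @crossed_by_ge _ _ _ _ _ _ _ _ (walk n) A c _ _ (leqnn _) _ (adpG n) one
    (measurable_cst _) (fun=> lee01) (pn n) _ _ (fun=> lexx _) c0 (@step_future n) G0 small.
  rewrite future_crossed integral_one//; apply: le_trans.
  rewrite [leRHS](eq_integral (fun w => hk (gap A c r w))); last first.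
    by move=> w _; rewrite wcs start.
  rewrite integral_above; apply: ge0_subset_integral => //.
  - apply: measurable_funTS.
    exact: (measurableT_comp (measurable_above mhk) mgap).
  - by move=> w _; apply: above_ge0 => x; exact: h0.
  - by apply/subsetPset/ndG.
have cvgK : (\int[P]_(w in \bigcup_n G n)
    above (fun y => h (y + k.+1%:R^-1)%R) (gap A c r w)) @[k --> \oo] -->
    \int[P]_(w in \bigcup_n G n) above h (gap A c r w).
  have mU : measurable (\bigcup_n G n) by exact: bigcupT_measurable.
  apply: (ge0_nondecreasing_cvg_integral_in (u := fun k w =>
      above (fun y => h (y + k.+1%:R^-1)%R) (gap A c r w)) mU).
  - move=> k; have mhk := measurable_above (measurable_comp_shift k.+1%:R^-1%R mh).
    exact: (measurableT_comp mhk mgap).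
  - by move=> k w; apply: above_ge0 => y; exact: h0.
  - move=> w k k' kk'; apply: le_above.
    have -> : (gap A c r w + k.+1%:R^-1 =
        gap A c r w + k'.+1%:R^-1 + (k.+1%:R^-1 - k'.+1%:R^-1))%R by ring.
    apply: (crossing1_nincr _ Ns c0).
    by rewrite subr_ge0 lef_pV2 ?posrE// ler_nat.
  - move=> w; apply: (cvg_above (u := fun k y => h (y + k.+1%:R^-1)%R)).
    exact: (@crossing1_cvg _ c _ (gap A c r w) Ns).
exact: (le_cvg_le cvgK key).
Unshelve. all: by end_near. Qed.

Lemma probability_future A c : (0 <= c)%R ->
  P ([set w | (0 <= gap A c r w)%R] `&` crosses A c r (r + s)) =
  \int[P]_w above (crossing c (N%:R * s) one) (gap A c r w).
Proof.
move=> c0; have UT : \bigcup_(n in [set: nat]) [set: Omega] = setT.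
  by apply/seteqP; split => // w _; exists 0%N.
have := @future_bigcup (fun=> setT) A c _ _ c0; rewrite UT setTI; apply => //.
move=> n; have aT := brownian_adapted0 B_brownian B_independent N (tau0 n) (@tau_lt n).
have h j : (j <= 2 ^ n)%N -> adp n j setT.
  elim: j => [//|j ih] jn; apply: (adpS (walk n)); last exact/ih/ltnW.
  exact: leq_trans jn (leq_addr _ _).
exact: h.
Qed.

(** The past crossing is an event of the grid past, and the two-sided grid bounds are
    applied to the future only. *)
Lemma probability_past_future A1 c1 A c : (0 <= A1)%R -> (0 <= c)%R ->
  P (crosses A1 c1 0 r `&`
     ([set w | (0 <= gap A c r w)%R] `&` crosses A c r (r + s))) =
  \int[P]_(w in crosses A1 c1 0 r) above (crossing c (N%:R * s) one) (gap A c r w).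
Proof.
move=> A10 c0; rewrite crosses_past_bigcup//; apply: future_bigcup => //.
move=> n; rewrite -[X in adp n _ X]setTI -past_crossed -[X in adp n X _]add0n.
have aT := brownian_adapted0 B_brownian B_independent N (tau0 n) (@tau_lt n).
have km : (0 + 2 ^ n <= 2 ^ n + 2 ^ n)%N by rewrite add0n leq_addr.
exact: (adp_crossed (walk n) A1 c1 km aT (leqnn _)).
Qed.

End continuous_time.

(** * The Gaussian tail *)

Section tail.
Context {R : realType}.
Local Notation mu := (@lebesgue_measure R).
Local Notation one := (fun=> 1%E : \bar R).
Implicit Types (v b x y : R).

Let is_derive_gauss v b x : 0 < v ->
  is_derive x (1 : R) (fun y => gauss v (y + b)) (- (x + b) / v * gauss v (x + b)).
Proof.
move=> v0.
have h1 : is_derive x (1 : R) (fun y => - (y + b) ^+ 2 / (2 * v)) (- (x + b) / v).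
  apply: is_derive_eq.
  by rewrite /GRing.scale /= ; field; rewrite gt_eqF.
have h2 : is_derive x (1 : R) (fun y => expR (- (y + b) ^+ 2 / (2 * v)))
    (expR (- (x + b) ^+ 2 / (2 * v)) * (- (x + b) / v)).
  exact: is_derive1_comp.
rewrite /gauss; apply: is_derive_eq.
by rewrite /GRing.scale /=; ring.
Qed.

Let F v b x := - (v * ((x + b)^-1 * gauss v (x + b))).

Let is_derive_F v b x : 0 < v -> 0 < x + b ->
  is_derive x (1 : R) (F v b) (gauss v (x + b) * (1 + v / (x + b) ^+ 2)).
Proof.
move=> v0 xb; have xb0 : x + b != 0 by rewrite gt_eqF.
have h0 : is_derive x (1 : R) (fun y => y + b) 1.
  by apply: is_derive_eq; rewrite addr0.
have h1 : is_derive x (1 : R) (fun y => (y + b)^-1) (- (x + b) ^- 2 *: (1 : R)).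
  exact: is_deriveV.
have h2 := is_derive_gauss b x v0.
rewrite /F; apply: is_derive_eq.
by rewrite /GRing.scale /=; field; rewrite xb0 gt_eqF.
Qed.

(** The integrand is the derivative of minus the ratio v gauss / (x + b). *)
Lemma gauss_tail_FTC v b : 0 < v -> 0 < b ->
  (\int[mu]_(x in `[0%R, +oo[) (gauss v (x + b) * (1 + v / (x + b) ^+ 2))%:E =
   (v / b * gauss v b)%:E)%E.
Proof.
move=> v0 b0.
have pos x : 0 <= x -> 0 < x + b by move=> x0; rewrite ltr_wpDl.
have cF x : 0 <= x -> {for x, continuous (F v b)}.
  move=> x0; apply: differentiable_continuous; apply/derivable1_diffP.
  by have [] := is_derive_F v0 (pos x x0).
rewrite (@ge0_continuous_FTC2y _ _ (F v b) 0 0).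
- by rewrite -EFinB /F !add0r opprK mulrA.
- by move=> x x0; rewrite mulr_ge0 ?gauss_ge0// addr_ge0// divr_ge0 ?exprn_ge0// ltW// pos.
- apply: continuous_in_subspaceT => x; rewrite inE/= in_itv/= andbT => x0.
  have h1 : {for x, continuous (fun y => gauss v (y + b))}.
    apply: differentiable_continuous; apply/derivable1_diffP.
    by have [] := is_derive_gauss b x v0.
  apply: cvgM; first exact: h1.
  apply: cvgD; first exact: cvg_cst.
  apply: cvgM; first exact: cvg_cst.
  apply: cvgV; first by rewrite expf_neq0// gt_eqF// pos.
  apply: (cvg_comp (fun x => x + b) (fun x => x ^+ 2)); last exact: sqr_continuous.
  by apply: cvgD; [exact: cvg_id|exact: cvg_cst].
- apply: (@squeeze_cvgr _ _ _ _ (fun x => - (v / Num.sqrt (2 * pi * v)) * (x + b)^-1)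
      (fun=> 0)); last 2 first.
  + rewrite -[X in _ --> X](mulr0 (- (v / Num.sqrt (2 * pi * v)))); apply: cvgMr.
    by apply/gtr0_cvgV0; [near=> x; exact: pos|exact: cvg_addrr].
  + exact: cvg_cst.
  near=> x; have xb : 0 < x + b by apply: pos.
  rewrite oppr_le0 mulr_ge0 ?mulr_ge0 ?gauss_ge0 ?invr_ge0 ?(ltW xb) ?(ltW v0)// andbT.
  rewrite mulNr lerN2 -[leRHS]mulrA ler_pM2l// [leRHS]mulrC ler_pM2l ?invr_gt0//.
  rewrite /gauss ler_piMl ?invr_ge0 ?sqrtr_ge0// -expR0 ler_expR.
  by rewrite mulNr oppr_le0 divr_ge0 ?sqr_ge0// mulr_ge0// ltW.
- by move=> x x0; have [] := is_derive_F v0 (pos x (ltW x0)).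
- by apply: cvg_at_right_filter; exact: cF.
- move=> x; rewrite in_itv/= andbT => x0.
  by rewrite derive1E; have [_ ->] := is_derive_F v0 (pos x (ltW x0)).
Unshelve. all: by end_near. Qed.

Lemma fin_num_tail v b : 0 < v -> heat v (above one) b \is a fin_num.
Proof.
move=> v0; rewrite ge0_fin_numE; last by apply: heat_ge0; exact: above_ge0.
apply: (@le_lt_trans _ _ 1%E); last exact: ltry.
apply: (@le_trans _ _ (heat v one b)); last by rewrite heat_cst.
apply: le_heat => //.
- exact: measurable_above.
- exact: above_ge0.
- by move=> x; rewrite /above; case: ifP.
Qed.

(** Probability that a centered normal variable of variance v exceeds b. *)
Definition tail v b : R := fine (heat v (above one) (- b)).

Lemma tailE v b : 0 < v -> heat v (above one) b = (tail v (- b))%:E.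
Proof. by move=> v0; rewrite /tail opprK fineK// fin_num_tail. Qed.

Lemma tail_ge0 v b : 0 <= tail v b.
Proof. by apply: fine_ge0; apply: heat_ge0; exact: above_ge0. Qed.

Lemma heatE v f b : heat v f b = (\int[mu]_x (f x * (gauss v (x - b))%:E))%E.
Proof. by []. Qed.

Opaque tail heat.

Lemma tail_below v b : 0 < v -> heat v (below one) b = (tail v b)%:E.
Proof. by move=> v0; rewrite heat_below_above (tailE (- b) v0) opprK. Qed.

Lemma tailN v b : 0 < v -> tail v (- b) = 1 - tail v b.
Proof.
move=> v0; have := @heat_cst _ v 1 b v0 ler01.
rewrite heat_split// tail_below// tailE// -EFinD => -[<-].
by rewrite addrAC subrr add0r.
Qed.

Lemma tail0 v : 0 < v -> tail v 0 = 1 / 2.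
Proof. by move=> v0; move: (tailN 0 v0); rewrite oppr0; move: (tail v 0) => t; lra. Qed.

Lemma tail_le1 v b : 0 < v -> tail v b <= 1.
Proof. by move=> v0; rewrite -subr_ge0 -tailN// tail_ge0. Qed.

Let tail_integral v b : 0 < v ->
  (\int[mu]_(x in `[0%R, +oo[) (gauss v (x + b))%:E = (tail v b)%:E)%E.
Proof.
move=> v0; rewrite -[b in RHS]opprK -tailE// heatE [LHS]integral_mkcond.
apply: eq_integral => x _; rewrite patchE /above.
rewrite (_ : (x \in _) = (0 <= x)) ?opprK.
  by case: ifPn => _; rewrite ?mul1e ?mul0e.
by apply/idP/idP; rewrite inE/= in_itv/= andbT.
Qed.

(** Mills' ratio: the factor 1 + v / (x + b)^2 in the exact primitive lies between 1 and its
    value at x = 0. *)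
Lemma mills v b : 0 < v -> 0 < b ->
  tail v b <= v / b * gauss v b <= (1 + v / b ^+ 2) * tail v b.
Proof.
move=> v0 b0; have FTC := gauss_tail_FTC v0 b0.
have mg : measurable_fun [set: R] (fun x => gauss v (x + b)).
  by apply: (measurableT_comp (measurable_gauss v)); exact: measurable_funD.
have mf : measurable_fun (`[0, +oo[ : set R)
    (fun x => (gauss v (x + b) * (1 + v / (x + b) ^+ 2))%:E).
  apply/measurable_EFinP; apply: measurable_funM; first exact: measurable_funTS.
  apply: subspace_continuous_measurable_fun => //.
  apply: continuous_in_subspaceT => x; rewrite inE/= in_itv/= andbT => x0.
  apply: cvgD; first exact: cvg_cst.
  apply: cvgM; first exact: cvg_cst.
  apply: cvgV; first by rewrite expf_neq0// gt_eqF// ltr_wpDl.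
  apply: (cvg_comp (fun x => x + b) (fun x => x ^+ 2)); last exact: sqr_continuous.
  by apply: cvgD; [exact: cvg_id|exact: cvg_cst].
apply/andP; split.
  rewrite -lee_fin -tail_integral// -FTC; apply: ge0_le_integral => //.
  - by move=> x _; rewrite lee_fin gauss_ge0.
  - by apply/measurable_EFinP; exact: measurable_funTS.
  - move=> x; rewrite /= in_itv/= andbT => x0.
    rewrite lee_fin ler_peMr ?gauss_ge0// lerDl divr_ge0 ?sqr_ge0//; exact: ltW.
rewrite -lee_fin [leRHS]EFinM -tail_integral// -ge0_integralZl//; last 3 first.
- by apply/measurable_EFinP; exact: measurable_funTS.
- by move=> x _; rewrite lee_fin gauss_ge0.
- by rewrite lee_fin addr_ge0// divr_ge0 ?sqr_ge0// ltW.
rewrite -FTC; apply: ge0_le_integral => //.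
- move=> x; rewrite /= in_itv/= andbT => x0; rewrite lee_fin mulr_ge0 ?gauss_ge0//.
  by rewrite addr_ge0// divr_ge0 ?sqr_ge0// ltW.
- apply: emeasurable_funM => //; apply/measurable_EFinP; exact: measurable_funTS.
move=> x; rewrite /= in_itv/= andbT => x0; rewrite -EFinM lee_fin mulrC.
rewrite ler_wpM2r ?gauss_ge0// lerD2l ler_pM2l// lef_pV2 ?posrE ?exprn_gt0//; last first.
  by rewrite ltr_wpDl.
by rewrite ler_sqr ?nnegrE ?addr_ge0 ?(ltW b0)// lerDr.
Qed.

End tail.

(** * Exponential rates of decay *)

Section decay.
Context {R : realType}.
Implicit Types (X Y : nat -> R) (k C : R).

(** X N behaves like C exp (- k N); for C = 0 it is negligible in comparison. *)
Definition exp_decay X k C := X N * expR (k * N%:R) @[N --> \oo] --> C.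

(** The same with the prefactor 1 / sqrt N that comes from a Gaussian tail. *)
Definition sqrt_decay X k C :=
  X N * (Num.sqrt N%:R * expR (k * N%:R)) @[N --> \oo] --> C.

Lemma cvg_near_eq (u w : nat -> R) C : (\forall n \near \oo, u n = w n) ->
  u n @[n --> \oo] --> C -> w n @[n --> \oo] --> C.
Proof. by move=> uw uC; apply: cvg_trans uC; apply: near_eq_cvg; exact: uw. Qed.

Lemma near_bounded_cvg0 (u w : nat -> R) : w n @[n --> \oo] --> (0 : R) ->
  (\forall n \near \oo, 0 <= u n <= w n) -> u n @[n --> \oo] --> (0 : R).
Proof. by move=> w0 uw; apply: (squeeze_cvgr uw) => //; exact: cvg_cst. Qed.

Lemma expR_cvg0 k : 0 < k -> expR (- k * N%:R) @[N --> \oo] --> (0 : R).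
Proof.
move=> k0; apply: (near_bounded_cvg0 (natr_expR_cvg0 k0)); near=> N.
rewrite expR_ge0/= ler_peMl ?expR_ge0// ler1n; near: N; exact: nbhs_infty_gt.
Unshelve. all: by end_near. Qed.

Lemma sqrt_le_natr (N : nat) : (0 < N)%N -> Num.sqrt N%:R <= N%:R :> R.
Proof.
move=> N0; have N1 : 1 <= N%:R :> R by rewrite ler1n.
by rewrite -[leRHS]ger0_norm// -sqrtr_sqr ler_wsqrtr// expr2 ler_peMl.
Qed.

Lemma sqrt_expR_cvg0 k : 0 < k ->
  Num.sqrt N%:R * expR (- k * N%:R) @[N --> \oo] --> (0 : R).
Proof.
move=> k0; apply: (near_bounded_cvg0 (natr_expR_cvg0 k0)); near=> N.
rewrite mulr_ge0 ?sqrtr_ge0 ?expR_ge0//= ler_wpM2r ?expR_ge0// sqrt_le_natr//.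
near: N; exact: nbhs_infty_gt.
Unshelve. all: by end_near. Qed.

Lemma sqrtV_cvg0 : (Num.sqrt N%:R)^-1 @[N --> \oo] --> (0 : R).
Proof.
rewrite -(cvg_shiftS (fun N : nat => (Num.sqrt N%:R)^-1 : R)).
have : Num.sqrt (n.+1%:R^-1 : R) @[n --> \oo] --> Num.sqrt (0 : R).
  by apply: continuous_cvg; [exact: sqrt_continuous|exact: cvg_harmonic].
by rewrite sqrtr0; apply: cvg_near_eq; near=> n; rewrite sqrtrV.
Unshelve. all: by end_near. Qed.

Let expRB k k' (x : R) : expR (k * x) = expR (k' * x) * expR (- (k' - k) * x).
Proof. by rewrite -expRD; congr expR; ring. Qed.

Lemma exp_decay_lt X k k' C : k < k' -> exp_decay X k' C -> exp_decay X k 0.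
Proof.
move=> kk' h; have k0 : 0 < k' - k by rewrite subr_gt0.
rewrite /exp_decay -(mulr0 C).
apply: cvg_near_eq (cvgM h (expR_cvg0 k0)); near=> N.
by rewrite /= (expRB k k') mulrA.
Unshelve. all: by end_near. Qed.

Lemma exp_decay_sqrt X k k' C : k < k' -> exp_decay X k' C -> sqrt_decay X k 0.
Proof.
move=> kk' h; have k0 : 0 < k' - k by rewrite subr_gt0.
rewrite /sqrt_decay -(mulr0 C).
apply: cvg_near_eq (cvgM h (sqrt_expR_cvg0 k0)); near=> N.
by rewrite /= (expRB k k'); ring.
Unshelve. all: by end_near. Qed.

Lemma sqrt_decay_lt X k k' C : k < k' -> sqrt_decay X k' C -> sqrt_decay X k 0.
Proof.
move=> kk' h; have k0 : 0 < k' - k by rewrite subr_gt0.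
rewrite /sqrt_decay -(mulr0 C).
apply: cvg_near_eq (cvgM h (expR_cvg0 k0)); near=> N.
by rewrite /= (expRB k k'); ring.
Unshelve. all: by end_near. Qed.

(** The prefactor makes even equal rates negligible. *)
Lemma sqrt_decay_exp X k k' C : k <= k' -> sqrt_decay X k' C -> exp_decay X k 0.
Proof.
move=> kk' h.
have z : (Num.sqrt N%:R)^-1 * expR (- (k' - k) * N%:R) @[N --> \oo] --> (0 : R).
  apply: (near_bounded_cvg0 sqrtV_cvg0); near=> N.
  rewrite mulr_ge0 ?invr_ge0 ?sqrtr_ge0 ?expR_ge0//= ler_piMr ?invr_ge0 ?sqrtr_ge0//.
  by rewrite -expR0 ler_expR mulNr oppr_le0 mulr_ge0// subr_ge0.
rewrite /exp_decay -(mulr0 C).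
apply: cvg_near_eq (cvgM h z); near=> N.
have N0 : Num.sqrt N%:R != 0 :> R.
  by rewrite gt_eqF// sqrtr_gt0 ltr0n; near: N; exact: nbhs_infty_gt.
by rewrite /= (expRB k k'); field.
Unshelve. all: by end_near. Qed.

Lemma exp_decay_mul X a k C : exp_decay X k C ->
  exp_decay (fun N => expR (- a * N%:R) * X N) (a + k) C.
Proof.
move=> h; apply: cvg_near_eq h; near=> N.
by rewrite /= mulrDl expRD mulNr expRN; field; rewrite gt_eqF// expR_gt0.
Unshelve. all: by end_near. Qed.

Lemma sqrt_decay_mul X a k C : sqrt_decay X k C ->
  sqrt_decay (fun N => expR (- a * N%:R) * X N) (a + k) C.
Proof.
move=> h; apply: cvg_near_eq h; near=> N.
by rewrite /= mulrDl expRD mulNr expRN; field; rewrite gt_eqF// expR_gt0.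
Unshelve. all: by end_near. Qed.

Lemma exp_decayD X Y k C D : exp_decay X k C -> exp_decay Y k D ->
  exp_decay (fun N => X N + Y N) k (C + D).
Proof.
move=> hX hY; apply: cvg_near_eq (cvgD hX hY); near=> N; by rewrite /= mulrDl.
Unshelve. all: by end_near. Qed.

Lemma exp_decayB X Y k C D : exp_decay X k C -> exp_decay Y k D ->
  exp_decay (fun N => X N - Y N) k (C - D).
Proof.
move=> hX hY; apply: cvg_near_eq (cvgB hX hY); near=> N; by rewrite /= mulrBl.
Unshelve. all: by end_near. Qed.

Lemma sqrt_decayD X Y k C D : sqrt_decay X k C -> sqrt_decay Y k D ->
  sqrt_decay (fun N => X N + Y N) k (C + D).
Proof.
move=> hX hY; apply: cvg_near_eq (cvgD hX hY); near=> N; by rewrite /= mulrDl.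
Unshelve. all: by end_near. Qed.

Lemma sqrt_decayB X Y k C D : sqrt_decay X k C -> sqrt_decay Y k D ->
  sqrt_decay (fun N => X N - Y N) k (C - D).
Proof.
move=> hX hY; apply: cvg_near_eq (cvgB hX hY); near=> N; by rewrite /= mulrBl.
Unshelve. all: by end_near. Qed.

Lemma exp_decay_squeeze X Y W k C : (\forall N \near \oo, X N <= W N <= Y N) ->
  exp_decay X k C -> exp_decay Y k C -> exp_decay W k C.
Proof.
move=> XWY hX hY; apply: (squeeze_cvgr _ hX hY).
by near=> N; rewrite !ler_pM2r ?expR_gt0//; near: N.
Unshelve. all: by end_near. Qed.

Lemma sqrt_decay_squeeze X Y W k C : (\forall N \near \oo, X N <= W N <= Y N) ->
  sqrt_decay X k C -> sqrt_decay Y k C -> sqrt_decay W k C.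
Proof.
move=> XWY hX hY; apply: (squeeze_cvgr _ hX hY).
near=> N; have h : X N <= W N <= Y N by near: N.
have p : 0 <= Num.sqrt N%:R * expR (k * N%:R) by rewrite mulr_ge0 ?sqrtr_ge0 ?expR_ge0.
by case/andP: h => h1 h2; rewrite !ler_wpM2r.
Unshelve. all: by end_near. Qed.

Lemma exp_decay_cst : exp_decay (fun=> 1) 0 1.
Proof.
rewrite /exp_decay; apply: cvg_near_eq (cvg_cst (1 : R)).
by near=> N; rewrite mul0r expR0 mulr1.
Unshelve. all: by end_near. Qed.

Lemma exp_decay_asymp X k C : C != 0 -> exp_decay X k C ->
  asymp_equiv X (fun N => C * expR (- k * N%:R)).
Proof.
move=> C0 h; rewrite /asymp_equiv -[X in _ --> X](divff C0).
apply: cvg_near_eq (cvgM h (cvg_cst C^-1)); near=> N.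
by rewrite /= mulNr expRN; field; rewrite C0 gt_eqF// expR_gt0.
Unshelve. all: by end_near. Qed.

Lemma sqrt_decay_asymp X k C : C != 0 -> sqrt_decay X k C ->
  asymp_equiv X (fun N => C * (1 / Num.sqrt N%:R) * expR (- k * N%:R)).
Proof.
move=> C0 h; rewrite /asymp_equiv -[X in _ --> X](divff C0).
apply: cvg_near_eq (cvgM h (cvg_cst C^-1)); near=> N.
have N0 : Num.sqrt N%:R != 0 :> R.
  by rewrite gt_eqF// sqrtr_gt0 ltr0n; near: N; exact: nbhs_infty_gt.
by rewrite /= mulNr expRN; field; rewrite C0 N0 gt_eqF// expR_gt0.
Unshelve. all: by end_near. Qed.

Lemma tail_sqrt_decay s b : 0 < s -> 0 < b ->
  sqrt_decay (fun N => tail (N%:R * s) (N%:R * b)) (b ^+ 2 / (2 * s))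
    (1 / Num.sqrt (2 * pi) * (Num.sqrt s / b)).
Proof.
move=> s0 b0; set C := 1 / _ * _.
have C0 : 0 < C by rewrite mulr_gt0 ?divr_gt0 ?sqrtr_gt0 ?mulr_gt0 ?pi_gt0.
have main (N : nat) : (0 < N)%N ->
    N%:R * s / (N%:R * b) * gauss (N%:R * s) (N%:R * b) *
    (Num.sqrt N%:R * expR (b ^+ 2 / (2 * s) * N%:R)) = C.
  move=> N0; have n0 : 0 < N%:R :> R by rewrite ltr0n.
  rewrite /gauss /C (_ : - (N%:R * b) ^+ 2 / (2 * (N%:R * s)) = - (b ^+ 2 / (2 * s) * N%:R)); last first.
    by field; rewrite !gt_eqF.
  rewrite expRN !sqrtrM ?mulr_ge0 ?pi_ge0 ?(ltW n0)//.
  have -> : s = Num.sqrt s ^+ 2 by rewrite sqr_sqrtr// ltW.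
  rewrite sqrtr_sqr ger0_norm ?sqrtr_ge0//.
  have h1 : Num.sqrt s != 0 by rewrite gt_eqF// sqrtr_gt0.
  have h2 : Num.sqrt pi != 0 :> R by rewrite gt_eqF// sqrtr_gt0 pi_gt0.
  have h3 : Num.sqrt 2 != 0 :> R by rewrite gt_eqF// sqrtr_gt0.
  have h4 : Num.sqrt N%:R != 0 :> R by rewrite gt_eqF// sqrtr_gt0.
  set e := expR _; have e0 : e != 0 by rewrite gt_eqF// expR_gt0.
  by field; rewrite h1 h2 h3 h4 e0 !gt_eqF.
have lb : C / (1 + s / b ^+ 2 * N%:R^-1) @[N --> \oo] --> C.
  rewrite -[X in _ --> X]mulr1; apply: cvgMr.
  rewrite -[X in _ --> X]invr1; apply: cvgV; first exact: oner_neq0.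
  rewrite -[X in _ --> X]addr0; apply: cvgD; first exact: cvg_cst.
  rewrite -[X in _ --> X](mulr0 (s / b ^+ 2)); apply: cvgMr.
  by rewrite -(cvg_shiftS (fun N : nat => N%:R^-1 : R)); exact: cvg_harmonic.
apply: (squeeze_cvgr _ lb (cvg_cst C)); near=> N.
have N1 : (0 < N)%N by near: N; exact: nbhs_infty_gt.
have n0 : 0 < N%:R :> R by rewrite ltr0n.
have /andP[m1 m2] := @mills R (N%:R * s) (N%:R * b) (mulr_gt0 n0 s0) (mulr_gt0 n0 b0).
set f := Num.sqrt N%:R * expR (b ^+ 2 / (2 * s) * N%:R).
have f0 : 0 < f by rewrite mulr_gt0 ?expR_gt0// sqrtr_gt0.
have q0 : 0 < 1 + s / b ^+ 2 * N%:R^-1.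
  by rewrite addr_gt0// mulr_gt0 ?invr_gt0// divr_gt0// exprn_gt0.
have mN : _ * f = C := main N N1.
apply/andP; split; last by rewrite -mN ler_wpM2r// ltW.
rewrite ler_pdivrMr// -mN [leRHS]mulrAC ler_wpM2r ?(ltW f0)//.
rewrite [leRHS]mulrC (le_trans m2)// le_eqVlt; apply/orP; left; apply/eqP.
by field; rewrite !gt_eqF.
Unshelve. all: by end_near. Qed.

Lemma tail_exp_decay0 s : 0 < s ->
  exp_decay (fun N => tail (N%:R * s) (N%:R * 0)) 0 (1 / 2).
Proof.
move=> s0; apply: cvg_near_eq (cvg_cst (1 / 2 : R)); near=> N.
rewrite mul0r expR0 !mulr1 mulr0 tail0// mulr_gt0// ltr0n.
near: N; exact: nbhs_infty_gt.
Unshelve. all: by end_near. Qed.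

Lemma tail_exp_decay_lt0 s b : 0 < s -> b < 0 ->
  exp_decay (fun N => tail (N%:R * s) (N%:R * b)) 0 1.
Proof.
move=> s0 b0; have Nb0 : 0 < - b by rewrite oppr_gt0.
have h := tail_sqrt_decay s0 Nb0.
have k0 : 0 <= (- b) ^+ 2 / (2 * s) by rewrite divr_ge0 ?sqr_ge0// mulr_ge0// ltW.
have h1 := exp_decayB exp_decay_cst (sqrt_decay_exp k0 h).
rewrite subr0 in h1; apply: cvg_near_eq h1; near=> N.
congr (_ * _); rewrite -tailN ?mulrN ?opprK// mulr_gt0// ltr0n.
near: N; exact: nbhs_infty_gt.
Unshelve. all: by end_near. Qed.

End decay.

(** * Closed forms and bounds for one and two crossings *)

Section excursions.
Context {R : realType}.
Implicit Types (a c g k l n s t : R).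
Local Notation one := (fun=> 1%E : \bar R).

Lemma EFin_le (a b : \bar R) (x y : R) : a = x%:E -> b = y%:E -> (a <= b)%E -> x <= y.
Proof. by move=> -> ->; rewrite lee_fin. Qed.

(** The probability that a Brownian motion with clock n u crosses the line
    n a + c n u before u = t, for a >= 0. *)
Definition hit a c t n :=
  tail (n * t) (n * (a + c * t)) +
  expR (- (2 * a * c) * n) * tail (n * t) (n * (a - c * t)).

Lemma crossing_one_hit a c t n : 0 < t -> 0 < n ->
  crossing c (n * t) one (n * a) = (hit a c t n)%:E.
Proof.
move=> t0 n0; have v0 : 0 < n * t by rewrite mulr_gt0.
rewrite (crossingE c (n * a) v0 (measurable_cst _) (fun=> lee01)).
rewrite (tail_below (n * a + c * (n * t)) v0).
rewrite (tailE (c * (n * t) - n * a) v0).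
rewrite -EFinM -EFinD; apply: (congr1 (@EFin R)).
have -> : n * a + c * (n * t) = n * (a + c * t) by ring.
have -> : - (c * (n * t) - n * a) = n * (a - c * t) by ring.
have -> // : - (2 * c) * (n * a) = - (2 * a * c) * n by ring.
Qed.

(** Closed form of the integral of exp (- g x) over x > 0 against the Gaussian density of
    mean n l and variance n t. *)
Definition tilted l t g n :=
  expR (- (g * l - g ^+ 2 * t / 2) * n) * tail (n * t) (n * (g * t - l)).

Lemma heat_tilted l t g n : 0 < t -> 0 < n ->
  heat (n * t) (fun x => (expR (- g * x))%:E * above one x)%E (n * l) =
  (tilted l t g n)%:E.
Proof.
move=> t0 n0; have v0 : 0 < n * t by rewrite mulr_gt0.
have ma : measurable_fun [set: R] (above one) by exact: measurable_above.
rewrite (heat_tilt g (n * l) v0 ma (above_ge0 (fun=> lee01))).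
rewrite (tailE (n * l - g * (n * t)) v0) -EFinM; apply: (congr1 (@EFin R)); rewrite /tilted.
have -> : - (n * l - g * (n * t)) = n * (g * t - l) by ring.
have -> // : - g * (n * l) + g ^+ 2 * (n * t) / 2 = - (g * l - g ^+ 2 * t / 2) * n.
by field.
Qed.

Lemma tilted_ge0 l t g n : 0 <= tilted l t g n.
Proof. by rewrite mulr_ge0 ?tail_ge0 ?expR_ge0. Qed.

Lemma tilted_le_expR l t g n : 0 < t -> 0 < n ->
  tilted l t g n <= expR (- (g * l - g ^+ 2 * t / 2) * n).
Proof. by move=> t0 n0; rewrite ler_piMr ?expR_ge0// tail_le1// mulr_gt0. Qed.

Opaque tilted hit.

Let mtilt (f : R -> \bar R) g : measurable_fun [set: R] f ->
  measurable_fun [set: R] (fun x => (expR (- g * x))%:E * above f x)%E.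
Proof.
move=> mf; apply: emeasurable_funM; first exact: measurable_expR_lin.
exact: measurable_above.
Qed.

Let tilt_ge0 (f : R -> \bar R) g x : (forall x, 0 <= f x)%E ->
  (0 <= (expR (- g * x))%:E * above f x)%E.
Proof. by move=> f0; rewrite mule_ge0 ?lee_fin ?expR_ge0// above_ge0. Qed.

Lemma le_heat_tilt (f h : R -> \bar R) g k v y :
  measurable_fun [set: R] f -> measurable_fun [set: R] h ->
  (forall x, 0 <= f x)%E -> (forall x, 0 <= h x)%E ->
  (forall x : R, (0 <= x)%R -> (expR (- g * x))%:E * f x <= (expR (- k * x))%:E * h x)%E ->
  (heat v (fun x => (expR (- g * x))%:E * above f x) y <=
   heat v (fun x => (expR (- k * x))%:E * above h x) y)%E.
Proof.
move=> mf mh f0 h0 fh; apply: (@le_heat _ v _ _ y (mtilt g mf) (mtilt k mh)) => x.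
  exact: tilt_ge0.
by rewrite /above; case: (leP 0%R x) => [x0|_]; [exact: fh|rewrite !mule0].
Qed.

Lemma tilted_nincr l t g k n : 0 < t -> 0 < n -> g <= k ->
  tilted l t k n <= tilted l t g n.
Proof.
move=> t0 n0 gk; apply: (EFin_le (heat_tilted l k t0 n0) (heat_tilted l g t0 n0)).
apply: le_heat_tilt => // x x0; rewrite !mule1 lee_fin ler_expR.
by rewrite ler_wpM2r// lerN2.
Qed.

(** The gap at time t is positive, a weight exp (- g x) accounts for what happened
    before, and a line of slope c is crossed during the following time s. *)
Definition recrossing l t s g c n :=
  fine (heat (n * t) (fun x => (expR (- g * x))%:E *
    above (crossing c (n * s) one) x)%E (n * l)).

Let mcrossing c v : measurable_fun [set: R] (crossing c v one).
Proof. exact: measurable_crossing. Qed.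

Let crossing0 c v x : (0 <= crossing c v one x)%E.
Proof. exact: crossing_ge0. Qed.

Let heat_recrossing_le l t s g c n : 0 < t -> 0 < s -> 0 < n ->
  (heat (n * t) (fun x => (expR (- g * x))%:E *
    above (crossing c (n * s) one) x) (n * l) <= (tilted l t (g + 2 * c) n)%:E)%E.
Proof.
move=> t0 s0 n0; rewrite -(heat_tilted l (g + 2 * c) t0 n0); apply: le_heat_tilt => // x x0.
rewrite mule1; have ns0 : 0 < n * s by rewrite mulr_gt0.
have -> : - (g + 2 * c) * x = - g * x + - (2 * c) * x by ring.
by rewrite expRD EFinM lee_wpmul2l ?lee_fin ?expR_ge0//; exact: crossing1_le_expR.
Qed.

Lemma recrossingE l t s g c n : 0 < t -> 0 < s -> 0 < n ->
  heat (n * t) (fun x => (expR (- g * x))%:E * above (crossing c (n * s) one) x)%E (n * l) =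
  (recrossing l t s g c n)%:E.
Proof.
move=> t0 s0 n0; rewrite /recrossing fineK// ge0_fin_numE.
  by rewrite (le_lt_trans (heat_recrossing_le _ _ _ t0 s0 n0))// ltry.
by apply: heat_ge0 => x; exact: tilt_ge0.
Qed.

Lemma recrossing_ge0 l t s g c n : 0 <= recrossing l t s g c n.
Proof. by rewrite fine_ge0//; apply: heat_ge0 => x; exact: tilt_ge0. Qed.

Opaque recrossing.

Lemma recrossing_le_tilted l t s g c n : 0 < t -> 0 < s -> 0 < n ->
  recrossing l t s g c n <= tilted l t (g + 2 * c) n.
Proof.
move=> t0 s0 n0; have h := heat_recrossing_le l g c t0 s0 n0.
exact: (EFin_le (recrossingE l g c t0 s0 n0) (erefl _) h).
Qed.

Lemma recrossing_le_past l t s g c n : 0 < t -> 0 < s -> 0 < n ->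
  recrossing l t s g c n <= tilted l t g n.
Proof.
move=> t0 s0 n0; have ns0 : 0 < n * s by rewrite mulr_gt0.
apply: (EFin_le (recrossingE l g c t0 s0 n0) (heat_tilted l g t0 n0)).
apply: le_heat_tilt => // x x0.
rewrite lee_wpmul2l ?lee_fin ?expR_ge0//.
rewrite (le_trans (crossing_le_heat c ns0 (measurable_cst _) (fun=> lee01) x0))//.
by rewrite heat_cst.
Qed.

Lemma recrossing_nincr l t s g k c n : 0 < t -> 0 < s -> 0 < n -> g <= k ->
  recrossing l t s k c n <= recrossing l t s g c n.
Proof.
move=> t0 s0 n0 gk; apply: (EFin_le (recrossingE l k c t0 s0 n0) (recrossingE l g c t0 s0 n0)).
apply: le_heat_tilt => // x x0.
by rewrite lee_wpmul2r// lee_fin ler_expR ler_wpM2r// lerN2.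
Qed.

(** The defect of the crossing probability from exp (- 2 c y) is bounded by
    [crossing1_ge_expR] with the exponent c s / (t + s), which minimizes the resulting
    error rate and leaves the gain (c s)^2 / (2 (t + s)). *)
Lemma tilted_le_recrossing l t s g c n : 0 < t -> 0 < s -> 0 < n -> 0 <= c ->
  l <= (g + 2 * c) * t ->
  tilted l t (g + 2 * c) n <= recrossing l t s g c n +
    expR (- (l ^+ 2 / (2 * t) + (c * s) ^+ 2 / (2 * (t + s))) * n).
Proof.
move=> t0 s0 n0 c0 lgt; have ns0 : 0 < n * s by rewrite mulr_gt0.
have ts0 : 0 < t + s by rewrite addr_gt0.
(* The error exponent n (t b^2 / 2 + s b^2 / 2 - s c b) is least at this b. *)
set b := c * s / (t + s); have b0 : 0 <= b by rewrite divr_ge0 ?mulr_ge0// ltW.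
set h := crossing c (n * s) one.
set e := expR (n * s * (b ^+ 2 / 2 - b * c)).
have e0 : 0 <= e by exact: expR_ge0.
have key : (heat (n * t) (fun x => (expR (- (g + 2 * c) * x))%:E * above one x) (n * l) <=
   heat (n * t) (fun x => (expR (- g * x))%:E * above h x +
     e%:E * ((expR (- (g + 2 * c - b) * x))%:E * above one x)) (n * l))%E.
  apply: le_heat.
  - exact: mtilt.
  - apply: emeasurable_funD; first exact: (mtilt _ (mcrossing c (n * s))).
    by apply: emeasurable_funM => //; exact: mtilt.
  - by move=> x; exact: tilt_ge0.
  - move=> x; rewrite /above; case: (leP 0%R x) => x0; last by rewrite !mule0 adde0.
    rewrite !mule1; have -> : - (g + 2 * c) * x = - g * x + - (2 * c) * x by ring.
    have -> : - (g + 2 * c - b) * x = - g * x + - (2 * c - b) * x by ring.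
    rewrite !expRD !EFinM muleCA -muleDr; last 2 first.
    - by [].
    - by rewrite ge0_adde_def// inE ?crossing0// -EFinM lee_fin mulr_ge0 ?expR_ge0.
    rewrite lee_wpmul2l ?lee_fin ?expR_ge0// -EFinM -expRD.
    rewrite [X in (_ + (expR X)%:E)%E]addrC; exact: crossing1_ge_expR.
move: key; rewrite (heat_tilted l (g + 2 * c) t0 n0) heatD; last 4 first.
- exact: (mtilt _ (mcrossing c (n * s))).
- by apply: emeasurable_funM => //; exact: (mtilt (g + 2 * c - b) (measurable_cst 1%E)).
- by move=> x; apply: tilt_ge0 => z; exact: crossing0.
- by move=> x; rewrite mule_ge0//; exact: tilt_ge0.
rewrite (recrossingE l g c t0 s0 n0) heatZ; last 3 first.
- by apply: mtilt; exact: measurable_cst.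
- by move=> x; exact: tilt_ge0.
- by [].
rewrite (heat_tilted l (g + 2 * c - b) t0 n0) -EFinM -EFinD lee_fin => key.
apply: (le_trans key); rewrite lerD2l.
have bl : l / t - b <= g + 2 * c - b by rewrite lerD2r ler_pdivrMr.
apply: (@le_trans _ _ (e * expR (- ((l / t - b) * l - (l / t - b) ^+ 2 * t / 2) * n))).
  rewrite ler_wpM2l//; apply: (le_trans (tilted_nincr l t0 n0 bl)).
  exact: tilted_le_expR.
rewrite -expRD ler_expR le_eqVlt; apply/orP; left; apply/eqP.
by rewrite /b; field; rewrite !gt_eqF.
Qed.

(** Past crossings are counted by paths started at the mirror image 2 a of the origin,
    from where the future line is b + c u; what is lost are the paths that are above it
    at time t, and these have crossed it by then. *)
Lemma recrossing_hit a l t s b c k n : 0 < t -> 0 < s -> 0 < n ->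
  k * t - a = b + c * t -> a + k * t = l ->
  0 <= expR (- (2 * a * k) * n) * hit b c (t + s) n
       - recrossing l t s (2 * a / t) c n
    <= expR (- (2 * a * k) * n) * hit b c t n.
Proof.
move=> t0 s0 n0 eb el; have nt0 : 0 < n * t by rewrite mulr_gt0.
have ns0 : 0 < n * s by rewrite mulr_gt0.
set h := crossing c (n * s) one.
have mh : measurable_fun [set: R] h by exact: mcrossing.
have h0 x : (0 <= h x)%E by exact: crossing0.
set e := expR (- (2 * a * k) * n).
have recE : (recrossing l t s (2 * a / t) c n)%:E =
    (e%:E * heat (n * t) (above h) (n * b + c * (n * t)))%E.
  rewrite -(recrossingE l (2 * a / t) c t0 s0 n0) -/h.
  have := @heat_image _ k (n * t) (above h) (n * a) nt0 (measurable_above mh) (above_ge0 h0).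
  have -> : 2 * (n * a) / (n * t) = 2 * a / t by field; rewrite !gt_eqF.
  have -> : n * a + k * (n * t) = n * l by rewrite -el; ring.
  have -> : k * (n * t) - n * a = n * b + c * (n * t).
    by transitivity (n * (k * t - a)); [ring|rewrite eb; ring].
  by move=> <-; congr ((expR _)%:E * _)%E; ring.
have hitE : (hit b c (t + s) n)%:E = heat (n * t) h (n * b + c * (n * t)).
  rewrite /h crossing_step//; rewrite -crossing_one_hit ?addr_gt0//.
  by rewrite mulrDr.
have belowle : (heat (n * t) (below h) (n * b + c * (n * t)) <= (hit b c t n)%:E)%E.
  rewrite -crossing_one_hit// /crossing; apply: le_heat.
  - exact: measurable_below.
  - by apply: measurable_reflected.
  - exact: below_ge0.
  - move=> x; rewrite /reflected /below; case: ifP => // x0.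
    rewrite /h crossingE// leeD//.
      by rewrite (tail_below (x + c * (n * s)) ns0) lee_fin tail_le1.
    rewrite lee_wpmul2l ?lee_fin ?expR_ge0//.
    by rewrite (tailE (c * (n * s) - x) ns0) lee_fin tail_le1.
have e0 : 0 < e by exact: expR_gt0.
have abovefin : heat (n * t) (above h) (n * b + c * (n * t)) =
    (e^-1 * recrossing l t s (2 * a / t) c n)%:E.
  by rewrite EFinM recE muleA -EFinM mulVf ?mul1e// gt_eqF.
have belowfin : heat (n * t) (below h) (n * b + c * (n * t)) \is a fin_num.
  rewrite ge0_fin_numE ?heat_ge0//; last exact: below_ge0.
  by rewrite (le_lt_trans belowle)// ltry.
have b0 : (0 <= heat (n * t) (below h) (n * b + c * (n * t)))%E.
  by apply: heat_ge0; exact: below_ge0.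
move: hitE b0 belowle; rewrite heat_split// -(fineK belowfin) abovefin -EFinD => -[->].
rewrite !lee_fin mulrDr; set q := fine _ => q0 qh.
have -> : e * q + e * (e^-1 * recrossing l t s (2 * a / t) c n)
    - recrossing l t s (2 * a / t) c n = e * q.
  by field; rewrite gt_eqF.
by rewrite mulr_ge0 ?(ltW e0)//= ler_wpM2l// ltW.
Qed.

End excursions.

(** * Decomposition at the intersection time *)

Section one_line.
Context (R : realType) (d : measure_display) (Omega : measurableType d)
  (P : probability Omega R) (B : nat -> R -> {RV P >-> R}).
Context (B_brownian : forall k : nat, standard_brownian_motion (B k)).
Context (B_independent : mutually_independent_processes B).
Context (N : nat) (N0 : (0 < N)%N).
Local Notation one := (fun=> 1%E : \bar R).
Local Notation n := (N%:R : R).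
Local Notation gapN := (gap B N).
Local Notation crossesN := (crosses B N).

Let n0 : 0 < n. Proof. by rewrite ltr0n. Qed.

Lemma sup_exceeds_crosses T a c : sup_exceeds B T a c N = crossesN (n * a) c 0 T.
Proof.
have gapE t w : (gapN (n * a) c t w < 0) =
    (a * n < \sum_(k < N) B k t w - c * n * t).
  rewrite /gap /bsum; set S := \sum_(k < N) _.
  by rewrite subr_lt0 ltrBrDr; congr (_ < _); ring.
apply/seteqP; split => w /=.
  move=> /ereal_sup_gt[_ [t /= tT <-]]; rewrite lte_fin -gapE => h.
  by exists t => //; move: tT; rewrite in_itv.
move=> [t tT]; rewrite gapE => h.
apply: (@lt_le_trans _ _ (\sum_(k < N) B k t w - c * n * t)%:E).
  by rewrite lte_fin.
by apply: ereal_sup_ubound; exists t => //=; rewrite in_itv.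
Qed.

Lemma integral_gap A c t (g : R -> \bar R) : 0 < t ->
  measurable_fun [set: R] g -> (forall x, 0 <= g x)%E ->
  (\int[P]_w g (gapN A c t w))%E = heat (n * t) g (A + c * (n * t)).
Proof.
move=> t0 mg g0.
(* A single step of the walk, from time 0 to time t. *)
pose tau (i : nat) : R := if i is 0%N then 0 else t.
have tau_lt i : (i < 1)%N -> tau i < tau i.+1 by case: i.
have walk := brownian_gaussian_walk B_brownian B_independent N0 (erefl : tau 0%N = 0) tau_lt.
have aT := brownian_adapted0 B_brownian B_independent N (erefl : tau 0%N = 0) tau_lt.
set D := A + c * (n * t).
pose h (y : R) := g (y + D).
have mh : measurable_fun [set: R] h by exact: measurable_comp_shift.
have h0 x : (0 <= h x)%E by exact: g0.
have := @walk_markov _ _ _ _ _ _ _ _ walk 0%N setT (fun x => h (- x)) isT aT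
  (measurable_comp_opp mh) (fun x => h0 _).
rewrite mulr0 subr0 => e; transitivity (heat (n * t) (fun x => h (- x)) 0).
  apply: etrans (etrans e _).
    by apply: eq_integral => w _; rewrite /h addrC.
  have Z0 w : brownian_sum B N tau 0 w = 0.
    by rewrite /brownian_sum big1// => k _; exact: sbm_start.
  rewrite (eq_integral (fun=> heat (n * t) (fun x => h (- x)) 0)).
    rewrite integral_cst// [X in (_ * X)%E]probability_setT mule1//.
  by move=> w _; rewrite Z0.
apply: etrans (@heat_opp _ (n * t) h 0 mh h0) _.
apply: etrans (@heat_shift _ (n * t) g D (- 0) mg g0) _.
by rewrite oppr0 add0r.
Qed.

Context (r : R) (r0 : 0 < r).
Local Notation ahead A c := [set w | 0 <= gapN A c r w].
Local Notation behind A c := [set w | gapN A c r w < 0].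

Let nr0 : 0 < n * r. Proof. by rewrite mulr_gt0. Qed.

Let integral_one (E : set Omega) : measurable E -> (\int[P]_(w in E) one w)%E = P E.
Proof. by move=> mE; rewrite integral_cst// mul1e. Qed.

Lemma probability_behind A c :
  P (behind A c) = (tail (n * r) (A + c * (n * r)))%:E.
Proof.
rewrite -(tail_below (A + c * (n * r)) nr0) -integral_gap//; last 2 first.
- exact: measurable_below.
- exact: below_ge0.
have mU : measurable (behind A c) by exact: measurable_gap_lt0.
rewrite -integral_one// integral_mkcond; apply: eq_integral => w _.
rewrite patchE /below; case: (ltP (gapN A c r w) 0) => h; first by rewrite ifT// inE.
by rewrite ifF//; apply/negP; rewrite inE/= ltNge h.
Qed.

Lemma probability_past A c : 0 <= A -> 0 <= c ->
  P (crossesN A c 0 r `&` ahead A c) = crossing c (n * r) (above one) A.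
Proof.
move=> A0 c0; rewrite -(integral_crosses B_brownian B_independent N0 r0 ltr01)//.
rewrite -integral_above integral_one//.
by apply: measurableI; [exact: measurable_crosses_past|exact: measurable_gap_ge0].
Qed.

Lemma crosses_behind A c : crossesN A c 0 r =
  behind A c `|` (crossesN A c 0 r `&` ahead A c).
Proof.
apply/seteqP; split => w; last first.
  by case=> [h|[]//]; exists r => //; rewrite lexx ltW.
by move=> h; case: (ltP (gapN A c r w) 0) => g; [left|right].
Qed.

(** Paths below the line at time r are counted by their image, the others by
    the Gaussian tail. *)
Lemma probability_crosses A c : 0 <= A -> 0 <= c ->
  P (crossesN A c 0 r) = crossing c (n * r) one A.
Proof.
move=> A0 c0; rewrite crosses_behind measureU; last 3 first.
- exact: measurable_gap_lt0.
- by apply: measurableI; [exact: measurable_crosses_past|exact: measurable_gap_ge0].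
- by apply/seteqP; split => // w [/= h [_]]; rewrite leNgt h.
apply: etrans (congr2 adde (probability_behind A c) (probability_past A0 c0)) _.
rewrite (crossing_aboveE c A nr0 (measurable_cst _) (fun=> lee01)).
rewrite (crossingE c A nr0 (measurable_cst _) (fun=> lee01)).
by rewrite (tail_below (A + c * (n * r)) nr0).
Qed.

End one_line.

Section two_lines.
Context (R : realType) (d : measure_display) (Omega : measurableType d)
  (P : probability Omega R) (B : nat -> R -> {RV P >-> R}).
Context (B_brownian : forall k : nat, standard_brownian_motion (B k)).
Context (B_independent : mutually_independent_processes B).
Context (N : nat) (N0 : (0 < N)%N).
Local Notation one := (fun=> 1%E : \bar R).
Local Notation n := (N%:R : R).
Local Notation gapN := (gap B N).
Local Notation crossesN := (crosses B N).

Let n0 : 0 < n. Proof. by rewrite ltr0n. Qed.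

Context (r s : R) (r0 : 0 < r) (s0 : 0 < s).
Local Notation T := (r + s).
Local Notation ahead A c := [set w | 0 <= gapN A c r w].
Local Notation behind A c := [set w | gapN A c r w < 0].

Let nr0 : 0 < n * r. Proof. by rewrite mulr_gt0. Qed.
Let ns0 : 0 < n * s. Proof. by rewrite mulr_gt0. Qed.

Lemma probability_past_tilted a c l : 0 <= a -> 0 <= c -> a + c * r = l ->
  P (crossesN (n * a) c 0 r `&` ahead (n * a) c) = (tilted l r (2 * a / r) n)%:E.
Proof.
move=> a0 c0 el; rewrite (probability_past B_brownian B_independent N0 r0) ?mulr_ge0 ?(ltW n0)//.
have m1 : measurable_fun [set: R] (above one) by exact: measurable_above.
rewrite (crossing_aboveE c (n * a) nr0 (measurable_cst _) (fun=> lee01)).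
rewrite (heat_image c (n * a) nr0 m1 (above_ge0 (fun=> lee01))).
have -> : 2 * (n * a) / (n * r) = 2 * a / r by field; rewrite !gt_eqF.
have -> : n * a + c * (n * r) = n * l by rewrite -el; ring.
exact: heat_tilted.
Qed.

Lemma probability_future_recrossing a c l : 0 <= c -> a + c * r = l ->
  P (ahead (n * a) c `&` crossesN (n * a) c r T) = (recrossing l r s 0 c n)%:E.
Proof.
move=> c0 el; rewrite (probability_future B_brownian B_independent N0 r0 s0)//.
have mh : measurable_fun [set: R] (crossing c (n * s) one) by exact: measurable_crossing.
have h0 x : (0 <= crossing c (n * s) one x)%E by exact: crossing_ge0.
rewrite (integral_gap B_brownian B_independent N0 (n * a) c r0 (measurable_above mh) (above_ge0 h0)).
have -> : n * a + c * (n * r) = n * l by rewrite -el; ring.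
rewrite -(recrossingE l 0 c r0 s0 n0); apply: eq_heat => x.
by rewrite oppr0 mul0r expR0 mul1e.
Qed.

Lemma probability_past_future_recrossing a c b k l : 0 <= a -> 0 <= c -> 0 <= k ->
  a + c * r = l -> b + k * r = l ->
  P (crossesN (n * a) c 0 r `&` (ahead (n * b) k `&` crossesN (n * b) k r T)) =
  (recrossing l r s (2 * a / r) k n)%:E.
Proof.
move=> a0 c0 k0 el eb; have A0 : 0 <= n * a by rewrite mulr_ge0// ltW.
rewrite (probability_past_future B_brownian B_independent N0 r0 s0)//.
set h := crossing k (n * s) one.
have mh : measurable_fun [set: R] h by exact: measurable_crossing.
have h0 x : (0 <= h x)%E by exact: crossing_ge0.
have mah : measurable_fun [set: R] (above h) by exact: measurable_above.
have -> : gapN (n * b) k r = gapN (n * a) c r.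
  apply/funext => w; rewrite /gap; congr (_ - _).
  transitivity (n * (b + k * r)); first by ring.
  by rewrite eb -el; ring.
rewrite -(above_idem h).
rewrite (integral_crosses B_brownian B_independent N0 r0 s0 A0 c0 mah (above_ge0 h0)); last first.
  by move=> x; exact: above_crossing1_le1.
rewrite above_idem (crossing_aboveE c (n * a) nr0 mh h0).
rewrite (heat_image c (n * a) nr0 mah (above_ge0 h0)).
have -> : 2 * (n * a) / (n * r) = 2 * a / r by field; rewrite !gt_eqF.
have -> : n * a + c * (n * r) = n * l by rewrite -el; ring.
exact: recrossingE.
Qed.

Lemma crosses_split A c : crossesN A c 0 T =
  behind A c `|` ((crossesN A c 0 r `&` ahead A c) `|` (ahead A c `&` crossesN A c r T)).
Proof.
have rT : r <= T by rewrite lerDl ltW.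
apply/seteqP; split => w.
  move=> [t /andP[t0 tT] gt]; case: (ltP (gapN A c r w) 0) => g; [by left|right].
  have [tr|rt] := leP t r; [left|right]; split => //; exists t => //.
    by rewrite t0.
  by rewrite (ltW rt).
case=> [h|[[[t /andP[t0 tr] h] _]|[_ [t /andP[rt tT] h]]]].
- by exists r => //; rewrite (ltW r0).
- by exists t => //; rewrite t0 (le_trans tr).
- by exists t => //; rewrite tT andbT (le_trans _ rt)// ltW.
Qed.

Context (a1 a2 c1 c2 l : R) (a1_ge0 : 0 <= a1) (a2_ge0 : 0 <= a2)
  (c2_ge0 : 0 <= c2) (c2_lt_c1 : c2 < c1) (l1 : a1 + c1 * r = l) (l2 : a2 + c2 * r = l).

Local Notation U := (behind (n * a1) c1).
Local Notation V := (ahead (n * a1) c1).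
Local Notation past a c := (crossesN (n * a) c 0 r).
Local Notation future a c := (crossesN (n * a) c r T).

Let c1_ge0 : 0 <= c1. Proof. by rewrite (le_trans c2_ge0)// ltW. Qed.

Let gap12 t w : gapN (n * a1) c1 t w = gapN (n * a2) c2 t w + n * ((c1 - c2) * (t - r)).
Proof.
rewrite /gap; have -> : a2 = a1 + (c1 - c2) * r by move: l2; rewrite -l1; lra.
by ring.
Qed.

Let V2 : ahead (n * a2) c2 = V.
Proof. by apply/seteqP; split => w /=; rewrite gap12 subrr !mulr0 addr0. Qed.

Let U2 : behind (n * a2) c2 = U.
Proof. by apply/seteqP; split => w /=; rewrite gap12 subrr !mulr0 addr0. Qed.

Let past21 : past a2 c2 `<=` past a1 c1.
Proof.
move=> w [t /andP[t0 tr] h]; exists t; first by rewrite t0.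
rewrite gap12 (le_lt_trans _ h)// gerDl mulr_ge0_le0// ?(ltW n0)//.
by rewrite mulr_ge0_le0 ?subr_ge0 ?subr_le0// ltW.
Qed.

Let future12 : future a1 c1 `<=` future a2 c2.
Proof.
move=> w [t /andP[rt tT] h]; exists t; first by rewrite rt.
move: h; rewrite gap12; apply: le_lt_trans; rewrite lerDl.
by rewrite !mulr_ge0 ?subr_ge0// ltW.
Qed.

Let pr (E : set Omega) : R := fine (P E).

Let prU (E F : set Omega) : measurable E -> measurable F ->
  pr (E `|` F) = pr E + pr F - pr (E `&` F).
Proof.
move=> mE mF; rewrite /pr measureUfinr ?ltey_eq ?fin_num_measure//.
rewrite fineB ?fineD ?fin_numD ?fin_num_measure//; exact: measurableI.
Qed.

Let pr_le (E F : set Omega) : measurable E -> measurable F -> E `<=` F -> pr E <= pr F.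
Proof.
move=> mE mF EF; rewrite fine_le ?fin_num_measure//.
by apply: le_measure => //; rewrite inE.
Qed.

Let mU : measurable U. Proof. exact: measurable_gap_lt0. Qed.
Let mV : measurable V. Proof. exact: measurable_gap_ge0. Qed.
Let mp a c : 0 <= a -> measurable (past a c).
Proof. by move=> a0; apply: measurable_crosses_past => //; rewrite mulr_ge0// ltW. Qed.
Let mq1 : measurable (V `&` future a1 c1).
Proof. exact: measurable_crosses_future. Qed.
Let mq2 : measurable (V `&` future a2 c2).
Proof. by rewrite -V2; exact: measurable_crosses_future. Qed.

Let prUV (E : set Omega) : measurable E -> E `<=` V -> pr (U `|` E) = pr U + pr E.
Proof.
move=> mE EV; rewrite prU// (_ : U `&` E = set0) ?/pr ?measure0 ?subr0//.
by apply/seteqP; split => // w [/= h /EV/=]; rewrite leNgt h.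
Qed.

Let prL (E F : set Omega) : measurable E -> measurable F -> E `<=` V -> F `<=` V ->
  pr (U `|` (E `|` F)) = pr U + pr E + pr F - pr (E `&` F).
Proof.
move=> mE mF EV FV; have EFV : E `|` F `<=` V by move=> w [/EV|/FV].
by rewrite (prUV (measurableU _ _ mE mF) EFV) (prU mE mF) !addrA.
Qed.

Let both : crossesN (n * a1) c1 0 T `&` crossesN (n * a2) c2 0 T =
  U `|` (((past a2 c2 `&` V) `|` (V `&` future a1 c1)) `|`
         (past a1 c1 `&` (V `&` future a2 c2))).
Proof.
rewrite !crosses_split V2 U2; apply/seteqP; split => w.
  case=> -[h|[[p1 v]|[v q1]]] [h'|[[p2 v']|[v' q2]]]; try by left.
  - by right; left; left.
  - by right; right.
  - by right; left; left.
  - by right; left; right.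
case=> [h|[[[p2 v]|[v q1]]|[p1 [v q2]]]]; first by split; left.
- by split; right; left => //; split => //; exact: past21.
- by split; right; right => //; split => //; exact: future12.
- by split; right; [left|right].
Qed.

Local Notation T0 := (tail (n * r) (n * l)).
Local Notation J a := (tilted l r (2 * a / r) n).
Local Notation M a c := (recrossing l r s (2 * a / r) c n).
Local Notation M0 c := (recrossing l r s 0 c n).

Let prT0 : pr U = T0.
Proof.
rewrite /pr (probability_behind B_brownian B_independent N0 r0) /=; congr (tail _ _); rewrite -l1; ring.
Qed.
Let V2_ind (Q : set Omega -> Prop) : Q (ahead (n * a2) c2) -> Q V.
Proof. by move=> h; exact: (eq_ind _ Q h _ V2). Qed.

Let prJ1 : pr (past a1 c1 `&` V) = J a1.
Proof. exact: (congr1 fine (probability_past_tilted a1_ge0 c1_ge0 l1)). Qed.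
Let prJ2 : pr (past a2 c2 `&` V) = J a2.
Proof.
apply: (V2_ind (Q := fun W => pr (past a2 c2 `&` W) = J a2)).
exact: (congr1 fine (probability_past_tilted a2_ge0 c2_ge0 l2)).
Qed.
Let prM01 : pr (V `&` future a1 c1) = M0 c1.
Proof. exact: (congr1 fine (probability_future_recrossing c1_ge0 l1)). Qed.
Let prM02 : pr (V `&` future a2 c2) = M0 c2.
Proof.
apply: (V2_ind (Q := fun W => pr (W `&` future a2 c2) = M0 c2)).
exact: (congr1 fine (probability_future_recrossing c2_ge0 l2)).
Qed.
Let prM11 : pr (past a1 c1 `&` (V `&` future a1 c1)) = M a1 c1.
Proof.
exact: (congr1 fine (probability_past_future_recrossing a1_ge0 c1_ge0 c1_ge0 l1 l1)).
Qed.
Let prM12 : pr (past a1 c1 `&` (V `&` future a2 c2)) = M a1 c2.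
Proof.
apply: (V2_ind (Q := fun W => pr (past a1 c1 `&` (W `&` future a2 c2)) = M a1 c2)).
exact: (congr1 fine (probability_past_future_recrossing a1_ge0 c1_ge0 c2_ge0 l1 l2)).
Qed.
Let prM22 : pr (past a2 c2 `&` (V `&` future a2 c2)) = M a2 c2.
Proof.
apply: (V2_ind (Q := fun W => pr (past a2 c2 `&` (W `&` future a2 c2)) = M a2 c2)).
exact: (congr1 fine (probability_past_future_recrossing a2_ge0 c2_ge0 c2_ge0 l2 l2)).
Qed.

Let rs0 : 0 < T. Proof. by rewrite addr_gt0. Qed.

Let hit_pr a c : 0 <= a -> 0 <= c -> hit a c T n = pr (crossesN (n * a) c 0 T).
Proof.
move=> a0 c0.
have nA : 0 <= n * a by rewrite mulr_ge0// ltW.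
by rewrite /pr (probability_crosses B_brownian B_independent N0 rs0 nA c0) crossing_one_hit.
Qed.

Lemma hit_decomposition1 : hit a1 c1 T n = T0 + J a1 + M0 c1 - M a1 c1.
Proof.
rewrite hit_pr// crosses_split prL.
- rewrite prT0 prJ1 prM01; congr (_ - _); rewrite -prM11; congr (pr _).
  by apply/seteqP; split => w /=; tauto.
- by apply: measurableI => //; exact: mp.
- exact: mq1.
- by move=> w [].
- by move=> w [].
Qed.

Lemma hit_decomposition2 : hit a2 c2 T n = T0 + J a2 + M0 c2 - M a2 c2.
Proof.
rewrite hit_pr// crosses_split V2 U2 prL.
- rewrite prT0 prJ2 prM02; congr (_ - _); rewrite -prM22; congr (pr _).
  by apply/seteqP; split => w /=; tauto.
- by apply: measurableI => //; exact: mp.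
- exact: mq2.
- by move=> w [].
- by move=> w [].
Qed.

(** Inclusion-exclusion for three events on V: line 2 before, line 1 after, and
    line 1 before with line 2 after.  Line 2 before together with line 1 after implies
    the third event, which makes the triple term cancel. *)
Lemma psi_decomposition : psi B a1 a2 c1 c2 T N =
  T0 + (J a2 - M a2 c2) + (M0 c1 - M a1 c1) + M a1 c2.
Proof.
rewrite /psi !sup_exceeds_crosses both -/(pr _).
have mE1 : measurable (past a2 c2 `&` V) by apply: measurableI => //; exact: mp.
have mE3 : measurable (past a1 c1 `&` (V `&` future a2 c2)).
  by apply: measurableI => //; exact: mp.
set E1 := past a2 c2 `&` V; set E2 := V `&` future a1 c1.
set E3 := past a1 c1 `&` (V `&` future a2 c2).
have mE2 : measurable E2 by exact: mq1.
have mE12 : measurable (E1 `|` E2) by exact: measurableU.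
have EV12 : E1 `|` E2 `<=` V by move=> w [[]|[]].
have EV3 : E3 `<=` V by move=> w [? []].
pose F2 := past a2 c2 `&` (V `&` future a2 c2).
pose F1 := past a1 c1 `&` (V `&` future a1 c1).
have mF2 : measurable F2 by apply: measurableI => //; exact: mp.
have mF1 : measurable F1 by apply: measurableI => //; exact: mp.
have EF : (E1 `|` E2) `&` E3 = F2 `|` F1.
  apply/seteqP; split => w.
    case=> -[[p2 v]|[v q1]] [p1 [v' q2]]; [left|right]; by do !split.
  case=> [[p2 [v q2]]|[p1 [v q1]]]; split; first by left.
  - by split => //; exact: past21.
  - by right.
  - by do !split => //; exact: future12.
have FE : F2 `&` F1 = E1 `&` E2.
  apply/seteqP; split => w; first by case=> -[? [? ?]] [? [? ?]].
  by case=> -[? ?] [? ?]; do !split => //; [exact: future12|exact: past21].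
have h3 : pr ((E1 `|` E2) `&` E3) = pr F2 + pr F1 - pr (E1 `&` E2).
  apply: etrans (congr1 pr EF) _; apply: etrans (prU mF2 mF1) _.
  by rewrite FE.
have alg (p u a b c e1 e2 x f1 f2 : R) : p = u + a + b - c -> a = e1 + e2 - x ->
    c = f2 + f1 - x -> p = u + (e1 - f2) + (e2 - f1) + b.
  by move=> -> -> ->; ring.
apply: etrans (alg _ _ _ _ _ _ _ _ _ _ (prL mE12 mE3 EV12 EV3) (prU mE1 mE2) h3) _.
by rewrite prT0 prJ2 prM01 prM12 prM22 prM11.
Qed.

Lemma psi_le_hit1 : psi B a1 a2 c1 c2 T N <= hit a1 c1 T n.
Proof.
rewrite hit_pr// /psi !sup_exceeds_crosses -/(pr _).
have mL a c : 0 <= a -> measurable (crossesN (n * a) c 0 T).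
  move=> a0; apply: measurable_crosses_past => //; by rewrite mulr_ge0// ltW.
by apply: pr_le; [apply: measurableI; exact: mL|exact: mL|exact: subIsetl].
Qed.

Lemma psi_le_hit2 : psi B a1 a2 c1 c2 T N <= hit a2 c2 T n.
Proof.
rewrite hit_pr// /psi !sup_exceeds_crosses -/(pr _).
have mL a c : 0 <= a -> measurable (crossesN (n * a) c 0 T).
  move=> a0; apply: measurable_crosses_past => //; by rewrite mulr_ge0// ltW.
by apply: pr_le; [apply: measurableI; exact: mL|exact: mL|exact: subIsetr].
Qed.

End two_lines.

(** * Rates of the terms of the decomposition *)

Section rates.
Context {R : realType}.
Implicit Types (a c g k l s t C : R) (X Y : nat -> R).
Local Notation K := (1 / Num.sqrt (2 * pi) : R).
Transparent hit tilted.

Lemma exp_decay_eq X Y k k' C C' : exp_decay X k C -> k = k' -> C = C' ->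
  (forall N, (0 < N)%N -> Y N = X N) -> exp_decay Y k' C'.
Proof.
move=> h <- <- YX; apply: cvg_near_eq h; near=> N; rewrite YX//.
near: N; exact: nbhs_infty_gt.
Unshelve. all: by end_near. Qed.

Lemma sqrt_decay_eq X Y k k' C C' : sqrt_decay X k C -> k = k' -> C = C' ->
  (forall N, (0 < N)%N -> Y N = X N) -> sqrt_decay Y k' C'.
Proof.
move=> h <- <- YX; apply: cvg_near_eq h; near=> N; rewrite YX//.
near: N; exact: nbhs_infty_gt.
Unshelve. all: by end_near. Qed.

Lemma tilted_sqrt_decay l t g : 0 < t -> l < g * t ->
  sqrt_decay (fun N => tilted l t g N%:R) (l ^+ 2 / (2 * t)) (K * (Num.sqrt t / (g * t - l))).
Proof.
move=> t0 lg; have b0 : 0 < g * t - l by rewrite subr_gt0.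
apply: (sqrt_decay_eq (sqrt_decay_mul (g * l - g ^+ 2 * t / 2) (tail_sqrt_decay t0 b0))).
- by field; rewrite !gt_eqF.
- by [].
- by [].
Qed.

Lemma tilted_exp_decay_half l t g : 0 < t -> g * t = l ->
  exp_decay (fun N => tilted l t g N%:R) (l ^+ 2 / (2 * t)) (1 / 2).
Proof.
move=> t0 lg.
apply: (exp_decay_eq (exp_decay_mul (g * l - g ^+ 2 * t / 2) (tail_exp_decay0 t0))).
- by rewrite addr0 -lg; field; rewrite !gt_eqF.
- by [].
- by move=> N _; rewrite /tilted lg subrr.
Qed.

Lemma hit_sqrt_decay a c t : 0 < t -> 0 < a + c * t -> c * t < a ->
  sqrt_decay (fun N => hit a c t N%:R) ((a + c * t) ^+ 2 / (2 * t))
    (K * (Num.sqrt t / (a + c * t) + Num.sqrt t / (a - c * t))).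
Proof.
move=> t0 p0 ca; have m0 : 0 < a - c * t by rewrite subr_gt0.
have h1 := tail_sqrt_decay t0 p0.
have h2 := sqrt_decay_mul (2 * a * c) (tail_sqrt_decay t0 m0).
have e : 2 * a * c + (a - c * t) ^+ 2 / (2 * t) = (a + c * t) ^+ 2 / (2 * t).
  by field; rewrite !gt_eqF.
rewrite e in h2; apply: (sqrt_decay_eq (sqrt_decayD h1 h2)).
- by [].
- by rewrite -mulrDr.
- by [].
Qed.

(** The difference is (a - c t)^2 / (2 t): the cheapest time to hit the line is a / c. *)
Lemma hit_rate_le a c t : 0 < t -> 2 * a * c <= (a + c * t) ^+ 2 / (2 * t).
Proof.
move=> t0; rewrite ler_pdivlMr ?mulr_gt0// -subr_ge0.
have -> : (a + c * t) ^+ 2 - 2 * a * c * (2 * t) = (a - c * t) ^+ 2 by ring.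
exact: sqr_ge0.
Qed.

Lemma hit_rate_decr a c s t : 0 <= c -> 0 < s -> s < t -> c * t < a ->
  (a + c * t) ^+ 2 / (2 * t) < (a + c * s) ^+ 2 / (2 * s).
Proof.
move=> c0 s0 st ca; have t0 := lt_trans s0 st.
rewrite -subr_gt0.
have -> : (a + c * s) ^+ 2 / (2 * s) - (a + c * t) ^+ 2 / (2 * t) =
    (t - s) * (a ^+ 2 - (c * s) * (c * t)) / (2 * s * t).
  by field; rewrite !gt_eqF.
rewrite divr_gt0 ?mulr_gt0// subr_gt0//.
have cs : c * s <= c * t by rewrite ler_wpM2l// ltW.
have a0 : 0 < a by rewrite (le_lt_trans _ ca)// mulr_ge0// ltW.
rewrite expr2; apply: (@le_lt_trans _ _ (c * t * (c * t))).
  by rewrite ler_wpM2r// mulr_ge0// ltW.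
have ct0 : 0 <= c * t by rewrite mulr_ge0// ltW.
exact: ltr_pM.
Qed.

Lemma hit_exp_decay_half a c t : 0 < t -> 0 < c -> a = c * t ->
  exp_decay (fun N => hit a c t N%:R) (2 * a * c) (1 / 2).
Proof.
move=> t0 c0 ea; have a0 : 0 < a by rewrite ea mulr_gt0.
have p0 : 0 < a + c * t by rewrite -ea addr_gt0.
have h1 := sqrt_decay_exp (hit_rate_le a c t0) (tail_sqrt_decay t0 p0).
have h2 := exp_decay_mul (2 * a * c) (tail_exp_decay0 t0); rewrite addr0 in h2.
apply: (exp_decay_eq (exp_decayD h1 h2)).
- by [].
- by rewrite add0r.
- by move=> N _; rewrite /hit -ea subrr.
Qed.

Lemma hit_exp_decay a c t : 0 < t -> 0 < a -> a < c * t ->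
  exp_decay (fun N => hit a c t N%:R) (2 * a * c) 1.
Proof.
move=> t0 a0 ac; have p0 : 0 < a + c * t by rewrite addr_gt0// (lt_trans a0).
have m0 : a - c * t < 0 by rewrite subr_lt0.
have h1 := sqrt_decay_exp (hit_rate_le a c t0) (tail_sqrt_decay t0 p0).
have h2 := exp_decay_mul (2 * a * c) (tail_exp_decay_lt0 t0 m0); rewrite addr0 in h2.
apply: (exp_decay_eq (exp_decayD h1 h2)).
- by [].
- by rewrite add0r.
- by [].
Qed.

Opaque hit tilted.

Lemma expR_sqrt_decay0 k k' : k < k' ->
  sqrt_decay (fun N => expR (- k' * N%:R)) k 0.
Proof.
move=> kk'; apply: (exp_decay_sqrt kk' (C := 1)).
apply: (exp_decay_eq (exp_decay_mul k' exp_decay_cst)).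
- by rewrite addr0.
- by [].
- by move=> N _; rewrite mulr1.
Qed.

Let recrossing_error l t s c : 0 < t -> 0 < s -> 0 < c ->
  l ^+ 2 / (2 * t) < l ^+ 2 / (2 * t) + (c * s) ^+ 2 / (2 * (t + s)).
Proof.
by move=> t0 s0 c0; rewrite ltrDl divr_gt0 ?exprn_gt0 ?mulr_gt0 ?addr_gt0.
Qed.

(** The error of [tilted_le_recrossing] has a strictly larger rate. *)
Lemma recrossing_sqrt_decay l t s g c : 0 < t -> 0 < s -> 0 < c -> l < (g + 2 * c) * t ->
  sqrt_decay (fun N => recrossing l t s g c N%:R) (l ^+ 2 / (2 * t))
    (K * (Num.sqrt t / ((g + 2 * c) * t - l))).
Proof.
move=> t0 s0 c0 lg; have hJ := tilted_sqrt_decay t0 lg.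
have he := expR_sqrt_decay0 (recrossing_error l t0 s0 c0).
have hlow := sqrt_decayB hJ he; rewrite subr0 in hlow.
apply: (sqrt_decay_squeeze _ hlow hJ); near=> N.
have n0 : 0 < N%:R :> R by rewrite ltr0n; near: N; exact: nbhs_infty_gt.
by rewrite recrossing_le_tilted// andbT lerBlDr tilted_le_recrossing// ltW.
Unshelve. all: by end_near. Qed.

Lemma recrossing_exp_decay_half l t s g c : 0 < t -> 0 < s -> 0 < c ->
  (g + 2 * c) * t = l ->
  exp_decay (fun N => recrossing l t s g c N%:R) (l ^+ 2 / (2 * t)) (1 / 2).
Proof.
move=> t0 s0 c0 lg; have hJ := tilted_exp_decay_half t0 lg.
have he : exp_decay (fun N => expR (- (l ^+ 2 / (2 * t) + (c * s) ^+ 2 / (2 * (t + s))) * N%:R))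
    (l ^+ 2 / (2 * t)) 0.
  apply: (exp_decay_lt (recrossing_error l t0 s0 c0) (C := 1)).
  apply: (exp_decay_eq (exp_decay_mul _ exp_decay_cst)).
  - by rewrite addr0.
  - by [].
  - by move=> N _; rewrite mulr1.
have hlow := exp_decayB hJ he; rewrite subr0 in hlow.
apply: (exp_decay_squeeze _ hlow hJ); near=> N.
have n0 : 0 < N%:R :> R by rewrite ltr0n; near: N; exact: nbhs_infty_gt.
by rewrite recrossing_le_tilted// andbT lerBlDr tilted_le_recrossing ?lg// ltW.
Unshelve. all: by end_near. Qed.

Lemma exp_decay_asymp1 X k : exp_decay X k 1 -> asymp_equiv X (fun N => expR (- k * N%:R)).
Proof.
move=> h; have := exp_decay_asymp (oner_neq0 R) h.
by under [X in asymp_equiv _ X -> _]eq_fun do rewrite mul1r.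
Qed.

End rates.

(** * The position of the intersection point *)

Section cases.
Context {R : realType}.
Implicit Types (X Y E F : nat -> R) (a c k : R).
Local Notation K := (1 / Num.sqrt (2 * pi) : R).

Lemma exp_decay_sandwich X Y E F k kappa C D D' : k <= kappa ->
  exp_decay Y k C -> sqrt_decay E kappa D -> sqrt_decay F kappa D' ->
  (forall N, (0 < N)%N -> Y N - E N <= X N <= Y N + F N) -> exp_decay X k C.
Proof.
move=> kk hY hE hF YX.
have h1 := exp_decayB hY (sqrt_decay_exp kk hE); rewrite subr0 in h1.
have h2 := exp_decayD hY (sqrt_decay_exp kk hF); rewrite addr0 in h2.
apply: (exp_decay_squeeze _ h1 h2); near=> N; apply: YX.
near: N; exact: nbhs_infty_gt.
Unshelve. all: by end_near. Qed.

Lemma sqrt_decay_sandwich X Y E F k kappa C D D' : k < kappa ->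
  sqrt_decay Y k C -> sqrt_decay E kappa D -> sqrt_decay F kappa D' ->
  (forall N, (0 < N)%N -> Y N - E N <= X N <= Y N + F N) -> sqrt_decay X k C.
Proof.
move=> kk hY hE hF YX.
have h1 := sqrt_decayB hY (sqrt_decay_lt kk hE); rewrite subr0 in h1.
have h2 := sqrt_decayD hY (sqrt_decay_lt kk hF); rewrite addr0 in h2.
apply: (sqrt_decay_squeeze _ h1 h2); near=> N; apply: YX.
near: N; exact: nbhs_infty_gt.
Unshelve. all: by end_near. Qed.

Context (t s l a1 a2 c1 c2 : R) (p : nat -> R).
Context (t0 : 0 < t) (s0 : 0 < s) (a1_gt0 : 0 < a1) (a1_lt_a2 : a1 < a2)
  (c2_gt0 : 0 < c2) (c2_lt_c1 : c2 < c1) (l1 : a1 + c1 * t = l) (l2 : a2 + c2 * t = l).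
Local Notation T := (t + s).

Let T0 (N : nat) := tail (N%:R * t) (N%:R * l).
Let J a (N : nat) := tilted l t (2 * a / t) N%:R.
Let M a c (N : nat) := recrossing l t s (2 * a / t) c N%:R.
Let M0 c (N : nat) := recrossing l t s 0 c N%:R.
Let H a c (N : nat) := hit a c T N%:R.
Let kappa := l ^+ 2 / (2 * t).

Context (p_decomp : forall N, (0 < N)%N ->
    p N = T0 N + (J a2 N - M a2 c2 N) + (M0 c1 N - M a1 c1 N) + M a1 c2 N)
  (hit1_decomp : forall N, (0 < N)%N -> H a1 c1 N = T0 N + J a1 N + M0 c1 N - M a1 c1 N)
  (hit2_decomp : forall N, (0 < N)%N -> H a2 c2 N = T0 N + J a2 N + M0 c2 N - M a2 c2 N)
  (p_le_hit1 : forall N, (0 < N)%N -> p N <= H a1 c1 N)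
  (p_le_hit2 : forall N, (0 < N)%N -> p N <= H a2 c2 N).

Let c1_gt0 : 0 < c1. Proof. exact: lt_trans c2_lt_c1. Qed.
Let a2_gt0 : 0 < a2. Proof. exact: lt_trans a1_lt_a2. Qed.
Let l_gt0 : 0 < l. Proof. by rewrite -l1 addr_gt0// mulr_gt0. Qed.
Let c1t : 0 < c1 * t. Proof. by rewrite mulr_gt0. Qed.
Let c2t : 0 < c2 * t. Proof. by rewrite mulr_gt0. Qed.
Let T_gt0 : 0 < T. Proof. by rewrite addr_gt0. Qed.
Let tT : t < T. Proof. by rewrite ltrDl. Qed.

Let T0_ge0 N : 0 <= T0 N. Proof. exact: tail_ge0. Qed.
Let J_ge0 a N : 0 <= J a N. Proof. exact: tilted_ge0. Qed.
Let M_ge0 a c N : 0 <= M a c N. Proof. exact: recrossing_ge0. Qed.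
Let M0_ge0 c N : 0 <= M0 c N. Proof. exact: recrossing_ge0. Qed.

Let M_le_J a c N : (0 < N)%N -> M a c N <= J a N.
Proof. by move=> N0; apply: recrossing_le_past => //; rewrite ltr0n. Qed.

Let M_le_M0 a c N : 0 < a -> (0 < N)%N -> M a c N <= M0 c N.
Proof.
move=> a0 N0; apply: recrossing_nincr => //; first by rewrite ltr0n.
by rewrite divr_ge0 ?mulr_ge0// ltW.
Qed.

Let decayT0 : sqrt_decay T0 kappa (K * (Num.sqrt t / l)).
Proof. exact: (tail_sqrt_decay t0 l_gt0). Qed.

Let decayJ a : l < 2 * a -> sqrt_decay (J a) kappa (K * (Num.sqrt t / (2 * a - l))).
Proof.
move=> la; have e : 2 * a / t * t = 2 * a by rewrite divfK// gt_eqF.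
by rewrite -e in la *; exact: (tilted_sqrt_decay t0 la).
Qed.

Let decayM a c : 0 < c -> l < 2 * a + 2 * c * t ->
  sqrt_decay (M a c) kappa (K * (Num.sqrt t / (2 * a + 2 * c * t - l))).
Proof.
move=> c0 la; have e : (2 * a / t + 2 * c) * t = 2 * a + 2 * c * t.
  by rewrite mulrDl divfK// gt_eqF.
by rewrite -e in la *; exact: (recrossing_sqrt_decay t0 s0 c0 la).
Qed.

Let decayM0 c : 0 < c -> l < 2 * c * t ->
  sqrt_decay (M0 c) kappa (K * (Num.sqrt t / (2 * c * t - l))).
Proof.
move=> c0 la; have e : (0 + 2 * c) * t = 2 * c * t by rewrite add0r.
by rewrite -e in la *; exact: (recrossing_sqrt_decay t0 s0 c0 la).
Qed.

Local Ltac lra_at N :=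
  generalize (T0 N) (J a1 N) (J a2 N) (M a1 c1 N) (M a1 c2 N) (M a2 c2 N)
    (M0 c1 N) (M0 c2 N); intros;
  match goal with |- _ /\ _ => split | _ => idtac end; lra.

Section before_first_exit.
Context (early : c1 * t < a1).

Let sandwich N : (0 < N)%N -> H a1 c1 N - J a1 N <= p N <= H a1 c1 N + J a1 N.
Proof.
move=> N0; apply/andP; split; last by rewrite (le_trans (p_le_hit1 N0))// lerDl.
rewrite p_decomp// hit1_decomp//.
by have := M_le_J a2 c2 N0; have := M_ge0 a1 c2 N; lra_at N.
Qed.

Let lJ : l < 2 * a1. Proof. by have := early; rewrite -l1; lra. Qed.

Lemma exp_decay_before_first k C : k <= kappa -> exp_decay (H a1 c1) k C -> exp_decay p k C.
Proof. by move=> kk h; exact: (exp_decay_sandwich kk h (decayJ lJ) (decayJ lJ) sandwich). Qed.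

Lemma decay_before_first_T_before : T < a1 / c1 ->
  sqrt_decay p ((a1 + c1 * T) ^+ 2 / (2 * T))
   (K * (Num.sqrt T / (a1 + c1 * T) + Num.sqrt T / (a1 - c1 * T))).
Proof.
rewrite ltr_pdivlMr// mulrC => Ta.
have kk : (a1 + c1 * T) ^+ 2 / (2 * T) < kappa.
  by rewrite /kappa -l1; apply: hit_rate_decr => //; exact: ltW.
have a1T : 0 < a1 + c1 * T by rewrite addr_gt0// mulr_gt0.
exact: (sqrt_decay_sandwich kk (hit_sqrt_decay T_gt0 a1T Ta) (decayJ lJ) (decayJ lJ) sandwich).
Qed.

Let rate : 2 * a1 * c1 <= kappa.
Proof. by rewrite /kappa -l1; exact: hit_rate_le. Qed.

Lemma decay_before_first_T_at : T = a1 / c1 -> exp_decay p (2 * a1 * c1) (1 / 2).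
Proof.
move=> eT; apply: (exp_decay_before_first rate); apply: hit_exp_decay_half => //.
by rewrite eT mulrC divfK// gt_eqF.
Qed.

Lemma decay_before_first_T_after : a1 / c1 < T -> exp_decay p (2 * a1 * c1) 1.
Proof.
rewrite ltr_pdivrMr// mulrC => Ta.
by apply: (exp_decay_before_first rate); exact: hit_exp_decay.
Qed.

End before_first_exit.

(** Half of the mass of the paths that cross line 1 is removed by J1; the other terms carry
    the prefactor 1 / sqrt N. *)
Lemma decay_at_first : a1 = c1 * t -> exp_decay p (2 * a1 * c1) (1 / 2).
Proof.
move=> e1; have kE : kappa = 2 * a1 * c1.
  by rewrite /kappa -l1 e1; field; rewrite gt_eqF.
have h1 : exp_decay (H a1 c1) kappa 1.
  by rewrite kE; apply: hit_exp_decay => //; rewrite [ltLHS]e1 ltr_pM2l.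
have h2 : exp_decay (J a1) kappa (1 / 2).
  apply: tilted_exp_decay_half => //.
  by rewrite divfK ?gt_eqF// -l1 -e1; ring.
have h := exp_decayB h1 h2.
have lJ2 : l < 2 * a2.
  by have := a1_gt0; have := a1_lt_a2; have := c2t; rewrite -l1 -e1; lra.
have lM12 : l < 2 * a1 + 2 * c2 * t.
  by have := a1_gt0; have := a1_lt_a2; have := c2t; rewrite -l1 -e1; lra.
have hE := sqrt_decayD (decayJ lJ2) (decayM c2_gt0 lM12).
rewrite -kE; have -> : 1 / 2 = 1 - 1 / 2 :> R by field.
apply: (exp_decay_sandwich (lexx _) h hE hE) => N N0; cbv beta.
rewrite p_decomp// hit1_decomp//; apply/andP.
have := M_le_J a2 c2 N0; have := M_ge0 a1 c2 N; have := J_ge0 a2 N.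
by have := M_ge0 a2 c2 N; lra_at N.
Qed.

Section between_exits.
Context (late1 : a1 < c1 * t) (early2 : c2 * t < a2).

Let lJ2 : l < 2 * a2.
Proof.
by have := late1; have := early2; have := a2_gt0; have := a1_gt0; have := c1t; have := c2t;
  rewrite -l2; lra.
Qed.
Let lM01 : l < 2 * c1 * t.
Proof.
by have := late1; have := early2; have := a2_gt0; have := a1_gt0; have := c1t; have := c2t;
  rewrite -l1; lra.
Qed.
Let lM11 : l < 2 * a1 + 2 * c1 * t.
Proof.
by have := late1; have := early2; have := a2_gt0; have := a1_gt0; have := c1t; have := c2t;
  rewrite -l1; lra.
Qed.
Let lM22 : l < 2 * a2 + 2 * c2 * t.
Proof.
by have := late1; have := early2; have := a2_gt0; have := a1_gt0; have := c1t; have := c2t;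
  rewrite -l2; lra.
Qed.

Let decay_rest := sqrt_decayD (sqrt_decayD decayT0 (decayJ lJ2)) (decayM0 c1_gt0 lM01).

Let sandwich N : (0 < N)%N ->
  M a1 c2 N <= p N <= M a1 c2 N + (T0 N + J a2 N + M0 c1 N).
Proof.
move=> N0; rewrite p_decomp//; apply/andP.
have := M_le_J a2 c2 N0; have := M_le_M0 c1 a1_gt0 N0; have := T0_ge0 N.
have := M_ge0 a2 c2 N; have := M_ge0 a1 c1 N.
by lra_at N.
Qed.

(** All six terms have the same order; the two terms with alpha t = 2 l contribute
    - 2 / l, which meets the 1 / l of T0. *)
Lemma decay_between_image_before : a2 - 2 * a1 < c2 * t ->
  sqrt_decay p ((a1 + c1 * t) ^+ 2 / (2 * t))
   (K * (Num.sqrt t / (a2 - c2 * t) + Num.sqrt t / ((2 * a1 - a2) + c2 * t)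
         - Num.sqrt t / (a1 + c1 * t) - Num.sqrt t / (a1 - c1 * t))).
Proof.
move=> late; have lM12 : l < 2 * a1 + 2 * c2 * t.
  by have := late1; have := early2; have := a2_gt0; have := a1_gt0; have := c1t; have := c2t;
    rewrite -l2; lra.
have h1 := sqrt_decayB (decayJ lJ2) (decayM c2_gt0 lM22).
have h2 := sqrt_decayB (decayM0 c1_gt0 lM01) (decayM c1_gt0 lM11).
have h := sqrt_decayD (sqrt_decayD (sqrt_decayD decayT0 h1) h2) (decayM c2_gt0 lM12).
apply: (sqrt_decay_eq h); first by rewrite /kappa l1.
  rewrite -!mulrBr -!mulrDr; congr (K * _).
  have -> : 2 * a2 - l = a2 - c2 * t by rewrite -l2; ring.
  have -> : 2 * a2 + 2 * c2 * t - l = l by rewrite -l2; ring.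
  have -> : 2 * c1 * t - l = - (a1 - c1 * t) by rewrite -l1; ring.
  have -> : 2 * a1 + 2 * c1 * t - l = l by rewrite -l1; ring.
  have -> : 2 * a1 + 2 * c2 * t - l = 2 * a1 - a2 + c2 * t by rewrite -l2; ring.
  by rewrite l1 invrN; ring.
by move=> N N0; rewrite p_decomp.
Qed.

Let exp_rate a := (a + c2 * t) ^+ 2 / (2 * t) + 2 * a1 * c1.

Let kappaE : exp_rate (a2 - 2 * a1) = kappa.
Proof.
rewrite /exp_rate /kappa -l1.
have -> : a2 - 2 * a1 + c2 * t = c1 * t - a1.
  by transitivity (l - 2 * a1); [rewrite -l2|rewrite -l1]; ring.
by field; rewrite gt_eqF.
Qed.

(** Here M12 is at its critical exponent alpha t = l and dominates by a factor sqrt N. *)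
Lemma decay_between_image_at : a2 - 2 * a1 = c2 * t ->
  exp_decay p (2 * (a1 * (c1 - 2 * c2) + a2 * c2)) (1 / 2).
Proof.
move=> e; have e2 : (2 * a1 / t + 2 * c2) * t = l.
  by rewrite mulrDl divfK ?gt_eqF// -l2 -mulrA -e; ring.
have hY := recrossing_exp_decay_half t0 s0 c2_gt0 e2.
have -> : 2 * (a1 * (c1 - 2 * c2) + a2 * c2) = kappa.
  rewrite -kappaE /exp_rate; have -> : a2 = 2 * a1 + c2 * t by move: e; lra.
  by field; rewrite gt_eqF.
apply: (exp_decay_sandwich (lexx _) hY decay_rest decay_rest) => N N0; cbv beta.
have /andP[lo hi] := sandwich N0; apply/andP; split => //.
apply: le_trans lo; rewrite gerBl.
by rewrite !addr_ge0.
Qed.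

Section free_endpoint.
Context (late : c2 * t < a2 - 2 * a1).

Let Y (N : nat) := expR (- (2 * a1 * c1) * N%:R) * H (a2 - 2 * a1) c2 N.
Let E (N : nat) := expR (- (2 * a1 * c1) * N%:R) * hit (a2 - 2 * a1) c2 t N%:R.

Let b_gt0 : 0 < a2 - 2 * a1. Proof. exact: lt_trans late. Qed.

Let sandwichY N : (0 < N)%N -> Y N - E N <= p N <= Y N + (T0 N + J a2 N + M0 c1 N).
Proof.
move=> N0; have n0 : 0 < N%:R :> R by rewrite ltr0n.
have eb : c1 * t - a1 = a2 - 2 * a1 + c2 * t.
  by transitivity (l - 2 * a1); [rewrite -l1|rewrite -l2]; ring.
have /andP[] := recrossing_hit t0 s0 n0 eb l1.
have /andP[] := sandwich N0; rewrite -/(M a1 c2 N) -/(Y N) -/(E N) => lo hi err0 err.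
apply/andP; move: lo hi err0 err (T0_ge0 N) (J_ge0 a2 N) (M0_ge0 c1 N).
by generalize (Y N) (E N) (p N); lra_at N.
Qed.

Let decayE : exists C, sqrt_decay E kappa C.
Proof.
have b0 : 0 < a2 - 2 * a1 + c2 * t by rewrite addr_gt0.
have h := sqrt_decay_mul (2 * a1 * c1) (hit_sqrt_decay t0 b0 late).
by eexists; apply: (sqrt_decay_eq h); [rewrite -kappaE /exp_rate addrC|reflexivity|].
Qed.

Lemma decay_between_T_before_image : T < (a2 - 2 * a1) / c2 ->
  sqrt_decay p (((2 * a1 - a2 - c2 * T) ^+ 2 + 4 * a1 * c1 * T) / (2 * T))
   (K * (Num.sqrt T / ((a2 - 2 * a1) - c2 * T) - Num.sqrt T / ((2 * a1 - a2) - c2 * T))).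
Proof.
rewrite ltr_pdivlMr// mulrC => Ta; have [C hE] := decayE.
have b0 : 0 < a2 - 2 * a1 + c2 * T by rewrite addr_gt0// mulr_gt0.
have hY := sqrt_decay_mul (2 * a1 * c1) (hit_sqrt_decay T_gt0 b0 Ta).
have kk : 2 * a1 * c1 + (a2 - 2 * a1 + c2 * T) ^+ 2 / (2 * T) < kappa.
  rewrite -kappaE /exp_rate addrC ltrD2r; apply: hit_rate_decr => //; exact: ltW.
apply: (sqrt_decay_eq (sqrt_decay_sandwich kk hY hE decay_rest sandwichY)).
- by field; rewrite gt_eqF.
- congr (K * _); have -> : 2 * a1 - a2 - c2 * T = - (a2 - 2 * a1 + c2 * T) by ring.
  by rewrite invrN; ring.
- by [].
Qed.

Let rate : 2 * a1 * c1 + 2 * (a2 - 2 * a1) * c2 <= kappa.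
Proof. by rewrite -kappaE /exp_rate addrC lerD2r; exact: hit_rate_le. Qed.

Let rateE : 2 * a1 * c1 + 2 * (a2 - 2 * a1) * c2 = 2 * (a1 * (c1 - 2 * c2) + a2 * c2).
Proof. by ring. Qed.

Lemma decay_between_T_at_image : T = (a2 - 2 * a1) / c2 ->
  exp_decay p (2 * (a1 * (c1 - 2 * c2) + a2 * c2)) (1 / 2).
Proof.
move=> eT; have [C hE] := decayE.
have e : a2 - 2 * a1 = c2 * T by rewrite eT [c2 * _]mulrC divfK// gt_eqF.
have hY := exp_decay_mul (2 * a1 * c1) (hit_exp_decay_half T_gt0 c2_gt0 e).
rewrite -rateE; exact: (exp_decay_sandwich rate hY hE decay_rest sandwichY).
Qed.

Lemma decay_between_T_after_image : (a2 - 2 * a1) / c2 < T ->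
  exp_decay p (2 * (a1 * (c1 - 2 * c2) + a2 * c2)) 1.
Proof.
rewrite ltr_pdivrMr// [T * c2]mulrC => Ta; have [C hE] := decayE.
have hY := exp_decay_mul (2 * a1 * c1) (hit_exp_decay T_gt0 b_gt0 Ta).
rewrite -rateE; exact: (exp_decay_sandwich rate hY hE decay_rest sandwichY).
Qed.

End free_endpoint.
End between_exits.

(** Here J2 is at its critical exponent alpha t = l and dominates by a factor sqrt N. *)
Lemma decay_at_second : a1 < c1 * t -> a2 = c2 * t -> exp_decay p (2 * a2 * c2) (1 / 2).
Proof.
move=> late1 e2.
have -> : 2 * a2 * c2 = kappa by rewrite /kappa -l2 e2; field; rewrite gt_eqF.
have hY : exp_decay (J a2) kappa (1 / 2).
  apply: tilted_exp_decay_half => //.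
  by rewrite divfK ?gt_eqF// -l2 -e2; ring.
have lM01 : l < 2 * c1 * t.
  by have := a1_gt0; have := a1_lt_a2; have := c1t; have := c2t; rewrite -l1; lra.
have lM22 : l < 2 * a2 + 2 * c2 * t.
  by have := a1_gt0; have := a1_lt_a2; have := c1t; have := c2t; rewrite -l2; lra.
have lM12 : l < 2 * a1 + 2 * c2 * t.
  by have := a1_gt0; have := a1_lt_a2; have := c1t; have := c2t; rewrite -l2; lra.
have hF := sqrt_decayD (sqrt_decayD decayT0 (decayM0 c1_gt0 lM01)) (decayM c2_gt0 lM12).
apply: (exp_decay_sandwich (lexx _) hY (decayM c2_gt0 lM22) hF) => N N0; cbv beta.
rewrite p_decomp//; apply/andP.
have := M_le_M0 c1 a1_gt0 N0; have := T0_ge0 N; have := M_ge0 a1 c2 N.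
have := M_ge0 a2 c2 N; have := M_ge0 a1 c1 N.
by lra_at N.
Qed.

Lemma decay_after_second : a2 < c2 * t -> exp_decay p (2 * a2 * c2) 1.
Proof.
move=> late2; have lM02 : l < 2 * c2 * t.
  by have := a1_gt0; have := a1_lt_a2; have := c1t; have := c2t; rewrite -l2; lra.
have rate : 2 * a2 * c2 <= kappa by rewrite /kappa -l2; exact: hit_rate_le.
have aT : a2 < c2 * T by rewrite (lt_trans late2)// ltr_pM2l.
have hY : exp_decay (H a2 c2) (2 * a2 * c2) 1 := hit_exp_decay T_gt0 a2_gt0 aT.
have hE := decayM0 c2_gt0 lM02.
apply: (exp_decay_sandwich rate hY hE hE) => N N0; cbv beta.
have := p_le_hit2 N0; have := hit2_decomp N0; rewrite p_decomp// => -> h; apply/andP; move: h.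
have := M_le_M0 c1 a1_gt0 N0; have := M_ge0 a1 c2 N; have := M0_ge0 c2 N.
by lra_at N.
Qed.

End cases.

(** * Asymptotics of the double crossing probability *)

Theorem theorem2p5 (R : realType) (d : measure_display)
    (Omega : measurableType d) (P : probability Omega R)
    (B : nat -> R -> {RV P >-> R})
    (B_brownian : forall k : nat, standard_brownian_motion (B k))
    (B_independent : mutually_independent_processes B)
    (T a1 a2 c1 c2 : R)
    (T_gt0 : 0 < T) (c2_gt0 : 0 < c2) (c2_lt_c1 : c2 < c1)
    (a1_gt0 : 0 < a1) (a1_lt_a2 : a1 < a2) :
  let tstar := (a2 - a1) / (c1 - c2) in
  let t1 := a1 / c1 in
  let t2 := a2 / c2 in
  let ttilde := (a2 - 2 * a1) / c2 in
  let psiT := psi B a1 a2 c1 c2 T in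
  tstar < T ->
  (* (i,a) *)
  (tstar < t1 -> T < t1 ->
    asymp_equiv psiT (fun N =>
      1 / Num.sqrt (2 * pi)
      * (Num.sqrt T / (a1 + c1 * T) + Num.sqrt T / (a1 - c1 * T))
      * (1 / Num.sqrt N%:R)
      * expR (- ((a1 + c1 * T) ^+ 2 / (2 * T)) * N%:R)))
  /\
  (* (i,b) *)
  (tstar < t1 -> T = t1 ->
    asymp_equiv psiT (fun N => 1 / 2 * expR (- 2 * a1 * c1 * N%:R)))
  /\
  (* (i,c) *)
  (tstar < t1 -> T > t1 ->
    asymp_equiv psiT (fun N => expR (- 2 * a1 * c1 * N%:R)))
  /\
  (* (ii) *)
  (t1 = tstar ->
    asymp_equiv psiT (fun N => 1 / 2 * expR (- 2 * a1 * c1 * N%:R)))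
  /\
  (* (iii,a) *)
  (t1 < tstar -> tstar < t2 -> T < ttilde ->
    asymp_equiv psiT (fun N =>
      1 / Num.sqrt (2 * pi)
      * (Num.sqrt T / ((a2 - 2 * a1) - c2 * T)
         - Num.sqrt T / ((2 * a1 - a2) - c2 * T))
      * (1 / Num.sqrt N%:R)
      * expR (- (((2 * a1 - a2 - c2 * T) ^+ 2 + 4 * a1 * c1 * T) / (2 * T))
              * N%:R)))
  /\
  (* (iii,b) *)
  (t1 < tstar -> tstar < t2 -> T = ttilde ->
    asymp_equiv psiT (fun N =>
      1 / 2 * expR (- 2 * (a1 * (c1 - 2 * c2) + a2 * c2) * N%:R)))
  /\
  (* (iii,c) *)
  (t1 < tstar -> tstar < t2 -> T > ttilde -> ttilde < tstar ->
    asymp_equiv psiT (fun N =>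
      1 / Num.sqrt (2 * pi)
      * (Num.sqrt tstar / (a2 - c2 * tstar)
         + Num.sqrt tstar / ((2 * a1 - a2) + c2 * tstar)
         - Num.sqrt tstar / (a1 + c1 * tstar)
         - Num.sqrt tstar / (a1 - c1 * tstar))
      * (1 / Num.sqrt N%:R)
      * expR (- ((a1 + c1 * tstar) ^+ 2 / (2 * tstar)) * N%:R)))
  /\
  (* (iii,d) *)
  (t1 < tstar -> tstar < t2 -> T > ttilde -> ttilde = tstar ->
    asymp_equiv psiT (fun N =>
      1 / 2 * expR (- 2 * (a1 * (c1 - 2 * c2) + a2 * c2) * N%:R)))
  /\
  (* (iii,e) *)
  (t1 < tstar -> tstar < t2 -> T > ttilde -> ttilde > tstar ->
    asymp_equiv psiT (fun N =>
      expR (- 2 * (a1 * (c1 - 2 * c2) + a2 * c2) * N%:R)))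
  /\
  (* (iv) *)
  (t1 < t2 -> t2 = tstar ->
    asymp_equiv psiT (fun N => 1 / 2 * expR (- 2 * a2 * c2 * N%:R)))
  /\
  (* (v) *)
  (t2 < tstar ->
    asymp_equiv psiT (fun N => expR (- 2 * a2 * c2 * N%:R))).
Proof.
move=> t t1 t2 tt psiT tT.
have c12 : 0 < c1 - c2 by rewrite subr_gt0.
have c1_gt0 : 0 < c1 by exact: lt_trans c2_lt_c1.
have a2_gt0 : 0 < a2 by exact: lt_trans a1_lt_a2.
have t0 : 0 < t by rewrite divr_gt0// subr_gt0.
have s0 : 0 < T - t by rewrite subr_gt0.
have l2 : a2 + c2 * t = a1 + c1 * t.
  have e : (c1 - c2) * t = a2 - a1 by rewrite mulrC divfK// gt_eqF.
  by move: e; rewrite mulrBl; lra.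
set l := a1 + c1 * t in l2; have l1 : a1 + c1 * t = l by [].
have TE : t + (T - t) = T by rewrite addrC subrK.
have D N (N0 : (0 < N)%N) := psi_decomposition B_brownian B_independent N0 t0 s0
  (ltW a1_gt0) (ltW a2_gt0) (ltW c2_gt0) c2_lt_c1 l1 l2.
have D1 N (N0 : (0 < N)%N) := hit_decomposition1 B_brownian B_independent N0 t0 s0
  (ltW a1_gt0) (ltW c2_gt0) c2_lt_c1 l1.
have D2 N (N0 : (0 < N)%N) := hit_decomposition2 B_brownian B_independent N0 t0 s0
  (ltW a2_gt0) (ltW c2_gt0) l1 l2.
have L1 N (N0 : (0 < N)%N) := psi_le_hit1 B_brownian B_independent N0 t0 s0
  (ltW a1_gt0) (ltW a2_gt0) (ltW c2_gt0) c2_lt_c1.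
have L2 N (N0 : (0 < N)%N) := psi_le_hit2 B_brownian B_independent N0 t0 s0
  c1 (ltW a1_gt0) (ltW a2_gt0) (ltW c2_gt0).
have early1 : (t < t1) = (c1 * t < a1) by rewrite /t1 ltr_pdivlMr// mulrC.
have late1 : (t1 < t) = (a1 < c1 * t) by rewrite /t1 ltr_pdivrMr// mulrC.
have early2 : (t < t2) = (c2 * t < a2) by rewrite /t2 ltr_pdivlMr// mulrC.
have late2 : (t2 < t) = (a2 < c2 * t) by rewrite /t2 ltr_pdivrMr// mulrC.
have early3 : (t < tt) = (c2 * t < a2 - 2 * a1) by rewrite /tt ltr_pdivlMr// [t * _]mulrC.
have late3 : (tt < t) = (a2 - 2 * a1 < c2 * t) by rewrite /tt ltr_pdivrMr// [t * _]mulrC.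
have K0 : 0 < 1 / Num.sqrt (2 * pi) :> R by rewrite divr_gt0 ?sqrtr_gt0 ?mulr_gt0 ?pi_gt0.
pose q := psi B a1 a2 c1 c2 (t + (T - t)).
have qE : psiT = q by rewrite /q TE.
have sT : 0 < Num.sqrt T by rewrite sqrtr_gt0.
have st : 0 < Num.sqrt t by rewrite sqrtr_gt0.
have half0 : 1 / 2 != 0 :> R by rewrite gt_eqF.
have r1 : - 2 * a1 * c1 = - (2 * a1 * c1) by ring.
have r2 : - 2 * a2 * c2 = - (2 * a2 * c2) by ring.
have r3 : - 2 * (a1 * (c1 - 2 * c2) + a2 * c2) = - (2 * (a1 * (c1 - 2 * c2) + a2 * c2)).
  by ring.
rewrite qE r1 r2 r3.
split.
  rewrite early1 -[in T < _]TE => e lT.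
  have h : sqrt_decay q _ _ := decay_before_first_T_before t0 s0 a1_gt0 c2_gt0 c2_lt_c1 l1 D D1 L1 e lT.
  rewrite TE in h lT; apply: sqrt_decay_asymp h; rewrite gt_eqF// mulr_gt0//.
  move: lT; rewrite ltr_pdivlMr// mulrC => lT.
  by rewrite addr_gt0// divr_gt0 ?subr_gt0// addr_gt0// mulr_gt0.
split.
  rewrite early1 -[in T = _]TE => e eT.
  have h : exp_decay q _ _ := decay_before_first_T_at t0 s0 c2_gt0 c2_lt_c1 l1 D D1 L1 e eT.
  exact: exp_decay_asymp h.
split.
  rewrite early1 -[in _ < T]TE => e gT.
  have h : exp_decay q _ _ := decay_before_first_T_after t0 s0 a1_gt0 c2_gt0 c2_lt_c1 l1 D D1 L1 e gT.
  exact: exp_decay_asymp1 h.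
split.
  move=> e; have e1 : a1 = c1 * t by rewrite -e /t1 mulrC divfK// gt_eqF.
  have h : exp_decay q _ _ := decay_at_first t0 s0 a1_gt0 a1_lt_a2 c2_gt0 c2_lt_c1 l1 D D1 e1.
  exact: exp_decay_asymp h.
split.
  rewrite late1 early2 => e1 e2 lT; have e3 := lt_trans tT lT; rewrite early3 in e3.
  rewrite -[in T < _]TE in lT.
  have h : sqrt_decay q _ _ :=
    decay_between_T_before_image t0 s0 a1_gt0 a1_lt_a2 c2_gt0 c2_lt_c1 l1 l2 D e1 e2 e3 lT.
  rewrite TE in h lT; apply: sqrt_decay_asymp h; rewrite gt_eqF// mulr_gt0//.
  move: lT; rewrite ltr_pdivlMr// [T * _]mulrC => lT.
  have c2T : 0 < c2 * T by rewrite mulr_gt0.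
  rewrite subr_gt0; apply: (@lt_trans _ _ 0); last by rewrite divr_gt0// subr_gt0.
  rewrite pmulr_rlt0// invr_lt0; lra.
split.
  rewrite late1 early2 => e1 e2 eT; have e3 := tT; rewrite eT early3 in e3.
  rewrite -[in T = _]TE in eT.
  have h : exp_decay q _ _ :=
    decay_between_T_at_image t0 s0 a1_gt0 a1_lt_a2 c2_gt0 c2_lt_c1 l1 l2 D e1 e2 e3 eT.
  exact: exp_decay_asymp h.
split.
  rewrite late1 early2 late3 => e1 e2 _ e3.
  have h : sqrt_decay q _ _ :=
    decay_between_image_before t0 s0 a1_gt0 a1_lt_a2 c2_gt0 c2_lt_c1 l1 l2 D e1 e2 e3.
  apply: sqrt_decay_asymp h; rewrite gt_eqF// mulr_gt0//.
  have c2t : 0 < c2 * t by rewrite mulr_gt0.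
  have l0 : 0 < a1 + c1 * t by rewrite l1 -l2 addr_gt0.
  rewrite subr_gt0; apply: (@lt_trans _ _ 0).
    by rewrite pmulr_rlt0// invr_lt0 subr_lt0.
  rewrite subr_gt0 -[ltLHS]addr0; apply: ltrD; last by rewrite divr_gt0//; lra.
  rewrite ltr_pM2l// ltf_pV2 ?posrE ?subr_gt0//.
  by rewrite l1 -l2; lra.
split.
  move=> + + _ e; rewrite late1 early2 => e1 e2.
  have e3 : a2 - 2 * a1 = c2 * t by rewrite -e /tt [c2 * _]mulrC divfK// gt_eqF.
  have h : exp_decay q _ _ :=
    decay_between_image_at t0 s0 a1_gt0 a1_lt_a2 c2_gt0 c2_lt_c1 l1 l2 D e1 e2 e3.
  exact: exp_decay_asymp h.
split.
  rewrite late1 early2 early3 -[in _ < T]TE => e1 e2 gT e3.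
  have h : exp_decay q _ _ :=
    decay_between_T_after_image t0 s0 a1_gt0 a1_lt_a2 c2_gt0 c2_lt_c1 l1 l2 D e1 e2 e3 gT.
  exact: exp_decay_asymp1 h.
split.
  move=> lt12 e; rewrite e late1 in lt12.
  have e2 : a2 = c2 * t by rewrite -e /t2 mulrC divfK// gt_eqF.
  have h : exp_decay q _ _ :=
    decay_at_second t0 s0 a1_gt0 a1_lt_a2 c2_gt0 c2_lt_c1 l1 l2 D lt12 e2.
  exact: exp_decay_asymp h.
rewrite late2 => e.
have h : exp_decay q _ _ :=
  decay_after_second t0 s0 a1_gt0 a1_lt_a2 c2_gt0 c2_lt_c1 l2 D D2 L2 e.
exact: exp_decay_asymp1 h.
Qed.
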